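(* Let $i,j,k,\ell\in\{0,1,\ldots,p-2\}$. Then, modulo projective direct summands (i.e. in the stable module category of $F\mathfrak{S}_p$), $$\Omega^k(D_i)\otimes \Omega^\ell(D_j)\;\cong\; \bigoplus_{t\in R(i,j)}\Omega^{k+\ell}(D_t).$$
   Context: $F$ is an algebraically closed field of prime characteristic $p$, and $\mathfrak{S}_p$ is the symmetric group on $p$ letters. Modules are finite-dimensional left modules; $\otimes$ is the tensor product over $F$ with diagonal group action. $S^\lambda$ denotes the (James) Specht module over $F$ labelled by a partition $\lambda$ of $p$; if $\lambda$ is $p$-regular (no part is repeated $p$ or more times), $D^\lambda=S^\lambda/\mathrm{Rad}(S^\lambda)$ is the corresponding simple module. For $0\le i\le p-2$ put $D_i=D^{(p-i,1^i)}$; these are the simple modules in the principal block of $F\mathfrak{S}_p$. Heller operators: $\Omega(M)$ is the kernel of a projective cover $\mathrm{P}(M)\twoheadrightarrow M$; $\Omega^i(M)=\Omega(\Omega^{i-1}(M))$ for $i\ge 2$; $\Omega^0(M)$ (the core of $M$) is the largest direct summand of $M$ having no nonzero projective direct summand. All are well defined up to isomorphism. The displayed isomorphism means that the core of the left-hand side is isomorphic to the right-hand side. For $i,j\in\{0,\ldots,p-2\}$ define $\ell_{i,j}=j-i$ if $i\le j$ and $\ell_{i,j}=i-j$ if $i>j$; define $r_{i,j}=i+j$ if $i\le p-2-j$ and $r_{i,j}=2p-4-i-j$ if $i>p-2-j$. Then $R(i,j)=\{\ell_{i,j}+2k : k\in\mathbb{Z},\ 0\le k\le (r_{i,j}-\ell_{i,j})/2\}$.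 *)

(* Defs.v *)
From mathcomp Require Import all_boot all_order all_algebra.
From mathcomp Require Import all_fingroup all_character.
From mathcomp Require Import boolp.

Set Implicit Arguments.
Unset Strict Implicit.
Unset Printing Implicit Defensive.

Import GroupScope GRing.Theory.
Local Open Scope ring_scope.

(* A finite-dimensional F[G]-module is a [representation F G]: G acts on row
   vectors by v |-> v *m M g.  Since the product of two permutations applies
   the left factor first, for G = 'S_n this is the action in James's
   convention, i.e. a left module when permutations are composed as functions. *)

Section Modules.

Variables (F : fieldType) (gT : finGroupType) (G : {group gT}).
Implicit Types M N P Q C : representation F G.

Definition mx_hom M N (f : 'M[F]_(rdegree M, rdegree N)) : Prop :=
  {in G, forall g, M g *m f = f *m N g}.

Definition prod_grepr M N : representation F G :=
  Representation (prod_repr M N).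

Definition is_summand C M : Prop :=
  exists N, mx_rsim M (dadd_grepr C N).

Definition projective P : Prop :=
  forall M N (q : 'M_(rdegree M, rdegree N)) (f : 'M_(rdegree P, rdegree N)),
    mx_hom q -> row_full q -> mx_hom f ->
  exists2 h : 'M_(rdegree P, rdegree M), mx_hom h & h *m q = f.

(* The last field says that the kernel of the map is superfluous. *)
Record projective_cover M := ProjectiveCover {
  cover_obj : representation F G;
  cover_map : 'M[F]_(rdegree cover_obj, rdegree M);
  cover_projective : projective cover_obj;
  cover_hom : mx_hom cover_map;
  cover_surj : row_full cover_map;
  cover_essential : forall U : 'M_(rdegree cover_obj),
    mxmodule cover_obj U -> row_full (U + kermx cover_map)%MS -> row_full U }.

Lemma mx_hom_mul M N P (f : 'M_(rdegree M, rdegree N))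
    (h : 'M_(rdegree N, rdegree P)) :
  mx_hom f -> mx_hom h -> mx_hom (f *m h).
Proof. by move=> hf hh g Gg; rewrite mulmxA (hf g Gg) -!mulmxA (hh g Gg). Qed.

Lemma projective_retract P Q (a : 'M_(rdegree Q, rdegree P))
    (b : 'M_(rdegree P, rdegree Q)) :
  mx_hom a -> mx_hom b -> a *m b = 1%:M -> projective P -> projective Q.
Proof.
move=> ha hb ab1 projP M N q f hq qfull hf.
have [h hh def_h] := projP M N q (b *m f) hq qfull (mx_hom_mul hb hf).
exists (a *m h); first exact: mx_hom_mul.
by rewrite -mulmxA def_h mulmxA ab1 mul1mx.
Qed.

Definition gring_grepr : representation F G :=
  Representation (regular_repr F G).

Definition gring_to M (v : 'rV_(rdegree M)) :
    'M_(rdegree gring_grepr, rdegree M) :=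
  \matrix_i (v *m M (enum_val i)).

Lemma gring_to_hom M (v : 'rV_(rdegree M)) : mx_hom (gring_to v).
Proof.
move=> g Gg; apply/row_matrixP=> i; rewrite !row_mul rowK.
rewrite -rowE !rowK gring_indexK ?groupM ?enum_valP //.
by rewrite repr_mxM ?enum_valP // mulmxA.
Qed.

Lemma gring_to_sub M (v : 'rV_(rdegree M)) : (v <= gring_to v)%MS.
Proof.
apply: (eq_row_sub (gring_index G 1%g)).
by rewrite rowK gring_indexK // repr_mx1 mulmx1.
Qed.

Lemma gring_projective : projective gring_grepr.
Proof.
move=> M N q f hq qfull hf.
have [w def_w]: exists w : 'rV_(rdegree M), row (gring_index G 1%g) f = w *m q.
  by apply/submxP/submx_full.
exists (gring_to w); first exact: gring_to_hom.
apply/row_matrixP=> i; rewrite row_mul rowK -mulmxA hq ?enum_valP //.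
rewrite mulmxA -def_w -row_mul -hf ?enum_valP // row_mul rowK -rowE.
by rewrite gring_indexK // mul1g gring_valK.
Qed.

Lemma dadd_projective P Q :
  projective P -> projective Q -> projective (dadd_grepr P Q).
Proof.
move=> projP projQ M N q f hq qfull hf.
have hfg g : g \in G ->
    P g *m usubmx f = usubmx f *m N g /\ Q g *m dsubmx f = dsubmx f *m N g.
  move=> Gg; have:= hf g Gg; rewrite -{1 2}[f]vsubmxK /= mul_block_col.
  by rewrite !mul0mx addr0 add0r mul_col_mx => /eq_col_mx.
have [h1 hh1 def1] := projP M N q (usubmx f) hq qfull (fun g Gg => (hfg g Gg).1).
have [h2 hh2 def2] := projQ M N q (dsubmx f) hq qfull (fun g Gg => (hfg g Gg).2).
exists (col_mx h1 h2); last by rewrite mul_col_mx def1 def2 vsubmxK.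
move=> g Gg; rewrite /= mul_block_col !mul0mx addr0 add0r mul_col_mx.
by rewrite hh1 // hh2.
Qed.

Lemma grepr0_projective : projective grepr0.
Proof.
move=> M N q f hq qfull hf; exists 0; last by rewrite [f]flatmx0 mul0mx.
by move=> g Gg; rewrite mulmx0 mul0mx.
Qed.

Lemma enough_projectives M :
  exists P, exists f : 'M_(rdegree P, rdegree M),
    [/\ projective P, mx_hom f & row_full f].
Proof.
suffices [P [f [projP hf /allP sub_f]]]: exists P,
    exists f : 'M_(rdegree P, rdegree M), [/\ projective P, mx_hom f
    & all (fun v : 'rV_(rdegree M) => v <= f)%MS
          [seq row i 1%:M | i <- enum 'I_(rdegree M)]].
  exists P, f; split=> //; rewrite -sub1mx; apply/row_subP=> i.
  by apply/sub_f/map_f; rewrite mem_enum.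
elim: (map _ _) => [|v s [P [f [projP hf sub_f]]]].
  exists grepr0, 0; split=> //; first exact: grepr0_projective.
  by move=> g Gg; rewrite mulmx0 mul0mx.
exists (dadd_grepr gring_grepr P), (col_mx (gring_to v) f); split.
- exact: dadd_projective gring_projective projP.
- move=> g Gg; rewrite /= mul_block_col !mul0mx addr0 add0r mul_col_mx.
  by rewrite (gring_to_hom v Gg) hf.
rewrite /= -addsmxE (submx_trans (gring_to_sub v) (addsmxSl _ _)) /=.
by apply: sub_all sub_f => w wf; rewrite -addsmxE (submx_trans wf) ?addsmxSr.
Qed.

Lemma projective_cover_exists M : exists _ : projective_cover M, True.
Proof.
pose good d := exists P, exists f : 'M_(rdegree P, rdegree M),
  [/\ projective P, mx_hom f, row_full f & rdegree P = d].
have exd: exists d, `[< good d >].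
  have [P [f [projP hf ffull]]] := enough_projectives M.
  by exists (rdegree P); apply/asboolP; exists P, f.
case: (ex_minnP exd) => d /asboolP[P [f [projP hf ffull def_d]]] dmin.
subst d.
suffices ess (U : 'M_(rdegree P)) :
    mxmodule P U -> row_full (U + kermx f)%MS -> row_full U.
  by exists (ProjectiveCover projP hf ffull ess).
move=> modU Ufull.
pose goodg r := exists g : 'M_(rdegree P),
  [/\ mx_hom g, (g <= U)%MS, g *m f = f & \rank g = r].
have exr: exists r, `[< goodg r >].
  pose SU := Representation (submod_repr modU).
  pose inc : 'M_(rdegree SU, rdegree P) := val_submod (1%:M : 'M_(\rank U)).
  have hinc: mx_hom inc.
    move=> x Gx; rewrite /inc -val_submodE.
    by rewrite -[submod_repr _ _]mul1mx val_submodJ.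
  have qfull: row_full (inc *m f).
    have: (1%:M <= (inc *m f))%MS.
      have [A def1]: exists A, 1%:M = A *m f by apply/submxP/submx_full.
      have: (A <= U + kermx f)%MS by apply: submx_full.
      case/sub_addsmxP=> [[u v] /= def_A].
      rewrite def1 def_A mulmxDl -(mulmxA v) mulmx_ker mulmx0 addr0 -mulmxA.
      apply: submx_trans (submxMl _ _) _; apply: submxMr.
      by rewrite /inc val_submod1.
    by rewrite sub1mx.
  have [h hh def_h] := projP SU M (inc *m f) f (mx_hom_mul hinc hf) qfull hf.
  exists (\rank (h *m inc)); apply/asboolP; exists (h *m inc); split=> //.
  - exact: mx_hom_mul.
  - by rewrite (submx_trans (submxMl _ _)) // /inc val_submod1.
  by rewrite -mulmxA.
case: (ex_minnP exr) => r /asboolP[g [hg gU gf rg]] rmin; subst r.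
have rgg: \rank (g *m g) = \rank g.
  apply/eqP; rewrite eqn_leq mxrankM_maxr rmin //; apply/asboolP.
  exists (g *m g); split=> //; first exact: mx_hom_mul.
    exact: submx_trans (submxMl _ _) gU.
  by rewrite -mulmxA !gf.
have modg: mxmodule P g by apply/mxmoduleP=> x Gx; rewrite -hg // submxMl.
pose SG := Representation (submod_repr modg).
pose inc : 'M_(rdegree SG, rdegree P) := val_submod (1%:M : 'M_(\rank g)).
pose prj : 'M_(rdegree P, rdegree SG) := in_submod g g.
have prj_inc: prj *m inc = g by rewrite /prj /inc -val_submodE in_submodK.
have hinc: mx_hom inc.
  move=> x Gx; rewrite /inc -val_submodE.
  by rewrite -[submod_repr _ _]mul1mx val_submodJ.
have hprj: mx_hom prj.
  move=> x Gx; rewrite /prj -in_submodJ // in_submodE mulmxA -in_submodE.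
  by rewrite hg.
pose th := inc *m prj.
have th_unit: th \in unitmx.
  rewrite -row_free_unit -row_leq_rank -[X in (X <= _)%N]/(\rank g) -rgg.
  rewrite -{1 2}prj_inc mulmxA -(mulmxA prj) -/th.
  exact: leq_trans (mxrankM_maxl _ _) (mxrankM_maxr _ _).
have hth: mx_hom th := mx_hom_mul hinc hprj.
have hthV: mx_hom (M := SG) (N := SG) (invmx th).
  move=> x Gx; rewrite -[LHS]mul1mx -(mulVmx th_unit) -mulmxA (mulmxA th).
  by rewrite -(hth x Gx) -(mulmxA _ th) mulmxV // mulmx1.
have projSG: projective SG.
  apply: projective_retract hinc (mx_hom_mul hprj hthV) _ projP.
  by rewrite mulmxA -/th mulmxV.
have leP: (rdegree P <= \rank g)%N.
  apply: dmin; apply/asboolP; exists SG, (inc *m f); split=> //.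
    exact: mx_hom_mul.
  rewrite -sub1mx (submx_trans (_ : 1%:M <= f)%MS) ?sub1mx //.
  by rewrite -{1}gf -prj_inc -mulmxA submxMl.
by rewrite -col_leq_rank (leq_trans leP) // mxrankS.
Qed.

Definition proj_cover M : projective_cover M :=
  projT1 (cid (projective_cover_exists M)).

Lemma cover_ker_module M (c : projective_cover M) :
  mxmodule (cover_obj c) (kermx (cover_map c)).
Proof.
apply/mxmoduleP=> g Gg; apply/sub_kermxP.
by rewrite -mulmxA cover_hom // mulmxA mulmx_ker mul0mx.
Qed.

Definition heller M : representation F G :=
  Representation (submod_repr (cover_ker_module (proj_cover M))).

Definition projective_free M : Prop :=
  forall P, projective P -> is_summand P M -> rdegree P = 0%N.

(* The core is determined up to isomorphism by Krull-Schmidt; "largest" is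
   measured by dimension. *)
Definition is_core M C : Prop :=
  [/\ is_summand C M, projective_free C
    & forall C', is_summand C' M -> projective_free C' ->
        (rdegree C' <= rdegree C)%N].

Lemma is_summand_degree M C : is_summand C M -> (rdegree C <= rdegree M)%N.
Proof. by case=> N [B def_n _ _]; rewrite def_n leq_addr. Qed.

Lemma core_exists M : exists C, is_core M C.
Proof.
pose good d :=
  exists C, [/\ is_summand C M, projective_free C & rdegree C = d].
have exd: exists d, `[< good d >].
  exists 0%N; apply/asboolP; exists grepr0; split=> //.
    exists M; exists 1%:M => //; first by rewrite row_free_unit unitmx1.
    move=> g Gg; rewrite mulmx1 mul1mx /=.
    apply/matrixP=> i j; rewrite !mxE; case: splitP => [[]// | i' def_i].
    rewrite !mxE; case: splitP => [[]// | j' def_j].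
    by congr (M g _ _); apply: val_inj.
  by move=> P projP /is_summand_degree; rewrite leqn0 => /eqP.
have ubd d : `[< good d >] -> (d <= rdegree M)%N.
  by case/asboolP=> C [sumC _ <-]; apply: is_summand_degree.
case: (ex_maxnP exd ubd) => d /asboolP[C [sumC freeC def_d]] dmax.
exists C; split=> // C' sumC' freeC'; rewrite def_d; apply: dmax.
by apply/asboolP; exists C'.
Qed.

Definition core M : representation F G := projT1 (cid (core_exists M)).

Definition omega (k : nat) M : representation F G :=
  if k is k'.+1 then iter k' heller (heller M) else core M.

(* R is the intersection of all maximal submodules of M. *)
Definition is_radical M (R : 'M_(rdegree M)) : Prop :=
  forall v : 'rV_(rdegree M), (v <= R)%MS <->
    (forall U, mxmodule M U -> max_submod M U 1%:M -> (v <= U)%MS).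

Arguments is_radical : clear implicits.

Lemma radical_exists M : exists R, is_radical M R.
Proof.
pose low m (A : 'M_(m, rdegree M)) :=
  forall U, mxmodule M U -> max_submod M U 1%:M -> (A <= U)%MS.
pose good r := exists2 R : 'M_(rdegree M), low _ R & \rank R = r.
have exr: exists r, `[< good r >].
  by exists 0%N; apply/asboolP; exists 0; [move=> U *; apply: sub0mx | rewrite mxrank0].
have ubr r : `[< good r >] -> (r <= rdegree M)%N.
  by case/asboolP=> R _ <-; apply: rank_leq_row.
case: (ex_maxnP exr ubr) => r /asboolP[R lowR def_r] rmax.
exists R => v; split=> [vR U modU maxU | lowv].
  exact: submx_trans vR (lowR U modU maxU).
have le_r: (\rank (R + v)%MS <= \rank R)%N.
  rewrite def_r; apply: rmax; apply/asboolP; exists (R + v)%MS => //.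
  by move=> U modU maxU; rewrite addsmx_sub lowR // lowv.
apply: submx_trans (addsmxSr R v) _.
by rewrite -(geq_leqif (mxrank_leqif_sup (addsmxSl R v))).
Qed.

Definition radical M : 'M[F]_(rdegree M) := projT1 (cid (radical_exists M)).

Lemma radical_module M : mxmodule M (radical M).
Proof.
have radP: is_radical M (radical M) := projT2 (cid (radical_exists M)).
apply/mxmoduleP=> g Gg; apply/row_subP=> i; rewrite row_mul.
apply/radP=> U modU maxU; apply: (mxmodule_trans modU Gg).
by move: U modU maxU; apply/radP; apply: row_sub.
Qed.

Definition head M : representation F G :=
  Representation (factmod_repr (radical_module M)).

End Modules.

Section Specht.

Variables (F : fieldType) (n : nat) (la : seq nat).

(* Let la be a partition of n.  The cells of its Young diagram are numbered
   0, ..., n-1 row by row, so that cell c lies in row [reshape_index la c] and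
   column [reshape_offset la c].  A la-tableau is a permutation t : 'S_n, with
   entry t c in cell c; then 'S_n acts on tableaux by right multiplication. *)
Implicit Types (t s : 'S_n) (x : 'I_n).

Definition row_of t x : nat := reshape_index la (t^-1%g x).
Definition col_of t x : nat := reshape_offset la (t^-1%g x).

Definition row_stab t : {set 'S_n} :=
  [set s : 'S_n | [forall x, row_of t (s x) == row_of t x]].
Definition col_stab t : {set 'S_n} :=
  [set s : 'S_n | [forall x, col_of t (s x) == col_of t x]].

Definition tabloid t : {set 'S_n} := [set (t * s)%g | s in row_stab t].
Definition tabloids : {set {set 'S_n}} := [set tabloid t | t : 'S_n].

Definition tabloid_mx (g : 'S_n) : 'M[F]_#|tabloids| :=
  \matrix_(i, j) (enum_val i :* g == enum_val j)%:R.

Definition tabloid_vec (A : {set 'S_n}) : 'rV[F]_#|tabloids| :=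
  \row_j (A == enum_val j)%:R.

Lemma row_stabJ t g s : ((s ^ g)%g \in row_stab (t * g)%g) = (s \in row_stab t).
Proof.
rewrite !inE; apply/forallP/forallP=> H x.
  by have:= H (g x); rewrite /row_of invMg /conjg !permM !permK.
by have:= H (g^-1%g x); rewrite /row_of invMg /conjg !permM !permK.
Qed.

Lemma col_stabJ t g s : ((s ^ g)%g \in col_stab (t * g)%g) = (s \in col_stab t).
Proof.
rewrite !inE; apply/forallP/forallP=> H x.
  by have:= H (g x); rewrite /col_of invMg /conjg !permM !permK.
by have:= H (g^-1%g x); rewrite /col_of invMg /conjg !permM !permK.
Qed.

Lemma tabloidM t g : tabloid t :* g = tabloid (t * g)%g.
Proof.
apply/setP=> u; rewrite mem_rcoset; apply/imsetP/imsetP=> [[s Rs def_u] | [s Rs ->]].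
  exists (s ^ g)%g; first by rewrite row_stabJ.
  by rewrite /conjg !mulgA mulgK -def_u mulgKV.
exists (s ^ g^-1)%g; last by rewrite /conjg invgK !mulgA.
by rewrite -(row_stabJ t g) conjgKV.
Qed.

Lemma tabloids_acts A g : A \in tabloids -> A :* g \in tabloids.
Proof. by case/imsetP=> t _ ->; rewrite tabloidM imset_f. Qed.

Lemma tabloid_vec_mx A g :
  A \in tabloids -> tabloid_vec A *m tabloid_mx g = tabloid_vec (A :* g).
Proof.
move=> tA; apply/rowP=> j; rewrite !mxE (bigD1 (enum_rank_in tA A)) //=.
rewrite !mxE enum_rankK_in // eqxx mul1r big1 ?addr0 // => i ne_i.
rewrite !mxE; case: eqP => [def_A|_]; last by rewrite mul0r.
by case/eqP: ne_i; apply: enum_val_inj; rewrite enum_rankK_in.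
Qed.

Lemma row_tabloid_mx i g : row i (tabloid_mx g) = tabloid_vec (enum_val i :* g).
Proof. by apply/rowP=> j; rewrite !mxE. Qed.

Lemma tabloid_mx_repr : mx_repr [set: 'S_n]%G tabloid_mx.
Proof.
split=> [|g h _ _].
  by apply/matrixP=> i j; rewrite !mxE mulg1 (inj_eq enum_val_inj).
apply/row_matrixP=> i; rewrite row_mul !row_tabloid_mx tabloid_vec_mx.
  by rewrite rcosetM.
exact: tabloids_acts (enum_valP i).
Qed.

Definition tabloid_repr : representation F [set: 'S_n]%G :=
  Representation (MxRepresentation tabloid_mx_repr).

Definition polytabloid t : 'rV[F]_#|tabloids| :=
  \sum_(s in col_stab t) (-1) ^+ (s : bool) *: tabloid_vec (tabloid t :* s).

Definition specht_mx : 'M[F]_#|tabloids| := (\sum_(t : 'S_n) <<polytabloid t>>)%MS.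

Lemma polytabloidM t g : polytabloid t *m tabloid_mx g = polytabloid (t * g)%g.
Proof.
rewrite /polytabloid mulmx_suml [RHS](reindex_inj (conjg_inj g)) /=.
apply: eq_big => [s|s Cs]; first by rewrite col_stabJ.
rewrite -scalemxAl tabloidM tabloid_vec_mx ?imset_f // !tabloidM odd_permJ.
congr (_ *: tabloid_vec (tabloid _)).
by rewrite /conjg !mulgA mulgK.
Qed.

Lemma specht_module : mxmodule tabloid_repr specht_mx.
Proof.
apply/mxmoduleP=> g _; rewrite sumsmxMr; apply/sumsmx_subP=> t _.
rewrite (eqmxMr _ (genmxE _)) /= polytabloidM (sumsmx_sup (t * g)%g) //.
by rewrite genmxE.
Qed.

Definition specht : representation F [set: 'S_n]%G :=
  Representation (submod_repr specht_module).

(* Simple when la is p-regular, p being the characteristic of F. *)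
Definition simple_mod : representation F [set: 'S_n]%G := head specht.

End Specht.

Definition hook (n i : nat) : seq nat := (n - i)%N :: nseq i 1%N.

Definition hook_simple (F : fieldType) (p i : nat) :
    representation F [set: 'S_p]%G := simple_mod F p (hook p i).

Definition ell (i j : nat) : nat := if (i <= j)%N then (j - i)%N else (i - j)%N.

Definition rr (p i j : nat) : nat :=
  if (i <= p - 2 - j)%N then (i + j)%N else (2 * p - 4 - i - j)%N.

(* For i, j <= p - 2, rr p i j - ell i j is an even natural number. *)
Definition Rset (p i j : nat) : seq nat :=
  [seq (ell i j + 2 * m)%N | m <- iota 0 ((rr p i j - ell i j)./2).+1].

(* Main.v *)
(* Call a map stably zero if it is a trace sum_g g^-1 th g; by Higman's criterion
   these are the maps through projectives.  Fitting's lemma shows that stably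
   isomorphic modules without projective summands are isomorphic, and Schanuel's
   lemma that Omega commutes stably with direct sums and with - (x) N, so it is
   enough to treat k = l = 0.

   D_i is realized inside the exterior algebra of F^p: with c_x and a_x the
   creation and annihilation operators, e = sum_x c_x and iota = sum_x a_x, it is
   the joint kernel of e and iota in degree i + 1 (James' argument shows that this
   is the unique simple quotient of the hook Specht module).  The operators
   c_x - c_o and a_x - a_o give explicit maps between D_1 (x) D_i and
   D_{i+1} (+) D_{i-1} (where D_{-1} = D_{p-1} = 0); one composite is the identity,
   and the other differs from it by a map through F^p (x) D_i, which is projective
   because the point stabilizer in S_p has order prime to p.  The general fusion
   rule follows by the Clebsch-Gordan recursion on i, cancelling direct summands
   whose endomorphism rings are division rings. *)
Require Import Defs.
From mathcomp Require Import all_boot all_order all_algebra.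
From mathcomp Require Import all_fingroup all_character.
From mathcomp Require Import boolp zify ring.

Set Implicit Arguments.
Unset Strict Implicit.
Unset Printing Implicit Defensive.

Import GRing.Theory.
Local Open Scope ring_scope.

(** * Stably zero maps *)

(** The operators [c_x - c_o] depend on a base point [o], and the lift of [1^perp / 1] to [F^p] is
    only linear, so nothing written over [F^p] is equivariant as it stands. Every defect is either
    constant in the index or a multiple of the all-ones vector, and the families in use sum to zero
    on harmonic vectors because [p = 0] in [F]; this kills the defects. The same relation makes [e]
    and [iota] anticommute. The error [Z] of the second composite does not visibly factor through
    [F^p (x) D_i]. Since the other composite is the identity, [Z^2 = -Z], and [Z^2] is a product of
    two equivariant maps through that module. James' argument enters as a generation property: a
    submodule of the Specht module not killed by the map to harmonic vectors is everything. It
    yields both the radical and the division property of endomorphisms. For cancellation, a corner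
    entry that is zero or invertible is all that block elimination asks for. *)

Section StableCategory.

Variables (F : fieldType) (gT : finGroupType) (G : {group gT}).
Local Notation rep := (representation F G).
Local Notation lin M N := ('M[F]_(rdegree M, rdegree N)).
Implicit Types L M N P Q : rep.

Definition gtrace M N (th : lin M N) : lin M N :=
  \sum_(g in G) M (g^-1)%g *m th *m N g.

Definition stably_zero M N (f : lin M N) : Prop :=
  exists th : lin M N, f = gtrace th.

Lemma gtrace_hom M N (th : lin M N) : mx_hom (gtrace th).
Proof.
move=> h Gh; rewrite mulmx_sumr mulmx_suml.
rewrite (reindex_inj (mulIg h)) /=; apply: eq_big => [g|g Gg].
  by rewrite groupMr.
have {}Gg: g \in G by rewrite groupMr in Gg.
rewrite invMg !repr_mxM ?groupV // !mulmxA -repr_mxM ?groupV // mulgV.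
by rewrite repr_mx1 mul1mx.
Qed.

Lemma gtrace_mull L M N (a : lin L M) (th : lin M N) :
  mx_hom a -> a *m gtrace th = gtrace (M := L) (a *m th).
Proof.
move=> ha; rewrite mulmx_sumr; apply: eq_bigr => g Gg.
by rewrite !mulmxA ha ?groupV.
Qed.

Lemma gtrace_mulr L M N (a : lin M N) (th : lin L M) :
  mx_hom a -> gtrace th *m a = gtrace (N := N) (th *m a).
Proof.
move=> ha; rewrite mulmx_suml; apply: eq_bigr => g Gg.
by rewrite -!mulmxA ha.
Qed.

Lemma gtraceD M N (a b : lin M N) : gtrace (a + b) = gtrace a + gtrace b.
Proof.
by rewrite -big_split; apply: eq_bigr => g _ /=; rewrite mulmxDr mulmxDl.
Qed.

Lemma gtraceN M N (a : lin M N) : gtrace (- a) = - gtrace a.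
Proof. by rewrite -sumrN; apply: eq_bigr => g _ /=; rewrite mulmxN mulNmx. Qed.

Lemma mx_hom1 M : mx_hom (M := M) (N := M) 1%:M.
Proof. by move=> g _; rewrite mulmx1 mul1mx. Qed.

Lemma mx_homD M N (a b : lin M N) : mx_hom a -> mx_hom b -> mx_hom (a + b).
Proof. by move=> ha hb g Gg; rewrite mulmxDr mulmxDl ha ?hb. Qed.

Lemma mx_homN M N (a : lin M N) : mx_hom a -> mx_hom (- a).
Proof. by move=> ha g Gg; rewrite mulmxN mulNmx ha. Qed.

Lemma mx_homB M N (a b : lin M N) : mx_hom a -> mx_hom b -> mx_hom (a - b).
Proof. by move=> ha hb; apply/mx_homD/mx_homN. Qed.

Lemma mx_hom0 M N : mx_hom (0 : lin M N).
Proof. by move=> g _; rewrite mulmx0 mul0mx. Qed.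

Lemma stably_zero0 M N : stably_zero (0 : lin M N).
Proof. by exists 0; rewrite /gtrace big1 // => g _; rewrite mulmx0 mul0mx. Qed.

Lemma stably_zeroD M N (a b : lin M N) :
  stably_zero a -> stably_zero b -> stably_zero (a + b).
Proof. by move=> [s ->] [t ->]; exists (s + t); rewrite gtraceD. Qed.

Lemma stably_zeroN M N (a : lin M N) : stably_zero a -> stably_zero (- a).
Proof. by move=> [s ->]; exists (- s); rewrite gtraceN. Qed.

Lemma stably_zeroB M N (a b : lin M N) :
  stably_zero a -> stably_zero b -> stably_zero (a - b).
Proof. by move=> za zb; apply/stably_zeroD/stably_zeroN. Qed.

Lemma stably_zero_mull L M N (a : lin L M) (b : lin M N) :
  mx_hom a -> stably_zero b -> stably_zero (M := L) (N := N) (a *m b).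
Proof. by move=> ha [s ->]; exists (a *m s); rewrite gtrace_mull. Qed.

Lemma stably_zero_mulr L M N (a : lin L M) (b : lin M N) :
  mx_hom b -> stably_zero a -> stably_zero (M := L) (N := N) (a *m b).
Proof. by move=> hb [s ->]; exists (s *m b); rewrite gtrace_mulr. Qed.

(* Higman's criterion. *)
Lemma trace_projective P : stably_zero (M := P) (N := P) 1%:M -> projective P.
Proof.
move=> [th def1] M N q f hq qfull hf.
have [s sq1] := row_fullP qfull.
(* The linear section [s] of [q] gives a linear lift of [th *m f]; its trace is equivariant and
   lifts [gtrace th *m f = f]. *)
exists (gtrace (M := P) (N := M) (th *m f *m s)); first exact: gtrace_hom.
rewrite gtrace_mulr // -!mulmxA sq1 mulmx1 -gtrace_mulr // -def1.
by rewrite mul1mx.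
Qed.

Lemma through_trace M N P (a : lin M P) (b : lin P N) :
    mx_hom a -> mx_hom b -> stably_zero (M := P) (N := P) 1%:M ->
  stably_zero (M := M) (N := N) (a *m b).
Proof.
move=> ha hb z1; rewrite -[a]mulmx1; apply: stably_zero_mulr hb _.
exact: stably_zero_mull ha z1.
Qed.

Lemma mx_rsim_homP M N :
  mx_rsim M N <-> exists f : lin M N, exists g : lin N M,
    [/\ mx_hom f, mx_hom g, f *m g = 1%:M & g *m f = 1%:M].
Proof.
split=> [|[f [g [hf hg fg gf]]]].
  case: M N => m M [n N] /= [B emn freeB homB]; case: n / emn N B freeB homB => N B.
  rewrite row_free_unit => uB homB; exists B, (invmx B).
  split; rewrite ?mulmxV ?mulVmx // => x Gx /=.
  by rewrite -[LHS]mul1mx -(mulVmx uB) -!mulmxA (mulmxA B) -homB // mulmxK.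
have rf : row_free f by apply/row_freeP; exists g.
have rg : row_free g by apply/row_freeP; exists f.
exists f => //; apply/eqP; rewrite eqn_leq.
rewrite -{1}(eqP rf) rank_leq_col -(eqP rg) rank_leq_col //.
Qed.

End StableCategory.

(** * Tensor products *)

(* The index of e_i (x) e_a in the basis underlying [tprod]. *)
Fixpoint pair_ord m n : 'I_m -> 'I_n -> 'I_(m * n) :=
  match m return 'I_m -> 'I_n -> 'I_(m * n) with
  | 0 => fun i => match notF (ltn_ord i) with end
  | m'.+1 => fun (i : 'I_(1 + m')) a =>
    match split i with
    | inl _ => lshift (m' * n) a
    | inr i' => rshift n (pair_ord i' a)
    end
  end.

Fixpoint unpair_ord m n : 'I_(m * n) -> 'I_m * 'I_n :=
  match m return 'I_(m * n) -> 'I_m * 'I_n with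
  | 0 => fun k => match notF (ltn_ord k) with end
  | m'.+1 => fun (k : 'I_(n + m' * n)) =>
    match split k with
    | inl a => (@lshift 1 m' ord0, a)
    | inr k' => let ia := unpair_ord k' in (@rshift 1 m' ia.1, ia.2)
    end
  end.

Lemma pair_ordK m n (i : 'I_m) (a : 'I_n) :
  unpair_ord (pair_ord i a) = (i, a).
Proof.
elim: m i => [[]//|m IHm] i /=.
rewrite -[i in RHS](@splitK 1 m).
case: (@split 1 m i) => [j|i'] /=.
  by rewrite (unsplitK (inl a)) (ord1 j).
by rewrite (unsplitK (inr (pair_ord i' a))) IHm.
Qed.

Lemma unpair_ordK m n (k : 'I_(m * n)) :
  pair_ord (unpair_ord k).1 (unpair_ord k).2 = k.
Proof.
elim: m k => [[]//|m IHm] k /=.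
rewrite -[k in RHS](@splitK n (m * n)).
case: (@split n (m * n) k) => [a|k'] /=.
  by rewrite (@unsplitK 1 m (inl ord0)).
by rewrite (@unsplitK 1 m (inr (unpair_ord k').1)) IHm.
Qed.

Variant pair_ord_spec m n : 'I_(m * n) -> Prop :=
  PairOrdSpec (i : 'I_m) (a : 'I_n) : pair_ord_spec (pair_ord i a).

Lemma pair_ordP m n (k : 'I_(m * n)) : pair_ord_spec k.
Proof. by rewrite -(unpair_ordK k). Qed.

Lemma sum_pair_ord (V : nmodType) m n (f : 'I_(m * n) -> V) :
  \sum_k f k = \sum_i \sum_a f (pair_ord i a).
Proof.
elim: m f => [|m IHm] f; first by rewrite !big_ord0.
rewrite (@big_split_ord _ _ _ n (m * n)) /= IHm.
rewrite (@big_split_ord _ _ _ 1 m) /= big_ord1.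
congr (_ + _); first by apply: eq_bigr => a _; rewrite (@unsplitK 1 m (inl ord0)).
apply: eq_bigr => i _; apply: eq_bigr => a _.
by rewrite (@unsplitK 1 m (inr i)).
Qed.

(** * Kronecker products and matrices in blocks *)

Section Kronecker.

Variable F : fieldType.

Lemma trow_pair n1 (A : 'rV[F]_n1) m n (B : 'M[F]_(m, n)) i k b :
  trow A B i (pair_ord k b) = A 0 k * B i b.
Proof.
elim: n1 A k => [A []//|n1 IHn A k] /=.
rewrite -[k in RHS](@splitK 1 n1).
case: (@split 1 n1 k) => [j|k'] /=; first by rewrite row_mxEl !mxE ord1.
by rewrite row_mxEr IHn mxE.
Qed.

Lemma tprodEpair m1 n1 (A : 'M[F]_(m1, n1)) m n (B : 'M[F]_(m, n)) i a k b :
  tprod A B (pair_ord i a) (pair_ord k b) = A i k * B a b.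
Proof.
elim: m1 A i => [A []//|m1 IHm A i] /=.
rewrite -[i in RHS](@splitK 1 m1).
case: (@split 1 m1 i) => [j|i'] /=; first by rewrite col_mxEu trow_pair !mxE ord1.
by rewrite col_mxEd IHm mxE.
Qed.

Lemma pair_mxP m n q (A B : 'M[F]_(m * n, q)) :
  (forall i a j, A (pair_ord i a) j = B (pair_ord i a) j) -> A = B.
Proof. by move=> eqAB; apply/matrixP=> k j; case: (pair_ordP k). Qed.

Lemma pair2_mxP m n q r (A B : 'M[F]_(m * n, q * r)) :
  (forall i a j b, A (pair_ord i a) (pair_ord j b)
                   = B (pair_ord i a) (pair_ord j b)) -> A = B.
Proof.
by move=> eqAB; apply/pair_mxP=> i a k; case: (pair_ordP k).
Qed.

Lemma tprodDl m1 n1 (A A' : 'M[F]_(m1, n1)) m n (B : 'M[F]_(m, n)) :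
  tprod (A + A') B = tprod A B + tprod A' B.
Proof.
by apply/pair2_mxP=> i a j b; rewrite [RHS]mxE !tprodEpair mxE mulrDl.
Qed.

Lemma tprodDr m1 n1 (A : 'M[F]_(m1, n1)) m n (B B' : 'M[F]_(m, n)) :
  tprod A (B + B') = tprod A B + tprod A B'.
Proof.
by apply/pair2_mxP=> i a j b; rewrite [RHS]mxE !tprodEpair mxE mulrDr.
Qed.

Lemma tprod0l m1 n1 m n (B : 'M[F]_(m, n)) : tprod (0 : 'M[F]_(m1, n1)) B = 0.
Proof.
by apply/pair2_mxP=> i a j b; rewrite [RHS]mxE !tprodEpair mxE mul0r.
Qed.

Lemma tprod0r m1 n1 m n (A : 'M[F]_(m1, n1)) : tprod A (0 : 'M[F]_(m, n)) = 0.
Proof.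
by apply/pair2_mxP=> i a j b; rewrite [RHS]mxE !tprodEpair mxE mulr0.
Qed.

Lemma tprod_suml (I : Type) (r : seq I) (P : pred I) m1 n1
    (A : I -> 'M[F]_(m1, n1)) m n (B : 'M[F]_(m, n)) :
  tprod (\sum_(i <- r | P i) A i) B = \sum_(i <- r | P i) tprod (A i) B.
Proof.
by apply: (big_morph (fun X => tprod X B)) => [X Y|];
   rewrite ?tprodDl ?tprod0l.
Qed.

Lemma tprod_sumr (I : Type) (r : seq I) (P : pred I) m1 n1
    (A : 'M[F]_(m1, n1)) m n (B : I -> 'M[F]_(m, n)) :
  tprod A (\sum_(i <- r | P i) B i) = \sum_(i <- r | P i) tprod A (B i).
Proof.
by apply: (big_morph (fun X => tprod A X)) => [X Y|];
   rewrite ?tprodDr ?tprod0r.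
Qed.

(** A family of maps [f i : X -> Y] read as one linear map [F^m (x) X -> Y], sending [e_i (x) v] to
    [v *m f i]. Dually, [block_row] packs a family [Y -> X] into a map [Y -> F^m (x) X]. *)
Definition block_col m n q (f : 'I_m -> 'M[F]_(n, q)) : 'M[F]_(m * n, q) :=
  \matrix_(k, j) f (unpair_ord k).1 (unpair_ord k).2 j.

Definition block_row m n q (f : 'I_m -> 'M[F]_(q, n)) : 'M[F]_(q, m * n) :=
  \matrix_(j, k) f (unpair_ord k).1 j (unpair_ord k).2.

Lemma block_colE m n q (f : 'I_m -> 'M[F]_(n, q)) i a j :
  block_col f (pair_ord i a) j = f i a j.
Proof. by rewrite mxE pair_ordK. Qed.

Lemma block_rowE m n q (f : 'I_m -> 'M[F]_(q, n)) i a j :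
  block_row f j (pair_ord i a) = f i j a.
Proof. by rewrite mxE pair_ordK. Qed.

Lemma eq_block_col m n q (f g : 'I_m -> 'M[F]_(n, q)) :
  f =1 g -> block_col f = block_col g.
Proof. by move=> eqfg; apply/pair_mxP=> i a j; rewrite !block_colE eqfg. Qed.

Lemma tprod_block_col m1 m2 n1 n2 q (A : 'M[F]_(m1, m2)) (B : 'M[F]_(n1, n2))
    (f : 'I_m2 -> 'M[F]_(n2, q)) :
  tprod A B *m block_col f = block_col (fun i => \sum_k A i k *: (B *m f k)).
Proof.
apply/pair_mxP=> i a j; rewrite block_colE !mxE sum_pair_ord summxE.
apply: eq_bigr => k _; rewrite !mxE mulr_sumr; apply: eq_bigr => b _.
by rewrite tprodEpair block_colE mulrA.
Qed.

Lemma block_row_tprod m1 m2 n1 n2 q (A : 'M[F]_(m1, m2)) (B : 'M[F]_(n1, n2))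
    (f : 'I_m1 -> 'M[F]_(q, n1)) :
  block_row f *m tprod A B = block_row (fun i => \sum_k A k i *: (f k *m B)).
Proof.
apply/matrixP=> j l; case: (pair_ordP l) => i a.
rewrite block_rowE !mxE sum_pair_ord summxE.
apply: eq_bigr => k _; rewrite !mxE mulr_sumr; apply: eq_bigr => b _.
by rewrite tprodEpair block_rowE mulrCA mulrA.
Qed.

Lemma block_col_mul m n q r (f : 'I_m -> 'M[F]_(n, q)) (C : 'M[F]_(q, r)) :
  block_col f *m C = block_col (fun i => f i *m C).
Proof.
apply/pair_mxP=> i a j; rewrite block_colE !mxE.
by apply: eq_bigr => k _; rewrite block_colE.
Qed.

Lemma mul_block_row m n q r (f : 'I_m -> 'M[F]_(q, n)) (C : 'M[F]_(r, q)) :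
  C *m block_row f = block_row (fun i => C *m f i).
Proof.
apply/matrixP=> j l; case: (pair_ordP l) => i a; rewrite block_rowE !mxE.
by apply: eq_bigr => k _; rewrite block_rowE.
Qed.

Lemma block_row_col m n q r (f : 'I_m -> 'M[F]_(q, n)) (g : 'I_m -> 'M[F]_(n, r)) :
  block_row f *m block_col g = \sum_k f k *m g k.
Proof.
apply/matrixP=> i j; rewrite !mxE sum_pair_ord summxE.
apply: eq_bigr => k _; rewrite !mxE; apply: eq_bigr => a _.
by rewrite block_rowE block_colE.
Qed.

End Kronecker.

(** * Traces under tensor products, and the converse of Higman's criterion *)

Section StableTensor.

Variables (F : fieldType) (gT : finGroupType) (G : {group gT}).
Local Notation rep := (representation F G).
Local Notation lin M N := ('M[F]_(rdegree M, rdegree N)).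
Implicit Types L M N P Q : rep.

Lemma tprod_hom M M' N N' (a : lin M M') (b : lin N N') :
  mx_hom a -> mx_hom b ->
  mx_hom (M := prod_grepr M N) (N := prod_grepr M' N') (tprod a b).
Proof. by move=> ha hb g Gg /=; rewrite -!tprodE ha ?hb. Qed.

(** Since [b] commutes with the group, conjugating [th (x) b] by [g] only conjugates [th], so the
    trace of [th (x) b] is the trace of [th] tensored with [b]. *)
Lemma stably_zero_tprodl M M' N N' (a : lin M M') (b : lin N N') :
  stably_zero a -> mx_hom b ->
  stably_zero (M := prod_grepr M N) (N := prod_grepr M' N') (tprod a b).
Proof.
move=> [th ->] hb; exists (tprod th b).
rewrite tprod_suml; apply: eq_bigr => g Gg /=.
rewrite -!tprodE hb ?groupV // -[b *m _ *m _]mulmxA -repr_mxM ?groupV //.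
by rewrite mulVg repr_mx1 mulmx1.
Qed.

Lemma stably_zero_tprodr M M' N N' (a : lin M M') (b : lin N N') :
  mx_hom a -> stably_zero b ->
  stably_zero (M := prod_grepr M N) (N := prod_grepr M' N') (tprod a b).
Proof.
move=> ha [th ->]; exists (tprod a th).
rewrite tprod_sumr; apply: eq_bigr => g Gg /=.
rewrite -!tprodE ha ?groupV // -[a *m _ *m _]mulmxA -repr_mxM ?groupV //.
by rewrite mulVg repr_mx1 mulmx1.
Qed.

(** The conjugates of the projection onto the basis vector 1 are the projections onto all basis
    vectors, each occurring once, so they add up to the identity. *)
Lemma gring_trace : stably_zero (M := gring_grepr F G) (N := gring_grepr F G) 1%:M.
Proof.
pose o : 'I_#|G| := gring_index G 1%g.
exists (delta_mx o o); apply/row_matrixP=> i.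
have act g x : g \in G -> x \in G ->
    delta_mx (0 : 'I_1) (gring_index G x) *m regular_mx F G g
    = delta_mx 0 (gring_index G (x * g)%g).
  by move=> Gg Gx; rewrite -rowE rowK gring_indexK.
rewrite [RHS]rowE /gtrace mulmx_sumr /= (bigD1 (enum_val i)) ?enum_valP //=.
rewrite big1 => [|g /andP[Gg ne_g]].
  rewrite addr0 !mulmxA -{2}[i]gring_valK act ?groupV ?enum_valP //.
  rewrite mulgV mul_delta_mx act ?enum_valP // mul1g gring_valK.
  by rewrite rowE mulmx1.
rewrite !mulmxA -{1}[i]gring_valK act ?groupV ?enum_valP //.
rewrite mul_delta_mx_cond; case: eqP => [/(congr1 enum_val)|]; last by rewrite mul0mx.
rewrite !gring_indexK ?groupM ?groupV ?enum_valP // => /eqP.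
by rewrite -eq_mulgV1 => /eqP eg; rewrite eg eqxx in ne_g.
Qed.

Lemma stably_zero_retract P Q (a : lin Q P) (b : lin P Q) :
    mx_hom a -> mx_hom b -> a *m b = 1%:M ->
    stably_zero (M := P) (N := P) 1%:M ->
  stably_zero (M := Q) (N := Q) 1%:M.
Proof. by move=> ha hb <- z1; apply: through_trace. Qed.

(** The augmentation tensored with [P] is a surjection [q] from [F[G] (x) P], which splits by
    projectivity. The identity of [F[G] (x) P] is a trace, and this passes to the retract [P]. *)
Lemma projective_trace P : projective P -> stably_zero (M := P) (N := P) 1%:M.
Proof.
move=> projP; pose Q := prod_grepr (gring_grepr F G) P.
pose q : lin Q P := block_col (fun _ => 1%:M).
have hq : mx_hom q.
  move=> g Gg; rewrite /= tprod_block_col block_col_mul.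
  apply: eq_block_col => i; rewrite mul1mx mulmx1 -scaler_suml.
  suff ->: \sum_k regular_mx F G g i k = 1 by rewrite scale1r.
  rewrite (bigD1 (gring_index G (enum_val i * g)%g)) //= big1 => [|k ne_k].
    by rewrite !mxE !eqxx addr0.
  by rewrite !mxE (negPf ne_k) andbF.
have qfull : row_full q.
  apply/row_fullP; exists (block_row (fun i => (i == gring_index G 1%g)%:R%:M)).
  rewrite block_row_col (bigD1 (gring_index G 1%g)) //= big1 => [|k /negPf->].
    by rewrite eqxx mulmx1 addr0.
  by rewrite mulmx1 raddf0.
have [h hh hq1] := projP _ _ q 1%:M hq qfull (mx_hom1 P).
apply: stably_zero_retract hh hq hq1 _.
rewrite /= -[1%:M]tprod1.
exact: stably_zero_tprodl gring_trace (mx_hom1 P).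
Qed.

Lemma projectiveP P : projective P <-> stably_zero (M := P) (N := P) 1%:M.
Proof. by split; [apply: projective_trace | apply: trace_projective]. Qed.

End StableTensor.

(** * Stable isomorphism *)

Section StableEquivalence.

Variables (F : fieldType) (gT : finGroupType) (G : {group gT}).
Local Notation rep := (representation F G).
Local Notation lin M N := ('M[F]_(rdegree M, rdegree N)).
Implicit Types C L M N P Q X Y : rep.

Lemma row_mx_hom L M N (f : lin L M) (g : lin L N) :
  mx_hom f -> mx_hom g -> mx_hom (M := L) (N := dadd_grepr M N) (row_mx f g).
Proof.
move=> hf hg x Gx; rewrite /= mul_mx_row mul_row_block !mulmx0 addr0 add0r.
by rewrite hf ?hg.
Qed.

Lemma col_mx_hom L M N (f : lin M L) (g : lin N L) :
  mx_hom f -> mx_hom g -> mx_hom (M := dadd_grepr M N) (N := L) (col_mx f g).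
Proof.
move=> hf hg x Gx; rewrite /= mul_block_col !mul0mx addr0 add0r mul_col_mx.
by rewrite hf ?hg.
Qed.

Lemma stably_zero_row L M N (f : lin L M) (g : lin L N) :
    stably_zero f -> stably_zero g ->
  stably_zero (M := L) (N := dadd_grepr M N) (row_mx f g).
Proof.
move=> [s ->] [t ->]; exists (row_mx s t); rewrite /gtrace.
elim/big_rec3: _ => [|x y1 y2 y3 Gx <-]; first by rewrite row_mx0.
by rewrite /= mul_mx_row mul_row_block !mulmx0 addr0 add0r add_row_mx.
Qed.

Lemma stably_zero_col L M N (f : lin M L) (g : lin N L) :
    stably_zero f -> stably_zero g ->
  stably_zero (M := dadd_grepr M N) (N := L) (col_mx f g).
Proof.
move=> [s ->] [t ->]; exists (col_mx s t); rewrite /gtrace.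
elim/big_rec3: _ => [|x y1 y2 y3 Gx <-]; first by rewrite col_mx0.
rewrite /= mul_block_col !mul0mx addr0 add0r mul_col_mx add_col_mx.
by [].
Qed.

Definition dadd_inl M N : lin M (dadd_grepr M N) := row_mx 1%:M 0.
Definition dadd_inr M N : lin N (dadd_grepr M N) := row_mx 0 1%:M.
Definition dadd_prl M N : lin (dadd_grepr M N) M := col_mx 1%:M 0.
Definition dadd_prr M N : lin (dadd_grepr M N) N := col_mx 0 1%:M.

Lemma dadd_inl_hom M N : mx_hom (dadd_inl M N).
Proof. exact: row_mx_hom (mx_hom1 M) (mx_hom0 M N). Qed.

Lemma dadd_inr_hom M N : mx_hom (dadd_inr M N).
Proof. exact: row_mx_hom (mx_hom0 N M) (mx_hom1 N). Qed.

Lemma dadd_prl_hom M N : mx_hom (dadd_prl M N).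
Proof. exact: col_mx_hom (mx_hom1 M) (mx_hom0 N M). Qed.

Lemma dadd_prr_hom M N : mx_hom (dadd_prr M N).
Proof. exact: col_mx_hom (mx_hom0 M N) (mx_hom1 N). Qed.

Lemma dadd_inlK M N : dadd_inl M N *m dadd_prl M N = 1%:M.
Proof. by rewrite mul_row_col mul1mx mul0mx addr0. Qed.

Lemma dadd_inrK M N : dadd_inr M N *m dadd_prr M N = 1%:M.
Proof. by rewrite mul_row_col mul1mx mul0mx add0r. Qed.

Lemma dadd_inl_prr M N : dadd_inl M N *m dadd_prr M N = 0.
Proof. by rewrite mul_row_col mulmx0 mul0mx addr0. Qed.

Lemma dadd_inr_prl M N : dadd_inr M N *m dadd_prl M N = 0.
Proof. by rewrite mul_row_col mulmx0 mul0mx addr0. Qed.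

Lemma dadd_sum1 M N :
  dadd_prl M N *m dadd_inl M N + dadd_prr M N *m dadd_inr M N = 1%:M.
Proof.
rewrite !mul_col_row !mulmx0 !mul0mx !mulmx1 add_block_mx !addr0 !add0r.
by rewrite -scalar_mx_block.
Qed.

(** The complement is the kernel of [b], and [1 - b a] is the projection onto it. *)
Lemma retract_summand C M (a : lin C M) (b : lin M C) :
  mx_hom a -> mx_hom b -> a *m b = 1%:M -> is_summand C M.
Proof.
move=> ha hb ab1.
have modK : mxmodule M (kermx b).
  apply/mxmoduleP=> g Gg; apply/sub_kermxP.
  by rewrite -mulmxA hb // mulmxA mulmx_ker mul0mx.
pose N : rep := Representation (submod_repr modK).
have sK : (1%:M - b *m a <= kermx b)%MS.
  by apply/sub_kermxP; rewrite mulmxBl mul1mx -mulmxA ab1 mulmx1 subrr.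
pose v : lin N M := val_submod 1%:M.
pose r : lin M N := in_submod (kermx b) (1%:M - b *m a).
have hv : mx_hom v.
  move=> x Gx; rewrite /v -val_submodE.
  by rewrite -[submod_repr _ _]mul1mx val_submodJ.
have hr : mx_hom r.
  move=> x Gx; rewrite /r -in_submodJ // in_submodE mulmxA -in_submodE.
  congr in_submod; rewrite mulmxBr mulmxBl mulmx1 mul1mx.
  by rewrite mulmxA hb // -!mulmxA ha.
exists N; apply/mx_rsim_homP.
exists (row_mx b r), (col_mx a v); split.
- exact: row_mx_hom.
- exact: col_mx_hom.
- by rewrite mul_row_col /r /v -val_submodE in_submodK // addrC subrK.
rewrite mul_col_row ab1.
have vb : v *m b = 0 by apply/sub_kermxP; rewrite /v val_submod1.
have -> : a *m r = 0.
  rewrite /r in_submodE mulmxA mulmxBr mulmx1 (mulmxA a b) ab1 mul1mx subrr.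
  by rewrite mul0mx.
rewrite vb.
have -> : v *m r = 1%:M.
  rewrite /r in_submodE mulmxA mulmxBr mulmx1 (mulmxA v b) vb mul0mx subr0.
  by rewrite -in_submodE val_submodK.
by rewrite -scalar_mx_block.
Qed.

Lemma summand_retract C M : is_summand C M ->
  exists a : lin C M, exists b : lin M C,
    [/\ mx_hom a, mx_hom b & a *m b = 1%:M].
Proof.
case=> N /mx_rsim_homP[f [g [hf hg fg gf]]].
exists (dadd_inl C N *m g), (f *m dadd_prl C N); split.
- exact: mx_hom_mul (dadd_inl_hom C N) hg.
- exact: mx_hom_mul hf (dadd_prl_hom C N).
by rewrite mulmxA -(mulmxA _ g) gf mulmx1 dadd_inlK.
Qed.

Definition mxpow n (e : 'M[F]_n) m := iter m (mulmx e) 1%:M.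

Lemma mxpowD n (e : 'M[F]_n) a b : mxpow e (a + b) = mxpow e a *m mxpow e b.
Proof.
elim: a => [|a IHa]; first by rewrite mul1mx.
by rewrite addSn /= -mulmxA -IHa.
Qed.

(** On the kernel of [1 + e] the map [e] is [-1], so its [m]-th power is invertible there as well as
    zero. *)
Lemma nilpotent_row_free n (e : 'M[F]_n) m :
  mxpow e m = 0 -> row_free (1%:M + e).
Proof.
move=> e0; rewrite -kermx_eq0; set K := kermx _.
have Ke : K *m e = - K.
  have := mulmx_ker (1%:M + e).
  by rewrite -/K mulmxDr mulmx1 addrC => /eqP; rewrite addr_eq0 => /eqP.
have : K *m mxpow e m = (-1) ^+ m *: K.
  elim: {e0}m => [|m IHm]; first by rewrite mulmx1 scale1r.
  by rewrite /= mulmxA Ke mulNmx IHm exprS mulN1r scaleNr.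
by rewrite e0 mulmx0 => /esym/eqP; rewrite scaler_eq0 signr_eq0.
Qed.

(* Fitting: on the stable image of a trace map, that map is invertible, so this
   summand is projective. *)
Lemma trace_nilpotent M (e : lin M M) :
  projective_free M -> mx_hom e -> stably_zero e -> exists m, mxpow e m = 0.
Proof.
move=> freeM he ze.
(* Exponents start at 1 because the power 0 is the identity, which need not be stably zero. Minimal
   rank forces [q] and [q *m q] to have the same rank. *)
pose good r := exists m, \rank (mxpow e m.+1) = r.
have exr : exists r, `[< good r >].
  by exists (\rank (mxpow e 1)); apply/asboolP; exists 0%N.
case: (ex_minnP exr) => r /asboolP[m def_r] rmin.
pose q : lin M M := mxpow e m.+1.
have hpow n : mx_hom (M := M) (N := M) (mxpow e n).
  by elim: n => [|n IHn]; [apply: mx_hom1 | apply: mx_hom_mul he IHn].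
have hq : mx_hom q by apply: hpow.
have zq : stably_zero q.
  exact: (stably_zero_mulr (hpow m) ze).
have rqq : \rank (q *m q) = \rank q.
  apply/eqP; rewrite eqn_leq mxrankM_maxr [X in (X <= _)%N]def_r rmin //.
  apply/asboolP; exists (m + m.+1)%N; rewrite /q -mxpowD.
  by rewrite addSn.
exists m.+1; apply/eqP; rewrite -mxrank_eq0 -/q; apply/eqP.
have modq : mxmodule M q by apply/mxmoduleP=> x Gx; rewrite -hq // submxMl.
pose SG : rep := Representation (submod_repr modq).
pose inc : lin SG M := val_submod 1%:M.
pose prj : lin M SG := in_submod q q.
have prj_inc : prj *m inc = q by rewrite /prj /inc -val_submodE in_submodK.
have hinc : mx_hom inc.
  move=> x Gx; rewrite /inc -val_submodE.
  by rewrite -[submod_repr _ _]mul1mx val_submodJ.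
have hprj : mx_hom prj.
  move=> x Gx; rewrite /prj -in_submodJ // in_submodE mulmxA -in_submodE.
  by rewrite hq.
(* [th] is [q] restricted to its own image; it is invertible because [q] and [q *m q] have equal
   rank. *)
pose th : lin SG SG := inc *m prj.
have th_unit : th \in unitmx.
  rewrite -row_free_unit -row_leq_rank -[X in (X <= _)%N]/(\rank q) -rqq.
  rewrite -{1 2}prj_inc mulmxA -(mulmxA prj) -/th.
  exact: leq_trans (mxrankM_maxl _ _) (mxrankM_maxr _ _).
have hth : mx_hom th := mx_hom_mul hinc hprj.
have hthV : mx_hom (M := SG) (N := SG) (invmx th).
  move=> x Gx; rewrite -[LHS]mul1mx -(mulVmx th_unit) -mulmxA (mulmxA th).
  by rewrite -(hth x Gx) -(mulmxA _ th) mulmxV // mulmx1.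
have def1 : inc *m (prj *m invmx th) = 1%:M by rewrite mulmxA mulmxV.
apply: (freeM SG); last first.
  exact: retract_summand hinc (mx_hom_mul hprj hthV) def1.
apply/trace_projective.
(* The identity of the image factors through the stably zero [q], so the image is projective. *)
have <- : (invmx th *m inc) *m q *m (prj *m invmx th) = 1%:M.
  transitivity (invmx th *m (th *m th) *m invmx th).
    by rewrite -[q in LHS]prj_inc /th !mulmxA.
  by rewrite mulmxA mulVmx // mul1mx mulmxV.
apply: stably_zero_mulr (mx_hom_mul hprj hthV) _.
exact: stably_zero_mull (mx_hom_mul hthV hinc) zq.
Qed.

Definition stably_iso M N : Prop :=
  exists f : lin M N, exists g : lin N M,
    [/\ mx_hom f, mx_hom g, stably_zero (M := M) (N := M) (f *m g - 1%:M)
      & stably_zero (M := N) (N := N) (g *m f - 1%:M)].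

Lemma stably_iso_sym M N : stably_iso M N -> stably_iso N M.
Proof. by case=> f [g [hf hg zf zg]]; exists g, f. Qed.

Lemma rsim_stably_iso M N : mx_rsim M N -> stably_iso M N.
Proof.
case/mx_rsim_homP=> f [g [hf hg fg gf]]; exists f, g.
by split; rewrite ?fg ?gf ?subrr //; apply: stably_zero0.
Qed.

Lemma stably_iso_refl M : stably_iso M M.
Proof. exact/rsim_stably_iso/mx_rsim_refl. Qed.

Lemma stably_zero_comp L M N (f : lin L M) (f' : lin M N) (g' : lin N M)
    (g : lin M L) :
    mx_hom f -> mx_hom g ->
    stably_zero (M := M) (N := M) (f' *m g' - 1%:M) ->
    stably_zero (M := L) (N := L) (f *m g - 1%:M) ->
  stably_zero (M := L) (N := L) ((f *m f') *m (g' *m g) - 1%:M).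
Proof.
move=> hf hg z' z.
have -> : (f *m f') *m (g' *m g) - 1%:M
          = f *m (f' *m g' - 1%:M) *m g + (f *m g - 1%:M).
  by rewrite mulmxBr mulmxBl mulmx1 addrA subrK !mulmxA.
apply: stably_zeroD z; apply: stably_zero_mulr hg _.
exact: stably_zero_mull hf z'.
Qed.

Lemma stably_iso_trans M L N :
  stably_iso L M -> stably_iso M N -> stably_iso L N.
Proof.
case=> f [g [hf hg fg gf]] [f' [g' [hf' hg' fg' gf']]].
exists (f *m f'), (g' *m g); split; try exact: mx_hom_mul.
  exact: stably_zero_comp.
exact: stably_zero_comp.
Qed.

Lemma stably_iso_dadd M M' N N' : stably_iso M M' -> stably_iso N N' ->
  stably_iso (dadd_grepr M N) (dadd_grepr M' N').
Proof.
case=> f [g [hf hg fg gf]] [f' [g' [hf' hg' fg' gf']]].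
exists (block_mx f 0 0 f'), (block_mx g 0 0 g').
have hom_diag (A A' B B' : rep) (a : lin A A') (b : lin B B') : mx_hom a -> mx_hom b ->
    mx_hom (M := dadd_grepr A B) (N := dadd_grepr A' B') (block_mx a 0 0 b).
  move=> ha hb; rewrite block_mxEv.
  exact: (@col_mx_hom (dadd_grepr A' B') A B (row_mx a 0) (row_mx 0 b)
    (row_mx_hom ha (mx_hom0 A B')) (row_mx_hom (mx_hom0 B A') hb)).
have z_diag (A B : rep) (a : lin A A) (b : lin B B) :
    stably_zero (M := A) (N := A) (a - 1%:M) ->
    stably_zero (M := B) (N := B) (b - 1%:M) ->
    stably_zero (M := dadd_grepr A B) (N := dadd_grepr A B)
      (block_mx a 0 0 b - 1%:M).
  move=> za zb; rewrite (scalar_mx_block _ _ 1) opp_block_mx add_block_mx.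
  rewrite !oppr0 !addr0 block_mxEv.
  exact: (@stably_zero_col (dadd_grepr A B) A B (row_mx _ 0) (row_mx 0 _)
    (stably_zero_row za (stably_zero0 A B)) (stably_zero_row (stably_zero0 B A) zb)).
split; try exact: hom_diag.
  rewrite mulmx_block !mulmx0 !mul0mx !addr0 !add0r; exact: z_diag.
rewrite mulmx_block !mulmx0 !mul0mx !addr0 !add0r; exact: z_diag.
Qed.

Lemma stably_iso_prod M M' N N' : stably_iso M M' -> stably_iso N N' ->
  stably_iso (prod_grepr M N) (prod_grepr M' N').
Proof.
case=> f [g [hf hg fg gf]] [f' [g' [hf' hg' fg' gf']]].
exists (tprod f f'), (tprod g g'); split; try exact: tprod_hom.
  rewrite -tprodE -[f *m g](subrK 1%:M) tprodDl -addrA; apply: stably_zeroD.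
    exact: stably_zero_tprodl fg (mx_hom_mul hf' hg').
  rewrite -[f' *m g'](subrK 1%:M) tprodDr tprod1 addrK.
  exact: stably_zero_tprodr (mx_hom1 M) fg'.
rewrite -tprodE -[g *m f](subrK 1%:M) tprodDl -addrA; apply: stably_zeroD.
  exact: stably_zero_tprodl gf (mx_hom_mul hg' hf').
rewrite -[g' *m f'](subrK 1%:M) tprodDr tprod1 addrK.
exact: stably_zero_tprodr (mx_hom1 M') gf'.
Qed.

(** Here [f g - 1] and [g f - 1] are stably zero endomorphisms of modules without projective
    summands, hence nilpotent, so [f g] and [g f] are injective. *)
Lemma projective_free_rsim M N :
  projective_free M -> projective_free N -> stably_iso M N -> mx_rsim M N.
Proof.
move=> freeM freeN [f [g [hf hg fg gf]]].
have row_free1 (L : rep) (e : lin L L) : projective_free L -> mx_hom e ->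
    stably_zero (M := L) (N := L) (e - 1%:M) -> row_free e.
  move=> freeL he ze.
  have [m e0] := trace_nilpotent freeL (mx_homB he (mx_hom1 L)) ze.
  by have := nilpotent_row_free e0; rewrite addrC subrK.
have ufg := row_free1 M _ freeM (mx_hom_mul hf hg) fg.
have ugf := row_free1 N _ freeN (mx_hom_mul hg hf) gf.
have rf : row_free f.
  by rewrite -row_leq_rank -{1}(eqP ufg) mxrankM_maxl.
have rg : row_free g.
  by rewrite -row_leq_rank -{1}(eqP ugf) mxrankM_maxl.
exists f => //; apply/eqP; rewrite eqn_leq.
by rewrite -{1}(eqP rf) rank_leq_col -(eqP rg) rank_leq_col.
Qed.

(** For a projective summand [P], the identity is [i1 r1 + i2 r2], through [M] and through [N]. Both
    terms are nilpotent by Fitting applied in [M] and in [N]; but then the second, being 1 minus a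
    nilpotent map, is also invertible, which forces [P = 0]. *)
Lemma projective_free_dadd M N :
  projective_free M -> projective_free N -> projective_free (dadd_grepr M N).
Proof.
move=> freeM freeN P /projectiveP z1 /summand_retract[i [r [hi hr ir1]]].
pose i1 : lin P M := i *m dadd_prl M N; pose r1 : lin M P := dadd_inl M N *m r.
pose i2 : lin P N := i *m dadd_prr M N; pose r2 : lin N P := dadd_inr M N *m r.
have hi1 : mx_hom i1 := mx_hom_mul hi (dadd_prl_hom M N).
have hi2 : mx_hom i2 := mx_hom_mul hi (dadd_prr_hom M N).
have hr1 : mx_hom r1 := mx_hom_mul (dadd_inl_hom M N) hr.
have hr2 : mx_hom r2 := mx_hom_mul (dadd_inr_hom M N) hr.
have sum1 : i1 *m r1 + i2 *m r2 = 1%:M.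
  rewrite /i1 /i2 -!mulmxA -mulmxDr (mulmxA _ _ r) (mulmxA _ _ r) -mulmxDl.
  by rewrite dadd_sum1 mul1mx.
have nil (L : rep) (a : lin P L) (b : lin L P) :
    projective_free L -> mx_hom a -> mx_hom b -> exists m, mxpow (a *m b) m = 0.
  move=> freeL ha hb.
  have [m e0] := trace_nilpotent freeL (mx_hom_mul hb ha) (through_trace hb ha z1).
  (* Nilpotency moves from [L] to [P] by [(a b)^(m+1) = a (b a)^m b]. *)
  exists m.+1; rewrite /mxpow iterSr -/(mxpow _ _) mulmx1.
  have -> n : iter n (mulmx (a *m b)) (a *m b) = a *m mxpow (b *m a) n *m b.
    elim: n => [|n IHn]; first by rewrite /= mulmx1.
    by rewrite /= IHn !mulmxA.
  by rewrite e0 mulmx0 mul0mx.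
have [m1 n1] := nil M i1 r1 freeM hi1 hr1.
have [m2 n2] := nil N i2 r2 freeN hi2 hr2.
have : row_free (i2 *m r2).
  have nN : mxpow (- (i1 *m r1)) m1 = 0.
    suff -> : mxpow (- (i1 *m r1)) m1 = (-1) ^+ m1 *: mxpow (i1 *m r1) m1.
      by rewrite n1 scaler0.
    elim: (m1) => [|m IHm]; first by rewrite scale1r.
    by rewrite /= IHm mulNmx -scalemxAr exprS mulN1r scaleNr.
  by have := nilpotent_row_free nN; rewrite -sum1 addrC addKr.
move=> free2; have : row_free (mxpow (i2 *m r2) m2).
  elim: (m2) => [|m IHm]; first by rewrite row_free_unit unitmx1.
  by rewrite /= -/(mxpow _ _) row_free_unit unitmx_mul -!row_free_unit free2.
by rewrite n2 /row_free mxrank0 => /eqP.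
Qed.

Lemma projective_free0 : projective_free (grepr0 : rep).
Proof. by move=> P _ /is_summand_degree; rewrite leqn0 => /eqP. Qed.

Lemma dadd_projective_stably_iso M P :
  projective P -> stably_iso (dadd_grepr M P) M.
Proof.
move=> /projectiveP z1; exists (dadd_prl M P), (dadd_inl M P); split.
- exact: dadd_prl_hom.
- exact: dadd_inl_hom.
- rewrite -dadd_sum1 opprD addrA subrr sub0r; apply: stably_zeroN.
  exact: through_trace (dadd_prr_hom M P) (dadd_inr_hom M P) z1.
by rewrite dadd_inlK subrr; apply: stably_zero0.
Qed.

Lemma summand_trans L M N : is_summand L M -> is_summand M N -> is_summand L N.
Proof.
move=> /summand_retract[a [b [ha hb ab1]]] /summand_retract[c [d [hc hd cd1]]].
apply: retract_summand (mx_hom_mul ha hc) (mx_hom_mul hd hb) _.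
by rewrite mulmxA -(mulmxA a) cd1 mulmx1.
Qed.

(** Reduces commutativity, associativity and distributivity of sums and tensor products to
    bijections between bases. *)
Lemma rsim_reindex M N (phi : 'I_(rdegree M) -> 'I_(rdegree N)) psi :
    cancel phi psi -> cancel psi phi ->
    (forall g, g \in G -> forall i j, M g i j = N g (phi i) (phi j)) ->
  mx_rsim M N.
Proof.
move=> phiK psiK eqMN; apply/mx_rsim_homP.
pose b : lin M N := \matrix_(i, j) (phi i == j)%:R.
pose c : lin N M := \matrix_(i, j) (psi i == j)%:R.
have bE m (A : 'M_(m, _)) i j : (A *m b) i j = A i (psi j).
  rewrite mxE (bigD1 (psi j)) //= big1 => [|k ne_k]; rewrite !mxE.
    by rewrite psiK eqxx mulr1 addr0.
  by case: eqP => [def_j|]; rewrite ?mulr0 //; rewrite -def_j phiK eqxx in ne_k.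
have cE m (A : 'M_(m, _)) i j : (A *m c) i j = A i (phi j).
  rewrite mxE (bigD1 (phi j)) //= big1 => [|k ne_k]; rewrite !mxE.
    by rewrite phiK eqxx mulr1 addr0.
  by case: eqP => [def_j|]; rewrite ?mulr0 //; rewrite -def_j psiK eqxx in ne_k.
have Eb m (A : 'M_(_, m)) i j : (b *m A) i j = A (phi i) j.
  rewrite mxE (bigD1 (phi i)) //= big1 => [|k ne_k]; rewrite !mxE.
    by rewrite eqxx mul1r addr0.
  by rewrite eq_sym (negPf ne_k) mul0r.
have Ec m (A : 'M_(_, m)) i j : (c *m A) i j = A (psi i) j.
  rewrite mxE (bigD1 (psi i)) //= big1 => [|k ne_k]; rewrite !mxE.
    by rewrite eqxx mul1r addr0.
  by rewrite eq_sym (negPf ne_k) mul0r.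
exists b, c; split=> [g Gg|g Gg||]; apply/matrixP=> i j.
- by rewrite bE Eb eqMN // psiK.
- by rewrite cE Ec eqMN // psiK.
- by rewrite cE !mxE (can_eq phiK).
by rewrite bE !mxE (can_eq psiK).
Qed.

Lemma dadd_comm M N : mx_rsim (dadd_grepr M N) (dadd_grepr N M).
Proof.
pose sw m n (k : 'I_(m + n)) : 'I_(n + m) :=
  match split k with inl i => rshift n i | inr j => lshift m j end.
have swl m n (i : 'I_m) : sw m n (lshift n i) = rshift n i.
  by rewrite /sw (unsplitK (inl i)).
have swr m n (i : 'I_n) : sw m n (rshift m i) = lshift m i.
  by rewrite /sw (unsplitK (inr i)).
have swK m n : cancel (sw m n) (sw n m).
  move=> k; rewrite -[k]splitK; case: (split k) => i /=.
    by rewrite swl swr.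
  by rewrite swr swl.
apply: (@rsim_reindex (dadd_grepr M N) (dadd_grepr N M) (sw _ _) (sw _ _)
         (swK _ _) (swK _ _)) => g _ i j.
rewrite -[i]splitK -[j]splitK.
by case: (split i) => i'; case: (split j) => j' /=; rewrite ?swl ?swr
  ?block_mxEul ?block_mxEur ?block_mxEdl ?block_mxEdr // !mxE.
Qed.

Lemma prod_assoc L M N :
  mx_rsim (prod_grepr (prod_grepr L M) N) (prod_grepr L (prod_grepr M N)).
Proof.
pose phi l m n (k : 'I_(l * m * n)) : 'I_(l * (m * n)) :=
  let ab := unpair_ord (unpair_ord k).1 in
  pair_ord ab.1 (pair_ord ab.2 (unpair_ord k).2).
pose psi l m n (k : 'I_(l * (m * n))) : 'I_(l * m * n) :=
  let bc := unpair_ord (unpair_ord k).2 in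
  pair_ord (pair_ord (unpair_ord k).1 bc.1) bc.2.
have phiE l m n (i : 'I_l) (j : 'I_m) (k : 'I_n) :
    phi l m n (pair_ord (pair_ord i j) k) = pair_ord i (pair_ord j k).
  by rewrite /phi !pair_ordK.
have psiE l m n (i : 'I_l) (j : 'I_m) (k : 'I_n) :
    psi l m n (pair_ord i (pair_ord j k)) = pair_ord (pair_ord i j) k.
  by rewrite /psi !pair_ordK.
apply: (@rsim_reindex (prod_grepr (prod_grepr L M) N)
          (prod_grepr L (prod_grepr M N)) (phi _ _ _) (psi _ _ _)).
- by move=> x; case: (pair_ordP x) => y k; case: (pair_ordP y) => i j; rewrite phiE psiE.
- by move=> x; case: (pair_ordP x) => i y; case: (pair_ordP y) => j k; rewrite psiE phiE.
move=> g _ x y.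
case: (pair_ordP x) => x' k; case: (pair_ordP x') => i j.
case: (pair_ordP y) => y' k'; case: (pair_ordP y') => i' j'.
by rewrite !phiE /= !tprodEpair mulrA.
Qed.

Lemma prod_daddl L M N :
  mx_rsim (prod_grepr (dadd_grepr L M) N)
          (dadd_grepr (prod_grepr L N) (prod_grepr M N)).
Proof.
pose phi l m n (k : 'I_((l + m) * n)) : 'I_(l * n + m * n) :=
  match split (unpair_ord k).1 with
  | inl i => lshift (m * n) (pair_ord i (unpair_ord k).2)
  | inr j => rshift (l * n) (pair_ord j (unpair_ord k).2) end.
pose psi l m n (k : 'I_(l * n + m * n)) : 'I_((l + m) * n) :=
  match split k with
  | inl x => pair_ord (lshift m (unpair_ord x).1) (unpair_ord x).2
  | inr x => pair_ord (rshift l (unpair_ord x).1) (unpair_ord x).2 end.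
have phil l m n (i : 'I_l) (a : 'I_n) :
    phi l m n (pair_ord (lshift m i) a) = lshift (m * n) (pair_ord i a).
  by rewrite /phi pair_ordK (unsplitK (inl i)).
have phir l m n (i : 'I_m) (a : 'I_n) :
    phi l m n (pair_ord (rshift l i) a) = rshift (l * n) (pair_ord i a).
  by rewrite /phi pair_ordK (unsplitK (inr i)).
have psil l m n (i : 'I_l) (a : 'I_n) :
    psi l m n (lshift (m * n) (pair_ord i a)) = pair_ord (lshift m i) a.
  by rewrite /psi (unsplitK (inl _)) pair_ordK.
have psir l m n (i : 'I_m) (a : 'I_n) :
    psi l m n (rshift (l * n) (pair_ord i a)) = pair_ord (rshift l i) a.
  by rewrite /psi (unsplitK (inr _)) pair_ordK.
apply: (@rsim_reindex (prod_grepr (dadd_grepr L M) N)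
          (dadd_grepr (prod_grepr L N) (prod_grepr M N)) (phi _ _ _) (psi _ _ _)).
- move=> x; case: (pair_ordP x) => y k; rewrite -[y]splitK.
  by case: (split y) => i /=; rewrite ?phil ?psil ?phir ?psir.
- move=> x; rewrite -[x]splitK.
  by case: (split x) => y /=; case: (pair_ordP y) => i k;
    rewrite ?psil ?psir ?phil ?phir.
move=> g _ x y.
case: (pair_ordP x) => x' k; case: (pair_ordP y) => y' k'.
rewrite -[x']splitK -[y']splitK.
by case: (split x') => i; case: (split y') => i' /=; rewrite !tprodEpair ?phil ?phir
  ?block_mxEul ?block_mxEur ?block_mxEdl ?block_mxEdr ?tprodEpair // !mxE mul0r.
Qed.

Lemma prod_daddr L M N :
  mx_rsim (prod_grepr N (dadd_grepr L M))
          (dadd_grepr (prod_grepr N L) (prod_grepr N M)).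
Proof.
pose phi l m n (k : 'I_(n * (l + m))) : 'I_(n * l + n * m) :=
  match split (unpair_ord k).2 with
  | inl i => lshift (n * m) (pair_ord (unpair_ord k).1 i)
  | inr j => rshift (n * l) (pair_ord (unpair_ord k).1 j) end.
pose psi l m n (k : 'I_(n * l + n * m)) : 'I_(n * (l + m)) :=
  match split k with
  | inl x => pair_ord (unpair_ord x).1 (lshift m (unpair_ord x).2)
  | inr x => pair_ord (unpair_ord x).1 (rshift l (unpair_ord x).2) end.
have phil l m n (i : 'I_l) (a : 'I_n) :
    phi l m n (pair_ord a (lshift m i)) = lshift (n * m) (pair_ord a i).
  by rewrite /phi pair_ordK (unsplitK (inl i)).
have phir l m n (i : 'I_m) (a : 'I_n) :
    phi l m n (pair_ord a (rshift l i)) = rshift (n * l) (pair_ord a i).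
  by rewrite /phi pair_ordK (unsplitK (inr i)).
have psil l m n (i : 'I_l) (a : 'I_n) :
    psi l m n (lshift (n * m) (pair_ord a i)) = pair_ord a (lshift m i).
  by rewrite /psi (unsplitK (inl _)) pair_ordK.
have psir l m n (i : 'I_m) (a : 'I_n) :
    psi l m n (rshift (n * l) (pair_ord a i)) = pair_ord a (rshift l i).
  by rewrite /psi (unsplitK (inr _)) pair_ordK.
apply: (@rsim_reindex (prod_grepr N (dadd_grepr L M))
          (dadd_grepr (prod_grepr N L) (prod_grepr N M)) (phi _ _ _) (psi _ _ _)).
- move=> x; case: (pair_ordP x) => k y; rewrite -[y]splitK.
  by case: (split y) => i /=; rewrite ?phil ?psil ?phir ?psir.
- move=> x; rewrite -[x]splitK.
  by case: (split x) => y /=; case: (pair_ordP y) => i k;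
    rewrite ?psil ?psir ?phil ?phir.
move=> g _ x y.
case: (pair_ordP x) => k x'; case: (pair_ordP y) => k' y'.
rewrite -[x']splitK -[y']splitK.
by case: (split x') => i; case: (split y') => i' /=; rewrite !tprodEpair ?phil ?phir
  ?block_mxEul ?block_mxEur ?block_mxEdl ?block_mxEdr ?tprodEpair // !mxE mulr0.
Qed.

Lemma rsim_degree0 M : rdegree M = 0%N -> mx_rsim M (grepr0 : rep).
Proof.
move=> M0; apply: (@rsim_reindex M (grepr0 : rep)
  (cast_ord M0) (cast_ord (esym M0))) => [i|i|g _ i].
- by rewrite cast_ordK.
- by rewrite cast_ordKV.
by have := ltn_ord i; rewrite [X in (_ < X)%N]M0.
Qed.

(** Induction on the dimension, splitting off one nonzero projective summand at a time; each removal
    is a stable isomorphism. *)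
Lemma projective_free_part M :
  exists C, [/\ projective_free C, is_summand C M & stably_iso M C].
Proof.
have [n] := ubnP (rdegree M); elim: n M => // n IHn M; rewrite ltnS => leMn.
have [freeM | notfree] := pselect (projective_free M).
  exists M; split=> //; last exact: stably_iso_refl.
  by apply: (retract_summand (mx_hom1 M) (mx_hom1 M)); rewrite mulmx1.
have [P [projP [N simM] P0]] : exists P, [/\ projective P, is_summand P M
     & rdegree P <> 0%N].
  apply: contrapT => no; apply: notfree => P projP sumP; apply: contrapT => P0.
  by case: no; exists P.
have degM : rdegree M = (rdegree P + rdegree N)%N by case: simM.
have [|C [freeC sumC isoNC]] := IHn N; first by lia.
have sumN : is_summand N M.
  have [f [g [hf hg fg gf]]] := (mx_rsim_homP _ _).1 simM.
  apply: (retract_summand (mx_hom_mul (dadd_inr_hom P N) hg)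
                          (mx_hom_mul hf (dadd_prr_hom P N))).
  by rewrite mulmxA -(mulmxA _ g) gf mulmx1 dadd_inrK.
exists C; split=> //; first exact: summand_trans sumC sumN.
apply: stably_iso_trans (rsim_stably_iso simM) _.
apply: stably_iso_trans (rsim_stably_iso (dadd_comm P N)) _.
exact: stably_iso_trans (dadd_projective_stably_iso N projP) isoNC.
Qed.

End StableEquivalence.

(** * Heller operators *)

Section Heller.

Variables (F : fieldType) (gT : finGroupType) (G : {group gT}).
Local Notation rep := (representation F G).
Local Notation lin M N := ('M[F]_(rdegree M, rdegree N)).
Implicit Types A B C L M N P Q X Y : rep.

(** The projective-free part [N0] of the complement [N] of the core must be zero: otherwise
    [C (+) N0] would be a larger projective-free summand. Hence [N] is stably zero. *)
Lemma core_stably_iso M : stably_iso (core M) M.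
Proof.
rewrite /core; case: (cid (core_exists M)) => C /= [[N simM] freeC maxC].
apply: stably_iso_trans (stably_iso_sym (rsim_stably_iso simM)).
have [N0 [freeN0 sumN0 isoN]] := projective_free_part N.
have N00 : rdegree N0 = 0%N.
  have := maxC (dadd_grepr C N0) _ (projective_free_dadd freeC freeN0).
  suff sumCN : is_summand (dadd_grepr C N0) M by move=> /(_ sumCN) /=; lia.
  have [f [g [hf hg fg gf]]] := (mx_rsim_homP _ _).1 simM.
  have [a [b [ha hb ab1]]] := summand_retract sumN0.
  have hdiag (A A' B B' : rep) (u : lin A A') (v : lin B B') : mx_hom u -> mx_hom v ->
      mx_hom (M := dadd_grepr A B) (N := dadd_grepr A' B') (block_mx u 0 0 v).
    move=> hu hv x Gx; rewrite /= !mulmx_block !mulmx0 !mul0mx !addr0 !add0r.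
    by rewrite hu ?hv.
  have h1 := hdiag _ _ _ _ _ _ (mx_hom1 C) ha.
  have h2 := hdiag _ _ _ _ _ _ (mx_hom1 C) hb.
  apply: retract_summand (mx_hom_mul h1 hg) (mx_hom_mul hf h2) _.
  rewrite mulmxA -(mulmxA _ g) gf mulmx1 mulmx_block.
  by rewrite !mulmx0 !mul0mx !addr0 !add0r mulmx1 ab1 -scalar_mx_block.
apply: (@stably_iso_trans _ _ _ (dadd_grepr C N0)); last first.
  exact: stably_iso_dadd (stably_iso_refl C) (stably_iso_sym isoN).
apply/stably_iso_sym/dadd_projective_stably_iso.
apply/projectiveP; exists 0; rewrite /gtrace big1 => [|g _]; last first.
  by rewrite mulmx0 mul0mx.
by apply/matrixP=> i; have := ltn_ord i; rewrite [X in (_ < X)%N]N00.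
Qed.

Lemma core_projective_free M : projective_free (core M).
Proof. by rewrite /core; case: (cid (core_exists M)) => C /= []. Qed.

Lemma heller_projective_free M : projective_free (heller M).
Proof.
move=> P /projectiveP[th def1] /summand_retract[i [r [hi hr ir1]]].
rewrite /heller in i r hi hr ir1; set c := proj_cover M in i r hi hr ir1.
pose Q := cover_obj c; set q := cover_map c.
pose K : rep := Representation (submod_repr (cover_ker_module c)).
pose inc : lin K Q := val_submod 1%:M.
have hinc : mx_hom inc.
  move=> x Gx; rewrite /inc -val_submodE.
  by rewrite -[submod_repr _ _]mul1mx val_submodJ.
pose j : lin P Q := i *m inc.
have hj : mx_hom j := mx_hom_mul hi hinc.
have [jV jK] : exists jV : lin Q P, j *m jV = 1%:M.
  pose inV : lin Q K := in_submod (kermx q) 1%:M.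
  have incK : inc *m inV = 1%:M by rewrite /inV -in_submodE val_submodK.
  by exists (inV *m r); rewrite mulmxA -(mulmxA i) incK mulmx1.
(* Projectives are also injective here: tracing the linear retraction [jV] against [th] makes it
   equivariant. *)
pose rho : lin Q P := gtrace (M := Q) (N := P) (jV *m th).
have hrho : mx_hom rho by apply: gtrace_hom.
have jrho : j *m rho = 1%:M by rewrite gtrace_mull // mulmxA jK mul1mx -def1.
(* The image of [1 - rho j] is the kernel of the retraction [rho], a complement of the embedded
   [P]. *)
have modU : mxmodule Q (1%:M - rho *m j).
  apply/mxmoduleP=> x Gx; apply/submxP; exists (Q x).
  rewrite mulmxBl mulmxBr mulmx1 mul1mx -(mulmxA rho) -hj //.
  by rewrite (mulmxA rho) -hrho // -(mulmxA _ rho).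
have jq : (j <= kermx q)%MS.
  by apply: submx_trans (submxMl _ _) _; rewrite /inc val_submod1.
have Ufull : row_full (1%:M - rho *m j)%MS.
  apply: (cover_essential modU).
  rewrite -sub1mx -[X in (X <= _)%MS](subrK (rho *m j)) addmx_sub_adds //.
  exact: submx_trans (submxMl _ _) jq.
have [B BU] := row_fullP Ufull.
have rj0 : j = 0.
  have : (1%:M - rho *m j) *m rho = 0.
    by rewrite mulmxBl mul1mx -mulmxA jrho mulmx1 subrr.
  move/(congr1 (mulmx B)); rewrite mulmxA BU mul1mx mulmx0 => rho0.
  by rewrite -[j]mul1mx -jrho rho0 mulmx0 mul0mx.
have := mxrank1 F (rdegree P).
by rewrite -jrho rj0 mul0mx mxrank0.
Qed.

(* A projective presentation, recorded with linear splittings so that it is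
   visibly preserved by tensor products and direct sums. *)
Definition syzygy A M : Prop :=
  exists P, exists i : lin A P, exists a : lin P M,
  exists i' : lin P A, exists s : lin M P,
  [/\ projective P, mx_hom i, mx_hom a
    & [/\ i *m i' = 1%:M, s *m a = 1%:M, i *m a = 0 & i' *m i + a *m s = 1%:M]].

Lemma heller_syzygy M : syzygy (heller M) M.
Proof.
rewrite /heller; set c := proj_cover M; set q := cover_map c.
pose K : rep := Representation (submod_repr (cover_ker_module c)).
have [s sq] := row_fullP (cover_surj c).
have sK : (1%:M - q *m s <= kermx q)%MS.
  by apply/sub_kermxP; rewrite mulmxBl mul1mx -mulmxA sq mulmx1 subrr.
pose v : lin K (cover_obj c) := val_submod 1%:M.
have vq : v *m q = 0 by apply/sub_kermxP; rewrite val_submod1.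
exists (cover_obj c), v, q, (in_submod _ (1%:M - q *m s)), s.
split; [exact: cover_projective | | exact: cover_hom | split=> //].
- move=> x Gx; rewrite /v -val_submodE.
  by rewrite -[submod_repr _ _]mul1mx val_submodJ.
- rewrite in_submodE mulmxA mulmxBr mulmx1 (mulmxA v q) vq mul0mx subr0.
  by rewrite -in_submodE val_submodK.
by rewrite -val_submodE in_submodK // subrK.
Qed.

(* Schanuel's lemma in the stable category. *)
Lemma syzygy_unique A B M N :
  syzygy A M -> syzygy B N -> stably_iso M N -> stably_iso A B.
Proof.
move=> [P [i [a [i' [s [/projectiveP zP hi ha [ii' sa ia split_P]]]]]]].
move=> [Q [j [b [j' [t [/projectiveP zQ hj hb [jj' tb jb split_Q]]]]]]].
move=> [f [g [hf hg [th fg] [ph gf]]]].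
(* A map between the modules lifts to the projective terms by tracing its linear lift through
   [s2]. *)
have lift (P1 P2 M1 M2 : rep) (a1 : lin P1 M1) (a2 : lin P2 M2) (s2 : lin M2 P2)
    (h : lin M1 M2) : stably_zero (M := P1) (N := P1) 1%:M ->
    mx_hom a1 -> mx_hom a2 -> mx_hom h -> s2 *m a2 = 1%:M ->
    exists2 h' : lin P1 P2, mx_hom h' & h' *m a2 = a1 *m h.
  move=> [e def1] ha1 ha2 hh sa2.
  exists (gtrace (M := P1) (N := P2) (e *m a1 *m h *m s2)).
    exact: gtrace_hom.
  rewrite gtrace_mulr // -!mulmxA sa2 mulmx1 -gtrace_mulr; last exact: mx_hom_mul.
  by rewrite -def1 mul1mx.
have [f' hf' f'b] := lift _ _ _ _ a b t f zP ha hb hf tb.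
have [g' hg' g'a] := lift _ _ _ _ b a s g zQ hb ha hg sa.
(* The lift carries the first kernel into the second, and [i2'] reads off the induced map of
   syzygies. *)
have restrict (A1 P1 P2 M1 A2 M2 : rep) (i1 : lin A1 P1) (a1 : lin P1 M1) (h : lin P1 P2)
    (h0 : lin M1 M2) (i2 : lin A2 P2) (i2' : lin P2 A2) (a2 : lin P2 M2)
    (s2 : lin M2 P2) :
    mx_hom i1 -> mx_hom i2 -> mx_hom h -> i1 *m a1 = 0 -> h *m a2 = a1 *m h0 ->
    i2 *m i2' = 1%:M -> i2' *m i2 + a2 *m s2 = 1%:M ->
    mx_hom (M := A1) (N := A2) (i1 *m h *m i2') /\
    i1 *m h *m i2' *m i2 = i1 *m h.
  move=> hi1 hi2 hh ia1 ha12 ii2 sp2.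
  have E : i1 *m h *m i2' *m i2 = i1 *m h.
    rewrite -mulmxA -[i2' *m i2](addrK (a2 *m s2)) sp2 mulmxBr mulmx1.
    by rewrite mulmxA -(mulmxA i1) ha12 mulmxA ia1 !mul0mx subr0.
  split=> // x Gx.
  have hih := mx_hom_mul hi1 hh.
  rewrite mulmxA hih // -{1}E -(mulmxA _ i2) -hi2 // mulmxA.
  by rewrite -(mulmxA _ i2) ii2 mulmx1.
have [hu uj] := restrict _ _ _ _ _ _ i a f' f j j' b t hi hj hf' ia f'b jj' split_Q.
have [hv vi] := restrict _ _ _ _ _ _ j b g' g i i' a s hj hi hg' jb g'a ii' split_P.
(* If [d] covers [1 + gtrace e], subtract from [d] the identity and the trace [h], which covers
   [gtrace e] and vanishes on the syzygy. The remainder [D] lands in the syzygy, so [d] induces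
   there the identity plus a map through the projective [P1]. *)
have diff (A1 P1 M1 : rep) (i1 : lin A1 P1) (i1' : lin P1 A1) (a1 : lin P1 M1)
    (s1 : lin M1 P1) (d : lin P1 P1) (e : lin M1 M1) :
    stably_zero (M := P1) (N := P1) 1%:M ->
    mx_hom i1 -> mx_hom a1 -> mx_hom d -> i1 *m i1' = 1%:M -> s1 *m a1 = 1%:M ->
    i1 *m a1 = 0 -> i1' *m i1 + a1 *m s1 = 1%:M ->
    d *m a1 = a1 *m (1%:M + gtrace e) ->
    stably_zero (M := A1) (N := A1) (i1 *m d *m i1' - 1%:M).
  move=> z1 hi1 ha1 hd ii1 sa1 ia1 sp1 da.
  pose h : lin P1 P1 := gtrace (M := P1) (N := P1) (a1 *m e *m s1).
  pose D := d - 1%:M - h.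
  have hD : mx_hom D by apply: mx_homB (mx_homB hd (mx_hom1 P1)) (gtrace_hom _).
  have Da : D *m a1 = 0.
    rewrite /D /h !mulmxBl mul1mx da mulmxDr mulmx1 gtrace_mulr // -!mulmxA sa1.
    by rewrite mulmx1 -gtrace_mull // addrAC addrK subrr.
  have Di : D *m i1' *m i1 = D.
    rewrite -mulmxA -[i1' *m i1](addrK (a1 *m s1)) sp1 mulmxBr mulmx1.
    by rewrite mulmxA Da mul0mx subr0.
  have hDi : mx_hom (M := P1) (N := A1) (D *m i1').
    move=> x Gx; rewrite mulmxA hD // -{1}Di -(mulmxA _ i1) -hi1 // mulmxA.
    by rewrite -(mulmxA _ i1) ii1 mulmx1.
  have ih : i1 *m h = 0.
    rewrite /h gtrace_mull // !mulmxA ia1 !mul0mx /gtrace big1 // => x _.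
    by rewrite mulmx0 mul0mx.
  have -> : i1 *m d *m i1' - 1%:M = i1 *m (D *m i1').
    have -> : d = D + h + 1%:M by rewrite /D !subrK.
    move: (D) (h) ih => D' h' ih'; rewrite !mulmxDr !mulmxDl mulmx1 ii1 ih' mul0mx addr0 addrK.
    by rewrite mulmxA.
  exact: through_trace.
exists (i *m f' *m j'), (j *m g' *m i'); split; [exact: hu | exact: hv | | ].
  rewrite !mulmxA uj -(mulmxA i).
  apply: (diff _ _ _ _ _ a s _ th zP) => //; first exact: mx_hom_mul.
  by rewrite -mulmxA g'a mulmxA f'b -mulmxA -fg addrC subrK.
rewrite !mulmxA vi -(mulmxA j).
apply: (diff _ _ _ _ _ b t _ ph zQ) => //; first exact: mx_hom_mul.
by rewrite -mulmxA f'b mulmxA g'a -mulmxA -gf addrC subrK.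
Qed.

Lemma projective_prodl P N : projective P -> projective (prod_grepr P N).
Proof.
move/projectiveP=> zP; apply/projectiveP; rewrite /= -[1%:M]tprod1.
exact: stably_zero_tprodl zP (mx_hom1 N).
Qed.

Lemma projective_prodr P N : projective P -> projective (prod_grepr N P).
Proof.
move/projectiveP=> zP; apply/projectiveP; rewrite /= -[1%:M]tprod1.
exact: stably_zero_tprodr (mx_hom1 N) zP.
Qed.

Lemma syzygy_prodl A M N : syzygy A M -> syzygy (prod_grepr A N) (prod_grepr M N).
Proof.
move=> [P [i [a [i' [s [projP hi ha [ii' sa ia spl]]]]]]].
exists (prod_grepr P N), (tprod i 1%:M), (tprod a 1%:M), (tprod i' 1%:M).
exists (tprod s 1%:M); split.
- exact: projective_prodl.
- exact: tprod_hom hi (mx_hom1 N).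
- exact: tprod_hom ha (mx_hom1 N).
by rewrite -!tprodE -tprodDl !mulmx1 ii' sa ia spl !tprod1 tprod0l.
Qed.

Lemma syzygy_prodr A M N : syzygy A M -> syzygy (prod_grepr N A) (prod_grepr N M).
Proof.
move=> [P [i [a [i' [s [projP hi ha [ii' sa ia spl]]]]]]].
exists (prod_grepr N P), (tprod 1%:M i), (tprod 1%:M a), (tprod 1%:M i').
exists (tprod 1%:M s); split.
- exact: projective_prodr.
- exact: tprod_hom (mx_hom1 N) hi.
- exact: tprod_hom (mx_hom1 N) ha.
by rewrite -!tprodE -tprodDr !mulmx1 ii' sa ia spl !tprod1 tprod0r.
Qed.

Lemma syzygy_dadd A B M N :
  syzygy A M -> syzygy B N -> syzygy (dadd_grepr A B) (dadd_grepr M N).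
Proof.
move=> [P [i [a [i' [s [projP hi ha [ii' sa ia spl]]]]]]].
move=> [Q [j [b [j' [t [projQ hj hb [jj' tb jb spl']]]]]]].
have hdiag (L L' X X' : rep) (u : lin L L') (v : lin X X') : mx_hom u -> mx_hom v ->
    mx_hom (M := dadd_grepr L X) (N := dadd_grepr L' X') (block_mx u 0 0 v).
  move=> hu hv x Gx; rewrite /= !mulmx_block !mulmx0 !mul0mx !addr0 !add0r.
  by rewrite hu ?hv.
exists (dadd_grepr P Q), (block_mx i 0 0 j), (block_mx a 0 0 b).
exists (block_mx i' 0 0 j'), (block_mx s 0 0 t); split.
- exact: dadd_projective.
- exact: hdiag.
- exact: hdiag.
rewrite !mulmx_block !mulmx0 !mul0mx !addr0 !add0r ii' jj' sa tb ia jb.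
by rewrite add_block_mx spl spl' !addr0 -!scalar_mx_block block_mx0.
Qed.

Lemma heller_stably_iso M N : stably_iso M N -> stably_iso (heller M) (heller N).
Proof. by apply: syzygy_unique; apply: heller_syzygy. Qed.

Lemma heller_prodl M N :
  stably_iso (prod_grepr (heller M) N) (heller (prod_grepr M N)).
Proof.
apply: syzygy_unique (stably_iso_refl (prod_grepr M N)).
  exact/syzygy_prodl/heller_syzygy.
exact: heller_syzygy.
Qed.

Lemma heller_prodr M N :
  stably_iso (prod_grepr N (heller M)) (heller (prod_grepr N M)).
Proof.
apply: syzygy_unique (stably_iso_refl (prod_grepr N M)).
  exact/syzygy_prodr/heller_syzygy.
exact: heller_syzygy.
Qed.

Lemma heller_dadd M N :
  stably_iso (heller (dadd_grepr M N)) (dadd_grepr (heller M) (heller N)).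
Proof.
apply: syzygy_unique (stably_iso_refl (dadd_grepr M N)).
  exact: heller_syzygy.
by apply: syzygy_dadd; apply: heller_syzygy.
Qed.

Lemma heller0 : stably_iso (heller (grepr0 : rep)) (grepr0 : rep).
Proof.
apply: syzygy_unique (heller_syzygy _) _ (stably_iso_refl (grepr0 : rep)).
have h0 : mx_hom (M := grepr0 : rep) (N := grepr0 : rep) 0 by apply: mx_hom0.
exists (grepr0 : rep), 0, 0, 0, 0; split=> //; first exact: grepr0_projective.
by split; apply: flatmx0 || rewrite [LHS]flatmx0 [RHS]flatmx0.
Qed.

Lemma iter_heller_stably_iso k M N :
  stably_iso M N -> stably_iso (iter k (@heller F gT G) M) (iter k (@heller F gT G) N).
Proof. by move=> isoMN; elim: k => //= k; apply: heller_stably_iso. Qed.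

Lemma iter_heller_prodl k M N :
  stably_iso (prod_grepr (iter k (@heller F gT G) M) N) (iter k (@heller F gT G) (prod_grepr M N)).
Proof.
elim: k => [|k IHk] /=; first exact: stably_iso_refl.
exact: stably_iso_trans (heller_prodl _ _) (heller_stably_iso IHk).
Qed.

Lemma iter_heller_prodr k M N :
  stably_iso (prod_grepr N (iter k (@heller F gT G) M)) (iter k (@heller F gT G) (prod_grepr N M)).
Proof.
elim: k => [|k IHk] /=; first exact: stably_iso_refl.
exact: stably_iso_trans (heller_prodr _ _) (heller_stably_iso IHk).
Qed.

Lemma iter_heller_bigdadd k (I : Type) (r : seq I) (M : I -> rep) :
  stably_iso (iter k (@heller F gT G) (\big[dadd_grepr/grepr0]_(t <- r) M t))
             (\big[dadd_grepr/grepr0]_(t <- r) iter k (@heller F gT G) (M t)).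
Proof.
have iter0 : stably_iso (iter k (@heller F gT G) (grepr0 : rep)) (grepr0 : rep).
  elim: k => [|k IHk] /=; first exact: stably_iso_refl.
  exact: stably_iso_trans (heller_stably_iso IHk) heller0.
have iter_dadd (A B : rep) : stably_iso (iter k (@heller F gT G) (dadd_grepr A B))
    (dadd_grepr (iter k (@heller F gT G) A) (iter k (@heller F gT G) B)).
  elim: k {iter0} => [|k IHk] /=; first exact: stably_iso_refl.
  exact: stably_iso_trans (heller_stably_iso IHk) (heller_dadd _ _).
elim: r => [|t r IHr]; rewrite ?big_nil ?big_cons //.
apply: stably_iso_trans (iter_dadd _ _) _.
exact: stably_iso_dadd (stably_iso_refl _) IHr.
Qed.

Lemma omega_stably_iso k M : stably_iso (omega k M) (iter k (@heller F gT G) M).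
Proof.
case: k => [|k]; first exact: core_stably_iso.
by rewrite /omega iterSr; apply: stably_iso_refl.
Qed.

Lemma omega_projective_free k M : projective_free (omega k M).
Proof.
case: k => [|[|k]] /=; first exact: core_projective_free.
  exact: heller_projective_free.
exact: heller_projective_free.
Qed.

Lemma bigdadd_projective_free (I : Type) (r : seq I) (M : I -> rep) :
    (forall t, projective_free (M t)) ->
  projective_free (\big[dadd_grepr/grepr0]_(t <- r) M t).
Proof.
move=> freeM; elim: r => [|t r IHr]; rewrite ?big_nil ?big_cons.
  exact: projective_free0.
exact: projective_free_dadd (freeM t) IHr.
Qed.

Lemma bigdadd_stably_iso (I : eqType) (r : seq I) (M N : I -> rep) :
    (forall t, t \in r -> stably_iso (M t) (N t)) ->
  stably_iso (\big[dadd_grepr/grepr0]_(t <- r) M t)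
             (\big[dadd_grepr/grepr0]_(t <- r) N t).
Proof.
elim: r => [|t r IHr] isoMN; rewrite ?big_nil ?big_cons; first exact: stably_iso_refl.
apply: stably_iso_dadd; first by apply: isoMN; rewrite mem_head.
by apply: IHr => u ru; apply: isoMN; rewrite in_cons ru orbT.
Qed.

End Heller.

(** * Cancellation of summands *)

(** The additive bookkeeping shared by both sides of the Schur complement: [x1 = a a'], [x2 = b c'],
    [x3 = b e c a'], [x4 = b e d c'], [y = 1], and the mirror image. *)
Lemma schur_sum (V : zmodType) (x1 x2 x3 x4 y : V) :
  x1 - x3 - y = (x1 + x2 - y) - (x3 + x4) + (x4 - x2).
Proof.
rewrite [LHS]addrAC opprD !addrA subrK [in RHS](addrAC x1 x2).
by rewrite (addrAC _ x2) addrK.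
Qed.

Section Cancellation.

Variables (F : fieldType) (gT : finGroupType) (G : {group gT}).
Local Notation rep := (representation F G).
Local Notation lin M N := ('M[F]_(rdegree M, rdegree N)).
Implicit Types A B C D L M N P Q X Y : rep.

Definition division_end D : Prop :=
  forall f : lin D D, mx_hom f -> f = 0 \/ f \in unitmx.

Lemma unitmx_hom M (f : lin M M) :
  mx_hom f -> f \in unitmx -> mx_hom (M := M) (N := M) (invmx f).
Proof.
move=> hf uf x Gx; rewrite -[LHS]mul1mx -(mulVmx uf) -mulmxA (mulmxA f).
by rewrite -hf // -(mulmxA _ f) mulmxV // mulmx1.
Qed.

(* Schur complement of a stably invertible diagonal entry. *)
Lemma schur_complement X Y D (f : lin (dadd_grepr X D) (dadd_grepr Y D))
    (g : lin (dadd_grepr Y D) (dadd_grepr X D)) (e : lin D D) :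
    let d := dadd_inr X D *m f *m dadd_prr Y D in
    mx_hom f -> mx_hom g -> mx_hom e ->
    stably_zero (M := dadd_grepr X D) (N := dadd_grepr X D) (f *m g - 1%:M) ->
    stably_zero (M := dadd_grepr Y D) (N := dadd_grepr Y D) (g *m f - 1%:M) ->
    stably_zero (M := D) (N := D) (d *m e - 1%:M) ->
    stably_zero (M := D) (N := D) (e *m d - 1%:M) ->
  stably_iso X Y.
Proof.
move=> d hf hg he zfg zgf zde zed.
have [h1 h2] := (dadd_inl_hom, dadd_inr_hom).
have [h3 h4] := (dadd_prl_hom, dadd_prr_hom).
(* Block entries of [f], and primed ones of [g]. The facts [z1] to [z4] are the entries of [f g] and
   [g f], compared with the identity, that the elimination uses. *)
pose a := dadd_inl X D *m f *m dadd_prl Y D.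
pose b := dadd_inl X D *m f *m dadd_prr Y D.
pose c := dadd_inr X D *m f *m dadd_prl Y D.
pose a' := dadd_inl Y D *m g *m dadd_prl X D.
pose b' := dadd_inl Y D *m g *m dadd_prr X D.
pose c' := dadd_inr Y D *m g *m dadd_prl X D.
have ha : mx_hom (M := X) (N := Y) a by do 2![apply: mx_hom_mul => //].
have hb : mx_hom (M := X) (N := D) b by do 2![apply: mx_hom_mul => //].
have hc : mx_hom (M := D) (N := Y) c by do 2![apply: mx_hom_mul => //].
have hd : mx_hom (M := D) (N := D) d by do 2![apply: mx_hom_mul => //].
have ha' : mx_hom (M := Y) (N := X) a' by do 2![apply: mx_hom_mul => //].
have hb' : mx_hom (M := Y) (N := D) b' by do 2![apply: mx_hom_mul => //].
have hc' : mx_hom (M := D) (N := X) c' by do 2![apply: mx_hom_mul => //].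
have entry (U U1 U2 V W : rep) (u : lin U (dadd_grepr V D))
    (h : lin (dadd_grepr V D) (dadd_grepr W D))
    (k : lin (dadd_grepr W D) (dadd_grepr U1 D)) (v : lin (dadd_grepr U1 D) U2) :
    u *m h *m dadd_prl W D *m (dadd_inl W D *m k *m v)
    + u *m h *m dadd_prr W D *m (dadd_inr W D *m k *m v) = u *m (h *m k) *m v.
  rewrite !mulmxA -(mulmxA (u *m h)) -(mulmxA (u *m h) (dadd_prr W D)).
  by rewrite -!mulmxDl -mulmxDr dadd_sum1 mulmx1.
have z1 : stably_zero (M := X) (N := X) (a *m a' + b *m c' - 1%:M).
  rewrite /a /a' /b /c' entry -(dadd_inlK X D) -mulmxBl.
  rewrite -[X in _ - X]mulmx1 -mulmxBr.
  exact: stably_zero_mulr (h3 _ _ _ _ _) (stably_zero_mull (h1 _ _ _ _ _) zfg).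
have z2 : stably_zero (M := D) (N := X) (c *m a' + d *m c').
  rewrite /c /a' /d /c' entry -[f *m g](subrK 1%:M) mulmxDr mulmxDl mulmx1.
  rewrite dadd_inr_prl addr0.
  exact: stably_zero_mulr (h3 _ _ _ _ _) (stably_zero_mull (h2 _ _ _ _ _) zfg).
have z3 : stably_zero (M := Y) (N := Y) (a' *m a + b' *m c - 1%:M).
  rewrite /a /a' /b' /c entry -(dadd_inlK Y D) -mulmxBl.
  rewrite -[X in _ - X]mulmx1 -mulmxBr.
  exact: stably_zero_mulr (h3 _ _ _ _ _) (stably_zero_mull (h1 _ _ _ _ _) zgf).
have z4 : stably_zero (M := Y) (N := D) (a' *m b + b' *m d).
  rewrite /b /a' /d /b' entry -[g *m f](subrK 1%:M) mulmxDr mulmxDl mulmx1.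
  rewrite dadd_inl_prr addr0.
  exact: stably_zero_mulr (h4 _ _ _ _ _) (stably_zero_mull (h1 _ _ _ _ _) zgf).
have hbe := mx_hom_mul hb he; have hec := mx_hom_mul he hc.
(* As for inverse block matrices, the Schur complement of [d] in [f] is inverted by the corner [a']
   of [g]. *)
exists (a - b *m e *m c), a'; split=> //.
- by apply: mx_homB => //; apply: mx_hom_mul hc.
- have -> : (a - b *m e *m c) *m a' - 1%:M = (a *m a' + b *m c' - 1%:M)
      - b *m e *m (c *m a' + d *m c') + b *m (e *m d - 1%:M) *m c'.
    rewrite mulmxBl mulmxDr mulmxBr mulmxBl mulmx1 !mulmxA.
    exact: schur_sum.
  apply: stably_zeroD.
    by apply: stably_zeroB => //; apply: stably_zero_mull hbe _.
  exact: stably_zero_mulr hc' (stably_zero_mull hb zed).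
have -> : a' *m (a - b *m e *m c) - 1%:M = (a' *m a + b' *m c - 1%:M)
    - (a' *m b + b' *m d) *m (e *m c) + b' *m (d *m e - 1%:M) *m c.
  rewrite mulmxBr mulmxDl mulmxBr mulmxBl mulmx1 !mulmxA.
  exact: schur_sum.
apply: stably_zeroD.
  by apply: stably_zeroB => //; apply: stably_zero_mulr hec _.
exact: stably_zero_mulr hc (stably_zero_mull hb' zde).
Qed.

Lemma dadd_cancel X Y D :
  division_end D -> stably_iso (dadd_grepr X D) (dadd_grepr Y D) -> stably_iso X Y.
Proof.
move=> divD [f [g [hf hg zfg zgf]]].
have [h1 h2] := (dadd_inl_hom, dadd_inr_hom).
have [h3 h4] := (dadd_prl_hom, dadd_prr_hom).
pose d := dadd_inr X D *m f *m dadd_prr Y D.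
have hd : mx_hom (M := D) (N := D) d by do 2![apply: mx_hom_mul => //].
case: (divD d hd) => [d0 | ud].
  (* [d = 0] forces [c b'] to be stably 1; adding column 1 times [b'] to
     column 2 makes the corner stably invertible. *)
  pose b' := dadd_inl Y D *m g *m dadd_prr X D.
  have hb' : mx_hom (M := Y) (N := D) b' by do 2![apply: mx_hom_mul => //].
  (* The strictly triangular map with single entry [b']; since [n n = 0], the column operation
     [1 + n] has inverse [1 - n]. *)
  pose n : lin (dadd_grepr Y D) (dadd_grepr Y D) :=
    dadd_prl Y D *m b' *m dadd_inr Y D.
  have hn : mx_hom n by do 2![apply: mx_hom_mul => //].
  have nn : n *m n = 0.
    rewrite /n !mulmxA -(mulmxA _ (dadd_inr Y D)) dadd_inr_prl.
    by rewrite mulmx0 !mul0mx.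
  have E1 : (1%:M + n) *m (1%:M - n) = 1%:M.
    by rewrite mulmxBr mulmx1 mulmxDl mul1mx nn addr0 addrK.
  have E2 : (1%:M - n) *m (1%:M + n) = 1%:M.
    by rewrite mulmxDr mulmx1 mulmxBl mul1mx nn subr0 subrK.
  have hE : mx_hom (M := dadd_grepr Y D) (N := dadd_grepr Y D) (1%:M + n).
    exact: mx_homD (mx_hom1 _) hn.
  have hE' : mx_hom (M := dadd_grepr Y D) (N := dadd_grepr Y D) (1%:M - n).
    exact: mx_homB (mx_hom1 _) hn.
  have zd : stably_zero (M := D) (N := D)
      (dadd_inr X D *m (f *m (1%:M + n)) *m dadd_prr Y D - 1%:M).
    have -> : dadd_inr X D *m (f *m (1%:M + n)) *m dadd_prr Y D - 1%:M
              = dadd_inr X D *m (f *m g - 1%:M) *m dadd_prr X D.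
      rewrite (mulmxBr (dadd_inr X D)) [RHS]mulmxBl mulmx1 dadd_inrK.
      congr (_ - _); transitivity (dadd_inr X D *m f *m dadd_prl Y D *m b').
        rewrite mulmxDr mulmx1 mulmxDr mulmxDl -/d d0 add0r /n !mulmxA.
        by rewrite -(mulmxA _ (dadd_inr Y D)) dadd_inrK mulmx1.
      have -> : f *m g = f *m dadd_prl Y D *m dadd_inl Y D *m g
                         + f *m dadd_prr Y D *m dadd_inr Y D *m g.
        by rewrite -mulmxDl -!(mulmxA f) -mulmxDr dadd_sum1 mulmx1.
      by rewrite mulmxDr mulmxDl !mulmxA -/d d0 !mul0mx addr0.
    exact: stably_zero_mulr (h4 _ _ _ _ _) (stably_zero_mull (h2 _ _ _ _ _) zfg).
  apply: (@schur_complement X Y D (f *m (1%:M + n)) ((1%:M - n) *m g) 1%:M).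
  - exact: mx_hom_mul.
  - exact: mx_hom_mul.
  - exact: mx_hom1.
  - by rewrite mulmxA -(mulmxA f) E1 mulmx1.
  - have -> : (1%:M - n) *m g *m (f *m (1%:M + n)) - 1%:M
              = (1%:M - n) *m (g *m f - 1%:M) *m (1%:M + n).
      by rewrite (mulmxBr (1%:M - n)) [RHS]mulmxBl mulmx1 E2 !mulmxA.
    exact: stably_zero_mulr hE (stably_zero_mull hE' zgf).
  - by rewrite mulmx1.
  by rewrite mul1mx.
apply: (@schur_complement X Y D f g (invmx d)) => //.
- exact: unitmx_hom.
- by rewrite mulmxV // subrr; apply: stably_zero0.
by rewrite mulVmx // subrr; apply: stably_zero0.
Qed.

Lemma dadd_assoc L M N :
  mx_rsim (dadd_grepr L (dadd_grepr M N)) (dadd_grepr (dadd_grepr L M) N).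
Proof.
pose phi l m n (k : 'I_(l + (m + n))) : 'I_(l + m + n) :=
  match split k with
  | inl i => lshift n (lshift m i)
  | inr y => match split y with
             | inl i => lshift n (rshift l i) | inr i => rshift (l + m) i end end.
pose psi l m n (k : 'I_(l + m + n)) : 'I_(l + (m + n)) :=
  match split k with
  | inl y => match split y with
             | inl i => lshift (m + n) i | inr i => rshift l (lshift n i) end
  | inr i => rshift l (rshift m i) end.
have phi1 l m n (i : 'I_l) : phi l m n (lshift _ i) = lshift n (lshift m i).
  by rewrite /phi (unsplitK (inl i)).
have phi2 l m n (i : 'I_m) :
    phi l m n (rshift _ (lshift _ i)) = lshift n (rshift l i).
  by rewrite /phi (unsplitK (inr (lshift _ i))) (unsplitK (inl i)).
have phi3 l m n (i : 'I_n) : phi l m n (rshift _ (rshift _ i)) = rshift _ i.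
  by rewrite /phi (unsplitK (inr (rshift _ i))) (unsplitK (inr i)).
have psi1 l m n (i : 'I_l) : psi l m n (lshift n (lshift m i)) = lshift _ i.
  by rewrite /psi (unsplitK (inl (lshift m i))) (unsplitK (inl i)).
have psi2 l m n (i : 'I_m) :
    psi l m n (lshift n (rshift l i)) = rshift _ (lshift _ i).
  by rewrite /psi (unsplitK (inl (rshift l i))) (unsplitK (inr i)).
have psi3 l m n (i : 'I_n) : psi l m n (rshift _ i) = rshift _ (rshift _ i).
  by rewrite /psi (unsplitK (inr i)).
apply: (@rsim_reindex _ _ _ (dadd_grepr L (dadd_grepr M N))
         (dadd_grepr (dadd_grepr L M) N) (phi _ _ _) (psi _ _ _)).
- move=> k; rewrite -[k]splitK; case: (split k) => [i|y] /=.
    by rewrite phi1 psi1.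
  rewrite -[y]splitK; case: (split y) => i /=; first by rewrite phi2 psi2.
  by rewrite phi3 psi3.
- move=> k; rewrite -[k]splitK; case: (split k) => [y|i] /=; last first.
    by rewrite psi3 phi3.
  rewrite -[y]splitK; case: (split y) => i /=; first by rewrite psi1 phi1.
  by rewrite psi2 phi2.
move=> g _ x y; rewrite -[x]splitK -[y]splitK.
case: (split x) => [i|x'] /=; last (rewrite -[x']splitK; case: (split x') => i /=);
case: (split y) => [j|y'] /=; try (rewrite -[y']splitK; case: (split y') => j /=);
by rewrite ?phi1 ?phi2 ?phi3
  !(block_mxEul, block_mxEur, block_mxEdl, block_mxEdr) ?mxE.
Qed.

Section BigSum.

Variables (I : eqType) (M : I -> rep).
Local Notation dsum s := (\big[dadd_grepr/grepr0]_(t <- s) M t).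

Lemma bigdadd_cat (r s : seq I) :
  stably_iso (dsum (r ++ s)) (dadd_grepr (dsum r) (dsum s)).
Proof.
elim: r => [|t r IHr] /=.
  rewrite big_nil.
  apply: stably_iso_trans (rsim_stably_iso (dadd_comm _ _)).
  exact/stably_iso_sym/dadd_projective_stably_iso/grepr0_projective.
rewrite !big_cons.
apply: stably_iso_trans (stably_iso_dadd (stably_iso_refl _) IHr) _.
exact/rsim_stably_iso/dadd_assoc.
Qed.

Lemma bigdadd_perm (r s : seq I) :
  perm_eq r s -> stably_iso (dsum r) (dsum s).
Proof.
elim: r s => [|t r IHr] s.
  by rewrite perm_sym => /perm_nilP->; apply: stably_iso_refl.
move=> rs; have : t \in s by rewrite -(perm_mem rs) mem_head.
move=> st; case/splitPr: st rs => s1 s2 rs.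
rewrite big_cons; apply: stably_iso_trans (stably_iso_sym (bigdadd_cat _ _)).
rewrite big_cons.
apply: stably_iso_trans (stably_iso_sym (rsim_stably_iso (dadd_assoc _ _ _))).
apply: (@stably_iso_trans _ _ _ (dadd_grepr (dadd_grepr (M t) (dsum s1)) (dsum s2))); last first.
  apply: stably_iso_dadd (stably_iso_refl _).
  exact/rsim_stably_iso/dadd_comm.
apply: stably_iso_trans (rsim_stably_iso (dadd_assoc _ _ _)).
apply: stably_iso_dadd (stably_iso_refl _) _.
apply: stably_iso_trans (bigdadd_cat _ _); apply: IHr.
by rewrite -(perm_cons t) (perm_trans rs) // -[t :: s2]cat1s perm_catCA.
Qed.

Lemma bigdadd_flatten (J : Type) (f : J -> seq I) (r : seq J) :
  stably_iso (dsum (flatten [seq f j | j <- r]))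
             (\big[dadd_grepr/grepr0]_(j <- r) dsum (f j)).
Proof.
elim: r => [|j r IHr] /=; first by rewrite !big_nil; apply: stably_iso_refl.
rewrite big_cons; apply: stably_iso_trans (bigdadd_cat _ _) _.
exact: stably_iso_dadd (stably_iso_refl _) IHr.
Qed.

Lemma prod_bigdaddr N (r : seq I) :
  stably_iso (prod_grepr N (dsum r))
             (\big[dadd_grepr/grepr0]_(t <- r) prod_grepr N (M t)).
Proof.
elim: r => [|t r IHr]; rewrite ?big_nil ?big_cons.
  by apply/rsim_stably_iso/rsim_degree0; rewrite /= muln0.
apply: stably_iso_trans (rsim_stably_iso (prod_daddr _ _ _)) _.
exact: stably_iso_dadd (stably_iso_refl _) IHr.
Qed.

Lemma bigdadd_cancel X Y (r : seq I) :
    (forall t, t \in r -> division_end (M t)) ->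
    stably_iso (dadd_grepr X (dsum r)) (dadd_grepr Y (dsum r)) ->
  stably_iso X Y.
Proof.
elim: r X Y => [|t r IHr] X Y divM.
  rewrite big_nil => iso0.
  have X0 A := dadd_projective_stably_iso A (@grepr0_projective F gT G).
  exact: stably_iso_trans (stably_iso_trans (stably_iso_sym (X0 X)) iso0) (X0 Y).
rewrite big_cons => iso1; apply: (@dadd_cancel _ _ (M t)).
  by apply: divM; rewrite mem_head.
apply: IHr => [u ru|]; first by apply: divM; rewrite in_cons ru orbT.
apply: stably_iso_trans (stably_iso_sym (rsim_stably_iso (dadd_assoc _ _ _))) _.
apply: stably_iso_trans (rsim_stably_iso (dadd_assoc _ _ _)).
exact: iso1.
Qed.

End BigSum.

End Cancellation.

(** * Combinatorics of the sets [Rset] *)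

(** The truncated Clebsch-Gordan conditions, symmetric in [i], [j], [t]: triangle inequalities, even
    sum, and sum at most [2 (p - 2)]. This form is accessible to linear arithmetic. *)
Lemma mem_Rset p i j t : (1 < p)%N -> (i <= p - 2)%N -> (j <= p - 2)%N ->
  (t \in Rset p i j) = [&& (i <= j + t)%N, (j <= i + t)%N, (t <= i + j)%N,
                          (t + i + j <= 2 * p - 4)%N & ~~ odd (t + i + j)].
Proof.
move=> hp hi hj; rewrite /Rset.
have hl : (ell i j <= rr p i j)%N by rewrite /ell /rr; case: ifP; case: ifP; lia.
have ol : ~~ odd (ell i j + i + j) by rewrite /ell; case: ifP; lia.
have orr : ~~ odd (rr p i j + i + j) by rewrite /rr; case: ifP; lia.
transitivity [&& (ell i j <= t)%N, (t <= rr p i j)%N & ~~ odd (t + i + j)].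
  apply/mapP/idP => [[m]|ht].
    by rewrite mem_iota => hm ->; lia.
  by exists ((t - ell i j)./2)%N; [rewrite mem_iota|]; lia.
case: (odd (t + i + j)); rewrite ?andbF //=; clear hl ol orr.
by rewrite /ell /rr; case: ifP; case: ifP; lia.
Qed.

Lemma uniq_Rset p i j : uniq (Rset p i j).
Proof. by rewrite map_inj_uniq ?iota_uniq // => a b; lia. Qed.

(** Compares the multiplicity of each [u]. On the left [u] comes from [t = u + 1] and [t = u - 1],
    once each; on the right from the two sets, once each. *)
Lemma Rset_step p i j :
    (0 < i)%N -> (i.+1 <= p - 2)%N -> (j <= p - 2)%N ->
  perm_eq (flatten [seq Rset p 1 t | t <- Rset p i j])
          (Rset p i.+1 j ++ Rset p i.-1 j).
Proof.
move=> hi hip hj.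
suff E u : count_mem u (flatten [seq Rset p 1 t | t <- Rset p i j])
           = count_mem u (Rset p i.+1 j ++ Rset p i.-1 j).
  by apply/allP=> u _; apply/eqP/E.
have hp : (1 < p)%N by lia.
have hi0 : (i <= p - 2)%N by lia.
have hi1 : (i.-1 <= p - 2)%N by lia.
rewrite [RHS]count_cat (count_uniq_mem _ (uniq_Rset p i.+1 j)).
rewrite (count_uniq_mem _ (uniq_Rset p i.-1 j)) count_flatten -map_comp.
have -> : sumn [seq (count_mem u \o Rset p 1) t | t <- Rset p i j]
    = count (fun t => (u <= p - 2)%N && ((t == u.+1) || (t.+1 == u))) (Rset p i j).
  rewrite -sumn_count; congr sumn; apply/eq_in_map => t; rewrite mem_Rset //.
  move=> ht; rewrite -[LHS]/(count_mem u (Rset p 1 t)).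
  rewrite -[RHS]/(nat_of_bool ((u <= p - 2) && ((t == u.+1) || (t.+1 == u))))%N.
  have [ht1 ht2] : (t <= i + j)%N /\ (t + i + j <= 2 * p - 4)%N.
    by case/and5P: ht.
  rewrite (count_uniq_mem _ (uniq_Rset p 1 t)) mem_Rset //; [|lia|lia].
  by congr nat_of_bool; apply/idP/idP; lia.
case hu : (u <= p - 2)%N; last first.
  rewrite count_pred0 !mem_Rset //; lia.
have -> : count (fun t => true && ((t == u.+1) || (t.+1 == u))) (Rset p i j)
  = ((u.+1 \in Rset p i j) + ((0 < u) && (u.-1 \in Rset p i j)))%N.
  rewrite -(count_uniq_mem _ (uniq_Rset p i j)).
  have -> : ((0 < u)%N && (u.-1 \in Rset p i j)) = count (fun t => t.+1 == u) (Rset p i j) :> nat.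
    case: u {hu} => [|u] /=; first by rewrite count_pred0.
    rewrite -(count_uniq_mem _ (uniq_Rset p i j)); apply: eq_count => t /=.
    by rewrite eqSS.
  rewrite -count_predUI [X in _ = (_ + X)%N](_ : _ = 0)%N ?addn0 //.
  by apply/eqP; rewrite -leqn0 leqNgt -has_count; apply/hasPn => t _ /=; lia.
rewrite !mem_Rset //.
have -> : odd (u.+1 + i + j) = odd (u + i.+1 + j) by lia.
have -> : odd (u + i.-1 + j) = odd (u + i.+1 + j) by lia.
have -> : (0 < u)%N && [&& (i <= j + u.-1)%N, (j <= i + u.-1)%N, (u.-1 <= i + j)%N,
    (u.-1 + i + j <= 2 * p - 4)%N & ~~ odd (u.-1 + i + j)]
  = [&& (0 < u)%N, (i.+1 <= j + u)%N, (j.+1 <= i + u)%N, (u <= (i + j).+1)%N,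
    (u + i + j <= (2 * p - 4).+1)%N & ~~ odd (u + i.+1 + j)].
  have [->|u0] := posnP u; first by [].
  have -> : odd (u.-1 + i + j) = odd (u + i.+1 + j) by lia.
  by case: (odd _); rewrite ?andbF //=; lia.
case ho: (odd _); rewrite ?andbF //= !andbT.
(* Bounds that differ by one agree on sums of the right parity; writing the sum as [h + h] lets
   linear arithmetic see this. *)
have {ho} [h def_h] : exists h, (u + i.+1 + j = h + h)%N.
  by exists (u + i.+1 + j)./2; rewrite addnn even_halfK ?ho.
(* A sum of two bits is determined by their conjunction and disjunction. *)
have addb_eq (b1 b2 b3 b4 : bool) :
    b1 && b2 = b3 && b4 -> b1 || b2 = b3 || b4 -> (b1 + b2 = b3 + b4)%N.
  by case: b1 b2 b3 b4 => [] [] [] [].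
apply: addb_eq.
  by apply/idP/idP => /andP[/and4P[? ? ? ?]]; do 4?case/andP=> ?;
     move=> ?; do !(apply/andP; split); lia.
apply/idP/idP => /orP[] => [/and4P[? ? ? ?]|/and5P[? ? ? ? ?]|/and4P[? ? ? ?]|/and4P[? ? ? ?]];
  lia.
Qed.

(** * The exterior algebra *)

(** The diagonal is assumed to vanish separately because antisymmetry does not imply it in
    characteristic 2. *)
Lemma sum_antisym (V : zmodType) n (f : 'I_n -> 'I_n -> V) :
    (forall i, f i i = 0) -> (forall i j, f i j = - f j i) ->
  \sum_i \sum_j f i j = 0.
Proof.
move=> f0 fN.
have split_sum i : \sum_j f i j = \sum_(j < n | (j < i)%N) f i j
                                + \sum_(j < n | (i < j)%N) f i j.
  rewrite (bigID (fun j : 'I_n => (j < i)%N)) /=; congr (_ + _).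
  rewrite (bigD1 i) ?ltnn //= f0 add0r; apply: eq_bigl => j.
  by rewrite -leqNgt ltn_neqAle andbC (inj_eq val_inj) eq_sym.
rewrite (eq_bigr _ (fun i _ => split_sum i)) big_split /=.
rewrite [X in _ + X](exchange_big_dep predT) //= -big_split big1 // => i _ /=.
rewrite -big_split big1 //= => j _.
by rewrite [f j i]fN subrr.
Qed.

Section Fock.

Variables (F : fieldType) (n : nat).
Implicit Types (A B : {set 'I_n}) (i j k : 'I_n) (g h : 'S_n).

Local Notation d := #|{set 'I_n}|.
Local Notation op := 'M[F]_d.

Local Notation val_set a := (enum_val a : {set 'I_n}).

(* The basis vector [fock_vec A] stands for the wedge product of the e_k, k in A,
   taken in increasing order; [cre i] is v |-> e_i /\ v. *)
Definition ord_sign i k : F := (-1) ^+ (k < i)%N.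

Definition set_sign i A : F := \prod_(k in A) ord_sign i k.

Definition fock_vec A : 'rV[F]_d := delta_mx 0 (enum_rank A).

Definition cre i : op :=
  \matrix_(a, b) if (i \notin (val_set a)) && ((val_set b) == i |: (val_set a))
                 then set_sign i (enum_val a) else 0.

(** Transposing exterior multiplication by [e_i] gives contraction with the dual basis vector. *)
Definition ann i : op := (cre i)^T.

Lemma ord_sign2 i k : ord_sign i k * ord_sign i k = 1.
Proof. by rewrite -expr2 sqrr_sign. Qed.

Lemma ord_signN i k : i != k -> ord_sign i k = - ord_sign k i.
Proof.
rewrite /ord_sign -(inj_eq val_inj) /=.
by case: ltngtP => // _ _; rewrite ?opprK.
Qed.

Lemma set_sign2 i A : set_sign i A * set_sign i A = 1.
Proof. by rewrite -big_split big1 //= => k _; apply: ord_sign2. Qed.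

Lemma set_signU i k A : k \notin A ->
  set_sign i (k |: A) = ord_sign i k * set_sign i A.
Proof. by move=> kA; rewrite /set_sign big_setU1. Qed.

Lemma fock_vecE A m (X : 'M[F]_(d, m)) : fock_vec A *m X = row (enum_rank A) X.
Proof. by rewrite -rowE. Qed.

Lemma fock_vec_cre A i :
  fock_vec A *m cre i = if i \in A then 0 else set_sign i A *: fock_vec (i |: A).
Proof.
apply/rowP=> b; rewrite fock_vecE !mxE enum_rankK.
have [iA|iA] := boolP (i \in A); rewrite /= !mxE // eqxx /=.
rewrite -(inj_eq enum_val_inj) enum_rankK.
by case: eqP => _; rewrite ?mulr1 ?mulr0.
Qed.

Lemma fock_vec_ann A i :
  fock_vec A *m ann i
  = if i \in A then set_sign i (A :\ i) *: fock_vec (A :\ i) else 0.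
Proof.
apply/rowP=> b; rewrite fock_vecE !mxE enum_rankK.
have [iA | niA] := boolP (i \in A); rewrite /= ?mxE; last first.
  by case: ifP => // /andP[_ /eqP eA]; rewrite eA setU11 in niA.
rewrite eqxx /= -(inj_eq enum_val_inj) enum_rankK.
case: (enum_val b =P A :\ i) => [->|ne_b]; first by rewrite !inE eqxx setD1K //= eqxx mulr1.
rewrite mulr0; case: ifP => // /andP[nib /eqP eA].
by case: ne_b; rewrite eA setU1K.
Qed.

Lemma fock_eqP m (X Y : 'M[F]_(d, m)) :
  (forall A, fock_vec A *m X = fock_vec A *m Y) -> X = Y.
Proof.
move=> eqXY; apply/row_matrixP=> a.
by have := eqXY (enum_val a); rewrite !fock_vecE enum_valK.
Qed.

Lemma cre_cre i : cre i *m cre i = 0.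
Proof.
apply: fock_eqP => A; rewrite mulmxA mulmx0 fock_vec_cre.
by case: ifP => iA; rewrite ?mul0mx // -scalemxAl fock_vec_cre setU11 scaler0.
Qed.

Lemma cre_anticomm i j : cre i *m cre j = - (cre j *m cre i).
Proof.
have [->|ne_ij] := eqVneq i j; first by rewrite cre_cre oppr0.
have ne_ji : j != i by rewrite eq_sym.
apply: fock_eqP => A; rewrite mulmxN !mulmxA !fock_vec_cre.
have [iA|iA] := boolP (i \in A); have [jA|jA] := boolP (j \in A);
  rewrite ?mul0mx ?oppr0 -?scalemxAl ?fock_vec_cre ?in_setU1 ?(negPf ne_ij)
    ?(negPf ne_ji) ?iA ?jA ?(negPf iA) ?(negPf jA) ?scaler0 ?oppr0 //=.
rewrite !set_signU // !scalerA setUCA -scaleNr; congr (_ *: _).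
by rewrite (ord_signN ne_ji); ring.
Qed.

Lemma ann_ann i : ann i *m ann i = 0.
Proof. by rewrite -trmx_mul cre_cre trmx0. Qed.

Lemma ann_anticomm i j : ann i *m ann j = - (ann j *m ann i).
Proof. by rewrite -!trmx_mul cre_anticomm linearN. Qed.

(** The Clifford relation. For [i != j] the two orders differ by [ord_sign i j = - ord_sign j i];
    for [i = j] exactly one of the two products acts on a given basis wedge, as the identity. *)
Lemma cre_ann i j : cre i *m ann j = (i == j)%:R%:M - ann j *m cre i.
Proof.
apply: fock_eqP => A; rewrite mulmxBr !mulmxA.
apply/eqP; rewrite -subr_eq opprK; apply/eqP.
rewrite fock_vec_cre fock_vec_ann; have [->|ne_ij] := eqVneq i j.
  rewrite mulmx1; have [jA|jA] := boolP (j \in A).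
    rewrite mul0mx add0r -scalemxAl fock_vec_cre setD11 scalerA set_sign2.
    by rewrite scale1r setD1K.
  rewrite mul0mx addr0 -scalemxAl fock_vec_ann setU11 setU1K //.
  by rewrite scalerA set_sign2 scale1r.
have ne_ji : j != i by rewrite eq_sym.
rewrite raddf0 mulmx0.
have [iA|iA] := boolP (i \in A); have [jA|jA] := boolP (j \in A);
  rewrite ?mul0mx ?add0r ?addr0 -?scalemxAl ?fock_vec_cre ?fock_vec_ann ?in_setU1
    ?in_setD1 ?ne_ij ?(negPf ne_ji) ?iA ?jA ?(negPf iA) ?(negPf jA)
    ?scaler0 ?addr0 //=.
have -> : (i |: A) :\ j = i |: (A :\ j).
  by apply/setP=> k; rewrite !inE; case: (k =P i) => [->|]; rewrite ?ne_ij ?andbT.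
have niAj : i \notin A :\ j by rewrite in_setD1 negb_and iA orbT.
have -> : set_sign i A = ord_sign i j * set_sign i (A :\ j).
  by rewrite -set_signU ?setD11 // setD1K.
rewrite set_signU // !scalerA -scalerDl (ord_signN ne_ji).
rewrite [X in X *: _](_ : _ = 0) ?scale0r //.
set x := ord_sign i j; set y := set_sign i _; set z := set_sign j _.
by rewrite mulNr mulrN mulrACA ord_sign2 mul1r [y * z]mulrC addNr.
Qed.

Lemma ann_cre i j : ann i *m cre j = (i == j)%:R%:M - cre j *m ann i.
Proof. by rewrite cre_ann eq_sym opprB addrC subrK. Qed.

(** For symmetric [f] this is a product over unordered pairs, so adjoining a point [i] to [A]
    contributes the factors [f i k] whatever the position of [i]. *)
Definition pair_prod (f : 'I_n -> 'I_n -> F) A : F :=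
  \prod_(i in A) \prod_(k in A | (k < i)%N) f i k.

Lemma pair_prodU f i A : (forall j k, f j k = f k j) -> i \notin A ->
  pair_prod f (i |: A) = pair_prod f A * \prod_(k in A) f i k.
Proof.
move=> fC iA; rewrite /pair_prod big_setU1 //=.
have split_prod j :
    \prod_(k in i |: A | (k < j)%N) f j k
    = (if (i < j)%N then f j i else 1) * \prod_(k in A | (k < j)%N) f j k.
  by rewrite big_mkcondr big_setU1 //= -big_mkcondr.
rewrite split_prod ltnn mul1r (eq_bigr _ (fun j _ => split_prod j)) big_split /=.
rewrite mulrA mulrC; congr (_ * _).
rewrite big_mkcondr /= -big_split; apply: eq_bigr => k kA /=.
have : i != k by apply: contraNneq iA => ->.
by rewrite -(inj_eq val_inj) /=; case: ltngtP; rewrite ?mulr1 ?mul1r.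
Qed.

Definition inv_sign g i k : F := ord_sign i k * ord_sign (g i) (g k).

Lemma inv_signC g i k : inv_sign g i k = inv_sign g k i.
Proof.
have [->//|ne_ik] := eqVneq i k.
by rewrite /inv_sign ord_signN // [X in _ * X]ord_signN ?mulrNN // inj_eq //; apply: perm_inj.
Qed.

(** The parity of the number of inversions of [g] on [A], that is, the sign that sorts the wedge of
    the [e_(g k)], [k] in [A]. *)
Definition act_sign g A : F := pair_prod (inv_sign g) A.

Lemma act_signU g i A : i \notin A -> act_sign g (i |: A)
  = act_sign g A * (set_sign i A * set_sign (g i) (g @: A)).
Proof.
move=> iA; rewrite /act_sign pair_prodU //; last exact: inv_signC.
rewrite big_split /=; congr (_ * (_ * _)).
by rewrite /set_sign big_imset //= => x y _ _; apply: perm_inj.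
Qed.

Lemma act_sign0 g : act_sign g set0 = 1.
Proof. by rewrite /act_sign /pair_prod big_set0. Qed.

Definition fock_mx g : op :=
  \matrix_(a, b) if (val_set b) == g @: (val_set a) then act_sign g (enum_val a) else 0.

Lemma fock_vec_mx A g : fock_vec A *m fock_mx g = act_sign g A *: fock_vec (g @: A).
Proof.
apply/rowP=> b; rewrite fock_vecE !mxE enum_rankK eqxx /=.
rewrite -(inj_eq enum_val_inj) enum_rankK.
by case: eqP => _; rewrite ?mulr1 ?mulr0.
Qed.

Lemma set_ind1 (P : {set 'I_n} -> Prop) :
  P set0 -> (forall i A, i \notin A -> P A -> P (i |: A)) -> forall A, P A.
Proof.
move=> P0 PU A; have [m] := ubnP #|A|; elim: m A => // m IHm A.
have [->//|[i iA]] := set_0Vmem A; rewrite ltnS => leA.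
rewrite -(setD1K iA); apply: PU; first by rewrite setD11.
by apply: IHm; apply: leq_trans leA; rewrite (cardsD1 i A) iA.
Qed.

Lemma imset_permU g i A : g @: (i |: A) = g i |: g @: A.
Proof. by rewrite imsetU imset_set1. Qed.

(** The cocycle law that makes [fock_mx] multiplicative. When a point is adjoined, the intermediate
    sign occurs twice and cancels. *)
Lemma act_signM g h A : act_sign (g * h)%g A = act_sign g A * act_sign h (g @: A).
Proof.
have imM B : (g * h)%g @: B = h @: (g @: B).
  by rewrite -imset_comp; apply: eq_imset => x; rewrite permM.
elim/set_ind1: A => [|i A iA IHA]; first by rewrite imset0 !act_sign0 mul1r.
rewrite imset_permU !act_signU // ?(mem_imset _ _ perm_inj) // IHA imM permM.
set x := set_sign i A; set y := set_sign (g i) _; set z := set_sign (h _) _.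
have y2 : y * y = 1 by apply: set_sign2.
transitivity (act_sign g A * act_sign h (g @: A) * (x * z * (y * y))).
  by rewrite y2 mulr1.
by ring.
Qed.

Lemma fock_mx_repr : mx_repr [set: 'S_n]%G fock_mx.
Proof.
split=> [|g h _ _]; apply: fock_eqP => A; rewrite ?mulmxA !fock_vec_mx.
  have -> : act_sign 1 A = 1.
    rewrite /act_sign /pair_prod big1 // => i _; rewrite big1 // => k _.
    by rewrite /inv_sign !perm1 ord_sign2.
  have -> : (1%g : 'S_n) @: A = A.
    by rewrite -[RHS]imset_id; apply: eq_imset => x; rewrite perm1.
  by rewrite scale1r mulmx1.
rewrite -scalemxAl fock_vec_mx scalerA -act_signM; congr (_ *: fock_vec _).
by rewrite -imset_comp; apply: eq_imset => x; rewrite permM.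
Qed.

Definition fock : representation F [set: 'S_n]%G :=
  Representation (MxRepresentation fock_mx_repr).

Lemma fock_cre g i : cre i *m fock_mx g = fock_mx g *m cre (g i).
Proof.
apply: fock_eqP => A; rewrite !mulmxA fock_vec_mx fock_vec_cre -scalemxAl.
rewrite fock_vec_cre (mem_imset _ _ (@perm_inj _ g)).
have [iA|iA] := boolP (i \in A); first by rewrite mul0mx scaler0.
rewrite -scalemxAl fock_vec_mx !scalerA imset_permU act_signU //.
congr (_ *: _); set x := set_sign i A; set y := set_sign (g i) _.
have x2 : x * x = 1 by apply: set_sign2.
transitivity (act_sign g A * y * (x * x)); last by rewrite x2 mulr1.
by ring.
Qed.

Lemma fock_ann g i : ann i *m fock_mx g = fock_mx g *m ann (g i).
Proof.
apply: fock_eqP => A; rewrite !mulmxA fock_vec_mx fock_vec_ann -scalemxAl.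
rewrite fock_vec_ann (mem_imset _ _ (@perm_inj _ g)).
have [iA|iA] := boolP (i \in A); last by rewrite mul0mx scaler0.
have gD : (g @: A) :\ g i = g @: (A :\ i).
  by rewrite -{1}(setD1K iA) imset_permU setU1K // (mem_imset _ _ perm_inj) setD11.
rewrite -scalemxAl fock_vec_mx !scalerA gD; congr (_ *: _).
rewrite -{3}(setD1K iA) act_signU ?setD11 //.
set x := set_sign i _; set y := set_sign (g i) _.
have y2 : y * y = 1 by apply: set_sign2.
transitivity (act_sign g (A :\ i) * x * (y * y)); first by rewrite y2 mulr1 mulrC.
by ring.
Qed.

Definition cre_sum : op := \sum_i cre i.
Definition ann_sum : op := \sum_i ann i.
(** On row vectors [ann i] acts first, so this counts the factors of a basis wedge. *)
Definition num_op : op := \sum_i ann i *m cre i.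

Local Notation e := cre_sum.
Local Notation iota := ann_sum.
Local Notation num := num_op.

Lemma cre_sum_cre i : e *m cre i = - (cre i *m e).
Proof.
by rewrite mulmx_suml mulmx_sumr -sumrN; apply: eq_bigr => k _; apply: cre_anticomm.
Qed.

Lemma ann_sum_ann i : iota *m ann i = - (ann i *m iota).
Proof.
by rewrite mulmx_suml mulmx_sumr -sumrN; apply: eq_bigr => k _; apply: ann_anticomm.
Qed.

Lemma sum_delta (i : 'I_n) : \sum_k (k == i)%:R%:M = 1%:M :> op.
Proof. by rewrite (bigD1 i) //= eqxx big1 ?addr0 // => k /negPf->; rewrite raddf0. Qed.

Lemma cre_sum_ann i : e *m ann i = 1%:M - ann i *m e.
Proof.
rewrite mulmx_suml mulmx_sumr -(sum_delta i) -sumrB.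
by apply: eq_bigr => k _; apply: cre_ann.
Qed.

Lemma ann_sum_cre i : iota *m cre i = 1%:M - cre i *m iota.
Proof.
rewrite mulmx_suml mulmx_sumr -(sum_delta i) -sumrB.
by apply: eq_bigr => k _; apply: ann_cre.
Qed.

Lemma cre_sum2 : e *m e = 0.
Proof.
rewrite mulmx_suml; under eq_bigr => i _ do rewrite mulmx_sumr.
by apply: sum_antisym => i *; [apply: cre_cre | apply: cre_anticomm].
Qed.

Lemma ann_sum2 : iota *m iota = 0.
Proof.
rewrite mulmx_suml; under eq_bigr => i _ do rewrite mulmx_sumr.
by apply: sum_antisym => i *; [apply: ann_ann | apply: ann_anticomm].
Qed.

(** In characteristic [n] the scalar disappears, and [e] and [iota] become anticommuting
    differentials. *)
Lemma cre_sum_ann_sum : e *m iota = n%:R%:M - iota *m e.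
Proof.
rewrite mulmx_sumr (eq_bigr _ (fun i _ => cre_sum_ann i)) sumrB -mulmx_suml.
by congr (_ - _); rewrite sumr_const card_ord raddfMn.
Qed.

Lemma fock_vec_num A : fock_vec A *m num = #|A|%:R *: fock_vec A.
Proof.
rewrite mulmx_sumr (eq_bigr (fun i => (i \in A)%:R *: fock_vec A)) => [|i _].
  rewrite -scaler_suml -natr_sum; congr (_%:R *: _).
  by rewrite -sum1_card [RHS]big_mkcond; apply: eq_bigr => i _; case: (i \in A).
rewrite mulmxA fock_vec_ann; have [iA|iA] := boolP (i \in A); last first.
  by rewrite mul0mx scale0r.
by rewrite -scalemxAl fock_vec_cre setD11 scalerA set_sign2 setD1K.
Qed.

Lemma num_cre i : cre i *m num = num *m cre i + cre i.
Proof.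
apply: fock_eqP => A; rewrite mulmxDr !mulmxA fock_vec_num -scalemxAl fock_vec_cre.
have [iA|iA] := boolP (i \in A); first by rewrite mul0mx scaler0 addr0.
rewrite -scalemxAl fock_vec_num cardsU1 iA natrD scalerDl scale1r scalerDr addrC.
by rewrite !scalerA mulrC.
Qed.

Lemma num_ann i : ann i *m num = num *m ann i - ann i.
Proof.
apply: fock_eqP => A; rewrite mulmxBr !mulmxA fock_vec_num -scalemxAl fock_vec_ann.
have [iA|iA] := boolP (i \in A); last by rewrite mul0mx scaler0 subr0.
rewrite -scalemxAl fock_vec_num (cardsD1 i A) iA natrD scalerDl scale1r.
by rewrite addrAC subrr add0r !scalerA mulrC.
Qed.

Lemma fock_cre_sum g : e *m fock_mx g = fock_mx g *m e.
Proof.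
rewrite mulmx_suml mulmx_sumr [RHS](reindex_inj (@perm_inj _ g)) /=.
by apply: eq_bigr => i _; apply: fock_cre.
Qed.

Lemma fock_ann_sum g : iota *m fock_mx g = fock_mx g *m iota.
Proof.
rewrite mulmx_suml mulmx_sumr [RHS](reindex_inj (@perm_inj _ g)) /=.
by apply: eq_bigr => i _; apply: fock_ann.
Qed.

Lemma fock_num g : num *m fock_mx g = fock_mx g *m num.
Proof.
rewrite mulmx_suml mulmx_sumr [RHS](reindex_inj (@perm_inj _ g)) /=.
by apply: eq_bigr => i _; rewrite -mulmxA fock_cre mulmxA fock_ann mulmxA.
Qed.

(* In characteristic p = n, and for 0 < r < p, this is the image of e iota in
   degree r, i.e. the (r-1)-st exterior power of 1^perp / 1. *)
Definition harmonic (r : nat) : op := kermx (row_mx e (row_mx iota (num - r%:R%:M))).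

Lemma harmonicP r m (V : 'M[F]_(m, d)) :
  reflect [/\ V *m e = 0, V *m iota = 0 & V *m num = r%:R *: V]
          (V <= harmonic r)%MS.
Proof.
apply: (iffP (sub_kermxP)) => [|[Ve Vi Vn]].
  rewrite !mul_mx_row => /eqP; rewrite !row_mx_eq0 => /and3P[/eqP Ve /eqP Vi].
  by rewrite mulmxBr mul_mx_scalar subr_eq0 => /eqP.
by rewrite !mul_mx_row Ve Vi mulmxBr mul_mx_scalar Vn subrr !row_mx0.
Qed.

Lemma harmonic_module r : mxmodule fock (harmonic r).
Proof.
apply/mxmoduleP=> g _; have [Ve Vi Vn] := harmonicP r (harmonic r) (submx_refl _).
apply/harmonicP; split; rewrite /= -mulmxA -?fock_cre_sum -?fock_ann_sum -?fock_num.
- by rewrite mulmxA Ve mul0mx.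
- by rewrite mulmxA Vi mul0mx.
by rewrite mulmxA Vn -scalemxAl.
Qed.

Definition harmonic_rep r : representation F [set: 'S_n]%G :=
  Representation (submod_repr (harmonic_module r)).

End Fock.

(** * The natural permutation module *)

Section Natural.

Variables (F : fieldType) (n : nat).

Lemma perm_mx_is_repr : mx_repr [set: 'S_n]%G (@perm_mx F n).
Proof. by split=> [|g h _ _]; rewrite ?perm_mx1 ?perm_mxM. Qed.

Definition natural_rep : representation F [set: 'S_n]%G :=
  Representation (MxRepresentation perm_mx_is_repr).

Lemma perm_mxE (g : 'S_n) i j : perm_mx g i j = (g i == j)%:R :> F.
Proof. by rewrite !mxE. Qed.

Lemma card_perm_fix (o i : 'I_n) : #|[set g : 'S_n | g o == i]| = (n.-1)`!.
Proof.
have -> : [set g : 'S_n | g o == i] = (fun g => g * tperm o i)%g @: [set g | perm_on [set~ o] g].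
  apply/setP=> g; rewrite inE; apply/eqP/imsetP => [go|[h]].
    exists (g * tperm o i)%g; last by rewrite -mulgA tperm2 mulg1.
    rewrite inE; apply/subsetP=> x; rewrite !inE; apply: contra => /eqP->.
    by rewrite permM go tpermR.
  rewrite inE => hon ->; rewrite permM (out_perm hon) ?tpermL //.
  by rewrite !inE eqxx.
rewrite card_imset; last exact: mulIg.
have := card_perm [set~ o]; rewrite cardsC1 card_ord => <-.
by rewrite cardsE.
Qed.

Lemma natural_projective (p_n : n \in [pchar F]) (X : representation F [set: 'S_n]%G) :
  projective (prod_grepr natural_rep X).
Proof.
apply: projective_prodl; apply/projectiveP.
have pr_n := pcharf_prime p_n.
pose o : 'I_n := Ordinal (prime_gt0 pr_n).
(* By Wilson's theorem [n] divides [(n-1)! + 1], so it cannot divide [(n-1)!]. *)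
have fact0 : (n.-1)`!%:R != 0 :> F.
  rewrite -(dvdn_pcharf p_n); apply/negP=> nd.
  have := Wilson (prime_gt1 pr_n); rewrite [prime n]pr_n => /esym.
  by rewrite -addn1 dvdn_addr // dvdn1 => /eqP n1; have := prime_gt1 pr_n; rewrite n1.
(* Conjugating the matrix unit at [o] gives each diagonal matrix unit [(n-1)!] times, once for each
   [g] with [g o = i]. *)
exists ((n.-1)`!%:R^-1 *: delta_mx o o); apply/matrixP=> i j.
rewrite /gtrace summxE; under eq_bigr => g _.
  rewrite -scalemxAr -scalemxAl mxE.
  have -> : (perm_mx g^-1%g *m delta_mx o o *m perm_mx g) i j
            = (g o == i)%:R * (i == j)%:R :> F.
    rewrite mxE (bigD1 o) //= big1 ?addr0 => [|k ne_k]; last first.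
      rewrite mxE big1 ?mul0r // => l _; rewrite [delta_mx _ _ _ _]mxE.
      by rewrite (negPf ne_k) andbF mulr0.
    rewrite mxE (bigD1 o) //= big1 ?addr0 => [|k ne_k]; last first.
      by rewrite [delta_mx _ _ _ _]mxE (negPf ne_k) mulr0.
    rewrite !perm_mxE [delta_mx _ _ _ _]mxE !eqxx mulr1 (canF_eq (permKV g)).
    by rewrite eq_sym; case: eqP => [->|]; rewrite ?mul0r.
  over.
rewrite -mulr_sumr -mulr_suml -natr_sum mxE.
have -> : (\sum_(g in [set: 'S_n]) (g o == i) = (n.-1)`!)%N.
  rewrite -(card_perm_fix o i) -sum1_card big_mkcond [RHS]big_mkcond.
  by apply: eq_bigr => g _; rewrite !inE; case: (g o == i).
by rewrite mulrA mulVf // mul1r.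
Qed.

End Natural.

(** * Equivariant maps to and from [V (x) X] built from indexed families *)

Section StandardTensor.

Variables (F : fieldType) (n : nat).
Local Notation rep := (representation F [set: 'S_n]%G).
Local Notation lin M N := ('M[F]_(rdegree M, rdegree N)).

Local Notation ones_row := (const_mx 1 : 'rV[F]_n).
Local Notation ones_col := (const_mx 1 : 'cV[F]_n).

(* V is the subquotient 1^perp / 1 of the natural permutation module: S is a
   linear lift V -> 1^perp, and Q extends the projection 1^perp -> V. *)
Record standard_section (V : rep) := StandardSection {
  sec : 'M[F]_(rdegree V, n);
  prj : 'M[F]_(n, rdegree V);
  sec_act : forall g : 'S_n, exists b, V g *m sec = sec *m perm_mx g + b *m ones_row;
  prj_act : forall g : 'S_n, exists h, prj *m V g = perm_mx g *m prj + ones_col *m h;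
  sec_sum : sec *m ones_col = 0;
  prj_sum : ones_row *m prj = 0;
  sec_prj : sec *m prj = 1%:M;
  prj_sec : exists h, exists b, prj *m sec = 1%:M + ones_col *m h + b *m ones_row }.

Variables (V : rep) (sV : standard_section V).
Local Notation S := (sec sV).
Local Notation Q := (prj sV).

Lemma sec_sumE a : \sum_k S a k = 0.
Proof.
have /matrixP/(_ a 0) := sec_sum sV; rewrite !mxE => E; rewrite -[RHS]E.
by apply: eq_bigr => k _; rewrite mxE mulr1.
Qed.

Lemma prj_sumE a : \sum_k Q k a = 0.
Proof.
have /matrixP/(_ 0 a) := prj_sum sV; rewrite !mxE => E; rewrite -[RHS]E.
by apply: eq_bigr => k _; rewrite mxE mul1r.
Qed.

Lemma tprod_block_col_const (X Y : rep) m (A : 'M[F]_(m, n))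
    (B : lin X X) (C : lin X Y) :
  A *m ones_col = 0 -> tprod A B *m block_col (fun _ => C) = 0.
Proof.
move=> A0; rewrite tprod_block_col; apply/pair_mxP=> i a j.
rewrite block_colE -scaler_suml.
have /matrixP/(_ i 0) := A0; rewrite [RHS]mxE [in X in X -> _]mxE => Ai0.
by rewrite (eq_bigr (fun k => A i k * ones_col k 0)) ?Ai0 ?scale0r ?mxE // => k _;
  rewrite mxE mulr1.
Qed.

(** Two defects cancel: [S] is equivariant up to multiples of the all-ones row, killed because the
    [f i] sum to zero; and [f] is equivariant up to a [C] independent of [i], killed because the
    rows of [S] sum to zero. *)
Lemma sec_hom (X Y : rep) (f : 'I_n -> lin X Y) :
    \sum_i f i = 0 ->
    (forall g : 'S_n, exists C, forall i, X g *m f (g i) = f i *m Y g + C) ->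
  mx_hom (M := prod_grepr V X) (N := Y) (tprod S 1%:M *m block_col f).
Proof.
move=> f0 hf g _; have [b defV] := sec_act sV g; have [C defC] := hf g.
rewrite mulmxA /= -tprodE defV mulmx1 -[X g]mul1mx tprodDl mulmxDl.
have -> : tprod (b *m ones_row) (1%:M *m X g) *m block_col f = 0.
  rewrite tprod_block_col; apply/pair_mxP=> i a j; rewrite block_colE mul1mx.
  rewrite (eq_bigr (fun k => b i 0 *: (X g *m f k))) => [|k _].
    by rewrite -scaler_sumr -mulmx_sumr f0 mulmx0 scaler0 !mxE.
  by rewrite mxE big_ord1 [ones_row _ _]mxE mulr1.
rewrite addr0 tprodE -!mulmxA; rewrite [tprod (perm_mx g) _ *m _]tprod_block_col.
have -> : block_col (fun i => \sum_k perm_mx g i k *: (X g *m f k))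
          = block_col f *m Y g + block_col (fun _ => C).
  rewrite block_col_mul; apply/pair_mxP=> i a j; rewrite [RHS]mxE !block_colE.
  rewrite (bigD1 (g i)) //= perm_mxE eqxx scale1r big1 => [|k ne_k].
    by rewrite addr0 defC mxE.
  by rewrite perm_mxE eq_sym (negPf ne_k) scale0r.
by rewrite mulmxDr tprod_block_col_const ?addr0 ?mulmxA // sec_sum.
Qed.

(** Dual to [sec_hom]: the all-ones column in the defect of [Q] meets a family of sum zero, and the
    constant [C] meets the zero column sums of [Q]. *)
Lemma prj_hom (X Y : rep) (f : 'I_n -> lin Y X) :
    \sum_i f i = 0 ->
    (forall g : 'S_n, exists C, forall i, f i *m X g = Y g *m f (g i) + C) ->
  mx_hom (M := Y) (N := prod_grepr V X) (block_row f *m tprod Q 1%:M).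
Proof.
move=> f0 hf g _; have [h defV] := prj_act sV g; have [C defC] := hf g.
rewrite -[in RHS]mulmxA /= -tprodE defV mul1mx tprodDl mulmxDr.
have -> : block_row f *m tprod (ones_col *m h) (X g) = 0.
  rewrite block_row_tprod; apply/matrixP=> j l; case: (pair_ordP l) => i a.
  rewrite block_rowE (eq_bigr (fun k => h 0 i *: (f k *m X g))) => [|k _].
    by rewrite -scaler_sumr -mulmx_suml f0 mul0mx scaler0 !mxE.
  by rewrite mxE big_ord1 [ones_col _ _]mxE mul1r.
rewrite addr0 -[X g in RHS]mulmx1 tprodE !mulmxA.
have -> : block_row f *m tprod (perm_mx g) (X g)
          = Y g *m block_row f + block_row (fun _ => C).
  rewrite block_row_tprod mul_block_row; apply/matrixP=> j l.
  case: (pair_ordP l) => i a; rewrite [RHS]mxE !block_rowE.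
  rewrite (bigD1 (g^-1%g i)) //= perm_mxE permKV eqxx scale1r big1 => [|k ne_k].
    by rewrite addr0 defC permKV mxE.
  by rewrite perm_mxE (canF_eq (permK g)) (negPf ne_k) scale0r.
rewrite mulmxDl [X in _ = _ + X](_ : _ = 0) ?addr0 //.
rewrite block_row_tprod; apply/matrixP=> j l; case: (pair_ordP l) => i a.
by rewrite block_rowE -scaler_suml prj_sumE scale0r !mxE.
Qed.

(** [Q S] differs from the identity by terms containing an all-ones row or column, which vanish
    against families of sum zero. *)
Lemma prj_sec_cancel k q r (f : 'I_n -> 'M[F]_(q, k)) (h : 'I_n -> 'M[F]_(k, r)) :
    \sum_i f i = 0 -> \sum_i h i = 0 ->
  (block_row f *m tprod Q 1%:M) *m (tprod S 1%:M *m block_col h)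
  = \sum_i f i *m h i.
Proof.
move=> f0 h0; rewrite !mulmxA -(mulmxA (block_row f)) -tprodE mul1mx.
have [u [b ->]] := prj_sec sV.
rewrite !tprodDl tprod1 !mulmxDr !mulmxDl mulmx1 block_row_col.
have -> : block_row f *m tprod (ones_col *m u) 1%:M = 0.
  rewrite block_row_tprod; apply/matrixP=> j l; case: (pair_ordP l) => i a.
  rewrite block_rowE (eq_bigr (fun k => u 0 i *: f k)) => [|x _].
    by rewrite -scaler_sumr f0 scaler0 !mxE.
  by rewrite mxE big_ord1 [ones_col _ _]mxE mul1r mulmx1.
rewrite mul0mx addr0 -mulmxA.
have -> : tprod (b *m ones_row) 1%:M *m block_col h = 0.
  rewrite tprod_block_col; apply/pair_mxP=> i a j; rewrite block_colE.
  rewrite (eq_bigr (fun k => b i 0 *: h k)) => [|x _].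
    by rewrite -scaler_sumr h0 scaler0 !mxE.
  by rewrite mxE big_ord1 [ones_row _ _]mxE mulr1 mul1mx.
by rewrite mulmx0 addr0.
Qed.

End StandardTensor.

(** * Harmonic modules *)

Section HarmonicOperators.

Variables (F : fieldType) (p : nat).
Hypothesis charF : p \in [pchar F].

Local Notation d := #|{set 'I_p}|.
Local Notation op := 'M[F]_d.
Local Notation c i := (cre F i).
Local Notation a i := (ann F i).
Local Notation e := (@cre_sum F p).
Local Notation iota := (@ann_sum F p).
Local Notation num := (@num_op F p).
Local Notation D r := (harmonic_rep F p r).
Local Notation vac := (fock_vec F (set0 : {set 'I_p})).
Implicit Types (i k o : 'I_p) (r : nat).

Lemma pF0 : p%:R = 0 :> F.
Proof. exact: pcharf0. Qed.

(** The range of [r] avoids the only ambiguous residue, shared by the cardinals 0 and [p]. *)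
Lemma card_mod_eq (A : {set 'I_p}) r :
  (0 < r < p)%N -> #|A|%:R = r%:R :> F -> #|A| = r.
Proof.
move=> /andP[r0 rp] /eqP eqAr.
have leA : (#|A| <= p)%N by rewrite -[X in (_ <= X)%N]card_ord max_card.
have pr_p := pcharf_prime charF.
case: (leqP r #|A|) => [le_rA | lt_Ar].
  have : (p %| #|A| - r)%N by rewrite (dvdn_pcharf charF) natrB // subr_eq0.
  by move=> /dvdnP[[|[|q]]] ?; nia.
have : (p %| r - #|A|)%N.
  by rewrite (dvdn_pcharf charF) natrB 1?ltnW // subr_eq0 eq_sym.
by move=> /dvdnP[[|q]] ?; nia.
Qed.

Lemma mul_cre_e m (W : 'M_(m, d)) i : W *m c i *m e = - (W *m e *m c i).
Proof. by rewrite -!mulmxA cre_sum_cre mulmxN opprK. Qed.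

Lemma mul_ann_e m (W : 'M_(m, d)) i : W *m a i *m e = W - W *m e *m a i.
Proof.
by rewrite -!mulmxA cre_sum_ann mulmxBr mulmx1 opprB addrC subrK.
Qed.

Lemma mul_cre_iota m (W : 'M_(m, d)) i : W *m c i *m iota = W - W *m iota *m c i.
Proof. by rewrite -!mulmxA ann_sum_cre mulmxBr mulmx1 opprB addrC subrK. Qed.

Lemma mul_ann_iota m (W : 'M_(m, d)) i : W *m a i *m iota = - (W *m iota *m a i).
Proof. by rewrite -!mulmxA ann_sum_ann mulmxN opprK. Qed.

Lemma mul_cre_num m (W : 'M_(m, d)) i :
  W *m c i *m num = W *m num *m c i + W *m c i.
Proof. by rewrite -!mulmxA num_cre mulmxDr mulmxA. Qed.

Lemma mul_ann_num m (W : 'M_(m, d)) i :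
  W *m a i *m num = W *m num *m a i - W *m a i.
Proof. by rewrite -!mulmxA num_ann mulmxBr mulmxA. Qed.

Lemma mul_e_num m (W : 'M_(m, d)) : W *m e *m num = W *m num *m e + W *m e.
Proof.
suff en : e *m num = num *m e + e by rewrite -mulmxA en mulmxDr mulmxA.
rewrite /cre_sum mulmx_suml [X in _ = X + _]mulmx_sumr -big_split.
by apply: eq_bigr => i _ /=; apply: num_cre.
Qed.

(** On a harmonic [W], both [W c_i iota] and [W a_i e] equal [W] for every [i]. So single operators
    leave the harmonic vectors, while differences preserve them. *)
Definition up o i : op := c o - c i.
Definition down o i : op := a o - a i.
(** The last two terms carry the composites of [up] and [down]. The number operators at [i] and [k]
    drop out of double differences in [i] and [k]; they are added so that [mix i k] itself preserves
    harmonic vectors, with no base point. *)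
Definition mix i k : op := a i *m c i + a k *m c k + c i *m a k - a i *m c k.

Lemma harmonic_up m (W : 'M_(m, d)) r o i :
  (W <= harmonic F p r)%MS -> (W *m up o i <= harmonic F p r.+1)%MS.
Proof.
case/harmonicP=> We Wi Wn; apply/harmonicP.
rewrite /up mulmxBr !mulmxBl !mul_cre_e !mul_cre_iota !mul_cre_num We Wi Wn.
rewrite !mul0mx; split; try by rewrite subrr.
by rewrite -!scalemxAl -natr1 scalerDl scale1r scalerBr opprD addrACA.
Qed.

Lemma harmonic_down m (W : 'M_(m, d)) r o i : (0 < r)%N ->
  (W <= harmonic F p r)%MS -> (W *m down o i <= harmonic F p r.-1)%MS.
Proof.
case: r => // r _ /harmonicP[We Wi Wn]; apply/harmonicP => /=.
rewrite /down mulmxBr !mulmxBl !mul_ann_e !mul_ann_iota !mul_ann_num We Wi Wn.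
rewrite !mul0mx; split; try by rewrite subrr.
by rewrite -!scalemxAl -natr1 !scalerDl !scale1r !addrK scalerBr.
Qed.

Lemma harmonic_mix m (W : 'M_(m, d)) r i k :
  (W <= harmonic F p r)%MS -> (W *m mix i k <= harmonic F p r)%MS.
Proof.
case/harmonicP=> We Wi Wn; apply/harmonicP.
rewrite /mix mulmxBr !mulmxDr !mulmxA; split.
- rewrite mulmxBl !mulmxDl !(mul_cre_e, mul_ann_e) We !mul0mx !subr0 !oppr0 !mul0mx.
  by rewrite ?subr0 !opprK addrAC subrK addNr.
- rewrite mulmxBl !mulmxDl !(mul_cre_iota, mul_ann_iota) Wi.
  by rewrite !mul0mx ?oppr0 ?mul0mx ?subr0 ?addr0 addrK subrr.
rewrite mulmxBl !mulmxDl !(mul_cre_num, mul_ann_num) Wn -!scalemxAl.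
rewrite !mulmxBl !mulmxDl !subrK !addrK -!scalemxAl.
by rewrite scalerBr !scalerDr.
Qed.

(** The number operators at [i] sum to the degree, the one at [k] is repeated [p = 0] times, and the
    rest involves [e] or [iota] applied to [W]. *)
Lemma sum_mixl m (W : 'M_(m, d)) r k : (W <= harmonic F p r)%MS ->
  \sum_i W *m mix i k = r%:R *: W.
Proof.
case/harmonicP=> We Wi Wn; rewrite -mulmx_sumr sumrB !big_split /=.
rewrite sumr_const card_ord -scaler_nat pF0 scale0r addr0.
rewrite -!mulmx_suml mulmxBr !mulmxDr !mulmxA We Wi !mul0mx addr0 subr0.
exact: Wn.
Qed.

Lemma sum_mixr m (W : 'M_(m, d)) r i : (W <= harmonic F p r)%MS ->
  \sum_k W *m mix i k = r%:R *: W.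
Proof.
case/harmonicP=> We Wi Wn; rewrite -mulmx_sumr sumrB !big_split /=.
rewrite sumr_const card_ord -scaler_nat pF0 scale0r add0r.
rewrite -!mulmx_sumr mulmxBr !mulmxDr !mulmxA mul_cre_iota mul_ann_e We Wi.
by rewrite !mul0mx subr0 addrK.
Qed.

(** Up to terms depending on at most one of [i] and [k], which [S] and [Q] annihilate, the base
    point disappears. *)
Lemma up_down o i k :
  up o i *m down o k - down o i *m up o k = mix i k - mix i o - mix o k + mix o o.
Proof.
rewrite /up /down /mix !mulmxBl !mulmxBr.
move: (a i *m c i) (a k *m c k) (a o *m c o) (c i *m a k) (a i *m c k) (c i *m a o).
move: (a i *m c o) (c o *m a k) (a o *m c k) (c o *m a o) => *.
by apply/matrixP=> x y; rewrite !mxE; ring.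
Qed.

(* Locked, so that [mulmxA] does not see through them. *)
Definition inc r : 'M[F]_(rdegree (D r), d) := locked (val_submod 1%:M).
Definition out r : 'M[F]_(d, rdegree (D r)) :=
  locked (in_submod (harmonic F p r) 1%:M).

Lemma incK r : inc r *m out r = 1%:M.
Proof. by rewrite /inc /out -!lock -in_submodE val_submodK. Qed.

Lemma outK m (W : 'M_(m, d)) r : (W <= harmonic F p r)%MS -> W *m out r *m inc r = W.
Proof.
by move=> Wr; rewrite /inc /out -!lock -in_submodE -val_submodE in_submodK.
Qed.

Lemma inc_harmonic r : (inc r <= harmonic F p r)%MS.
Proof. by rewrite /inc -lock val_submod1. Qed.

Lemma incJ r g : D r g *m inc r = inc r *m fock_mx F g.
Proof. by rewrite /inc -lock -val_submodE -[D r g]mul1mx val_submodJ ?inE. Qed.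

Lemma outJ m (W : 'M_(m, d)) r g : (W <= harmonic F p r)%MS ->
  W *m out r *m D r g = W *m fock_mx F g *m out r.
Proof. by move=> Wr; rewrite /out -lock -!in_submodE -in_submodJ. Qed.

Lemma vac_ann i : vac *m a i = 0.
Proof. by rewrite fock_vec_ann inE. Qed.

Lemma vac_iota : vac *m iota = 0.
Proof. by rewrite mulmx_sumr big1 // => i _; apply: vac_ann. Qed.

Lemma vac_num : vac *m num = 0.
Proof. by rewrite fock_vec_num cards0 scale0r. Qed.

Lemma vac_act g : vac *m fock_mx F g = vac.
Proof. by rewrite fock_vec_mx act_sign0 imset0 scale1r. Qed.

Lemma vac_trace : vac *m vac^T = 1%:M.
Proof. by rewrite trmx_delta mul_delta_mx; apply/matrixP=> x y; rewrite !mxE !ord1. Qed.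

Lemma act_vacT g : fock_mx F g *m vac^T = vac^T.
Proof.
apply: fock_eqP => A; rewrite mulmxA fock_vec_mx -scalemxAl.
have vE B : fock_vec F B *m vac^T = (B == set0)%:R%:M.
  rewrite trmx_delta mul_delta_mx_cond (inj_eq enum_rank_inj).
  by case: eqP => _; apply/matrixP=> x y; rewrite !mxE !ord1.
rewrite !vE imset_eq0; case: eqP => [->|_]; last by rewrite raddf0 scaler0.
by rewrite act_sign0 scale1r.
Qed.

(** Degree 1 modulo [p] means degree 1 exactly, so contraction yields a multiple of the vacuum,
    whose coefficient [vac^T] extracts. *)
Lemma degree1_ann m (W : 'M_(m, d)) i :
  W *m num = W -> W *m a i = W *m a i *m vac^T *m vac.
Proof.
move=> Wn; apply/row_matrixP=> x; rewrite !row_mul.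
have {Wn} : row x W *m num = row x W by rewrite -row_mul Wn.
move: (row x W) => w wn.
have w1 (A : {set 'I_p}) : w 0 (enum_rank A) != 0 -> #|A| = 1%N.
  move=> wA; apply: (@card_mod_eq A 1); first by rewrite (prime_gt1 (pcharf_prime charF)).
  have /rowP/(_ (enum_rank A)) := wn.
  rewrite mxE (bigD1 (enum_rank A)) //= big1 ?addr0 => [|b neb]; last first.
    have -> : num b (enum_rank A) = (fock_vec F (enum_val b) *m num) 0 (enum_rank A).
      by rewrite fock_vecE mxE enum_valK.
    by rewrite fock_vec_num !mxE enum_valK eq_sym (negPf neb) andbF !mulr0.
  have -> : num (enum_rank A) (enum_rank A) = #|A|%:R.
    have := fock_vec_num F A; rewrite fock_vecE => /rowP/(_ (enum_rank A)).
    by rewrite !mxE !eqxx mulr1.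
  by rewrite -[X in _ = X]mulr1 => /(mulfI wA).
have wE : w = \sum_b w 0 b *: fock_vec F (enum_val b).
  by rewrite {1}[w]row_sum_delta; apply: eq_bigr => b _; rewrite /fock_vec enum_valK.
rewrite wE !mulmx_suml; apply: eq_bigr => b _.
have [w0 | w0] := eqVneq (w 0 b) 0; first by rewrite w0 !scale0r !mul0mx.
have /eqP/cards1P[k ->] : #|(enum_val b : {set 'I_p})| = 1%N.
  by apply: w1; rewrite enum_valK.
rewrite -!scalemxAl; congr (_ *: _); rewrite fock_vec_ann.
case: ifP => [|_]; last by rewrite !mul0mx.
rewrite in_set1 => /eqP->; rewrite setDv -!scalemxAl vac_trace mul1mx.
by [].
Qed.

(** A harmonic 2-vector [W] satisfies [W = W a_o e], so it is represented by [w = W a_o], a vector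
    of [1^perp] determined modulo the all-ones vector. The entries are the coordinates of this
    representative, the one that vanishes at [o]. *)
Definition std_sec o : 'M[F]_(rdegree (D 2), p) :=
  \matrix_(x, i) (inc 2 *m a o *m a i *m vac^T) x 0.

(** Subtracting [e_o] moves [e_k] into [1^perp], which makes its product with [e] harmonic. *)
Definition std_prj o : 'M[F]_(p, rdegree (D 2)) :=
  \matrix_k (vac *m (c k - c o) *m e *m out 2).

Lemma mul_std_sec m (X : 'M_(m, _)) o x i :
  (X *m std_sec o) x i = (X *m inc 2 *m a o *m a i *m vac^T) x 0.
Proof.
rewrite -!(mulmxA X) !mxE; apply: eq_bigr => y _; rewrite !mxE.
by rewrite -!mulmxA.
Qed.

Lemma vac_e_harmonic : (vac *m e <= harmonic F p 1)%MS.
Proof.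
apply/harmonicP; split.
- by rewrite -(mulmxA _ e) cre_sum2 mulmx0.
- rewrite -(mulmxA _ e) cre_sum_ann_sum pF0 raddf0 sub0r mulmxN.
  by rewrite (mulmxA vac) vac_iota mul0mx oppr0.
by rewrite mul_e_num vac_num mul0mx add0r scale1r.
Qed.

Lemma vac_pair_harmonic k o : (vac *m (c k - c o) *m e <= harmonic F p 2)%MS.
Proof.
have vc i : vac *m c i *m iota = vac by rewrite mul_cre_iota vac_iota mul0mx subr0.
have vn i : vac *m c i *m num = vac *m c i.
  by rewrite mul_cre_num vac_num mul0mx add0r.
apply/harmonicP; split.
- by rewrite -(mulmxA _ e) cre_sum2 mulmx0.
- rewrite -(mulmxA _ e) cre_sum_ann_sum pF0 raddf0 sub0r mulmxN mulmxA mulmxBr mulmxBl.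
  by rewrite !vc subrr mul0mx oppr0.
rewrite mul_e_num mulmxBr (mulmxBl _ _ num) !vn -mulr2n.
by rewrite scaler_nat.
Qed.

Lemma vac_e_ann i : vac *m e *m a i *m vac^T = 1%:M.
Proof.
rewrite -(mulmxA vac) cre_sum_ann mulmxBr mulmx1 mulmxA vac_ann mul0mx subr0.
exact: vac_trace.
Qed.

Lemma standard_section_harmonic o : standard_section (D 2).
Proof.
have /harmonicP[Ie Ii In] := inc_harmonic 2.
have ae i : inc 2 *m a i *m e = inc 2 by rewrite mul_ann_e Ie mul0mx subr0.
have an i : inc 2 *m a i *m num = inc 2 *m a i.
  by rewrite mul_ann_num In -scalemxAl scaler_nat mulr2n addrK.
apply: (@StandardSection _ _ _ (std_sec o) (std_prj o)).
(* Acting by [g] moves the base point. The two lifts differ by [x], which has degree 1 and is killed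
   by [e], hence is a multiple of the all-ones vector [vac e]. *)
- move=> g; pose o' := (g^-1%g o).
  pose x := inc 2 *m (a o' - a o).
  have xe : x *m e = 0 by rewrite /x mulmxBr mulmxBl !ae subrr.
  have xn : x *m num = x by rewrite /x mulmxBr mulmxBl !an.
  have xa i : x = x *m a i *m vac^T *m vac *m e.
    by rewrite -degree1_ann // mul_ann_e xe mul0mx subr0.
  exists (x *m a o *m vac^T); apply/matrixP=> y i; rewrite mul_std_sec incJ [RHS]mxE.
  have -> : (std_sec o *m perm_mx g) y i = std_sec o y (g^-1%g i).
    rewrite mxE (bigD1 (g^-1%g i)) //= perm_mxE permKV eqxx mulr1 big1 ?addr0 // => k.
    by rewrite perm_mxE (canF_eq (permK g)) => /negPf->; rewrite mulr0.
  have -> : (x *m a o *m vac^T *m (const_mx 1 : 'rV_p)) y i = (x *m a o *m vac^T) y 0.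
    by rewrite mxE big_ord1 [const_mx _ _ _]mxE mulr1.
  have -> : x *m a o *m vac^T = x *m a (g^-1%g i) *m vac^T.
    transitivity (x *m a (g^-1%g i) *m vac^T *m (vac *m e *m a o *m vac^T)).
      by rewrite {1}(xa (g^-1%g i)) -!mulmxA.
    by rewrite vac_e_ann mulmx1.
  rewrite [std_sec _ _ _]mxE.
  have fa k : fock_mx F g *m a k = a (g^-1%g k) *m fock_mx F g.
    by rewrite fock_ann permKV.
  rewrite -(mulmxA _ _ (a o)) fa mulmxA -(mulmxA _ _ (a i)) fa mulmxA.
  rewrite -(mulmxA _ (fock_mx F g)) act_vacT.
  rewrite [in RHS]/x mulmxBr !mulmxBl [X in _ = _ + X]mxE [X in _ + (_ + X)]mxE.
  by rewrite addrC subrK.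
(* The correction is the change of base point from [o] to [g o], the same for every [k]. *)
- move=> g; exists (- (vac *m (c (g o) - c o) *m e *m out 2)).
  apply/row_matrixP=> k; rewrite row_mul rowK outJ ?vac_pair_harmonic //.
  have rowD (A B : 'M[F]_(p, rdegree (D 2))) : row k (A + B) = row k A + row k B.
    exact: linearD.
  have -> : row k (perm_mx g *m std_prj o + const_mx 1
                   *m - (vac *m (c (g o) - c o) *m e *m out 2))
            = row (g k) (std_prj o)
              + row k (const_mx 1) *m - (vac *m (c (g o) - c o) *m e *m out 2).
    rewrite rowD; congr (_ + _); last exact: row_mul.
    by rewrite -row_permE; apply/rowP=> y; rewrite !mxE.
  rewrite rowK.
  have -> : row k (const_mx 1 : 'cV[F]_p) = 1%:M.
    by apply/matrixP=> x y; rewrite !mxE !ord1.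
  rewrite mul1mx -mulmxBl -mulmxBl -mulmxBr opprB addrA subrK.
  rewrite -(mulmxA _ e) fock_cre_sum !mulmxA.
  suff -> : vac *m (c k - c o) *m fock_mx F g = vac *m (c (g k) - c (g o)) by [].
  by rewrite -(mulmxA vac) mulmxBl !fock_cre -mulmxBr mulmxA vac_act.
- apply/matrixP=> x y; rewrite ord1 mxE [RHS]mxE.
  under eq_bigr => i _ do rewrite [const_mx _ _ _]mxE mulr1 mxE.
  rewrite -summxE -mulmx_suml -mulmx_sumr.
  by rewrite mul_ann_iota Ii mul0mx oppr0 mul0mx mxE.
- apply/rowP=> y; rewrite mxE [RHS]mxE.
  under eq_bigr => i _ do rewrite [const_mx _ _ _]mxE mul1r mxE.
  rewrite -summxE -!mulmx_suml -mulmx_sumr sumrB sumr_const card_ord.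
  by rewrite -scaler_nat pF0 scale0r subr0 -(mulmxA vac) cre_sum2 mulmx0 mul0mx mxE.
(* Summing over [i] restores the representative [inc 2 a_o] (the [c_o] part dies by [iota]), and [e]
   recovers the 2-vector. *)
- transitivity (inc 2 *m a o *m e *m out 2); last by rewrite ae incK.
  have -> : std_sec o *m std_prj o
            = \sum_i inc 2 *m a o *m a i *m (c i - c o) *m e *m out 2.
    apply/matrixP=> x y; rewrite mxE summxE; apply: eq_bigr => i _.
    have -> : inc 2 *m a o *m a i *m (c i - c o) *m e *m out 2
        = inc 2 *m a o *m a i *m vac^T *m (vac *m (c i - c o) *m e *m out 2).
      by rewrite {1}degree1_ann ?an // !mulmxA.
    by rewrite [RHS]mxE big_ord1 [std_prj o i y]mxE [std_sec o x i]mxE.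
  rewrite -!mulmx_suml; congr (_ *m _ *m _).
  rewrite (eq_bigr (fun i => inc 2 *m a o *m (a i *m c i)
                              - inc 2 *m a o *m a i *m c o)) => [|i _]; last first.
    by rewrite mulmxBr !mulmxA.
  rewrite sumrB -mulmx_sumr -mulmx_suml -mulmx_sumr.
  by rewrite mul_ann_iota Ii mul0mx oppr0 mul0mx subr0 an.
(* [e_k] goes to [e_k - e_o], normalized to vanish at [o] by subtracting its coordinate there,
   [(k == o) - 1], times the all-ones row. *)
exists (\row_i - (o == i)%:R), (\col_k (1 - (k == o)%:R)).
have vca k i : vac *m c k *m a i = (k == i)%:R *: vac.
  by rewrite -mulmxA cre_ann mulmxBr mulmxA vac_ann mul0mx subr0 mul_mx_scalar.
apply/matrixP=> k i; rewrite mul_std_sec.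
set X := std_prj o *m _ *m _ *m _ *m _.
transitivity (row k X 0 0); first by rewrite [RHS]mxE.
rewrite /X !row_mul rowK outK ?vac_pair_harmonic // -(mulmxA _ e) cre_sum_ann.
have Wa x : vac *m (c k - c o) *m a x = ((k == x)%:R - (o == x)%:R) *: vac.
  by rewrite mulmxBr mulmxBl !vca scalerBl.
move: (vac *m (c k - c o)) Wa => W Wa.
rewrite mulmxBr mulmx1 mulmxA Wa eqxx mulmxBl Wa -!scalemxAl mulmxBl.
rewrite -!scalemxAl vac_trace vac_e_ann.
rewrite !mxE !big_ord1 !mxE !eqxx. by rewrite /= mulr1n; ring.
Qed.

End HarmonicOperators.

(** * The stable splitting of [V (x) X] *)

Section StandardTensorSplit.

Variables (F : fieldType) (p : nat).
Hypothesis charF : p \in [pchar F].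
Local Notation rep := (representation F [set: 'S_p]%G).
Local Notation lin M N := ('M[F]_(rdegree M, rdegree N)).
Variables (V : rep) (sV : standard_section V).
Local Notation S := (sec sV).
Local Notation Q := (prj sV).

Definition block_square k (X : 'I_p -> 'I_p -> 'M[F]_k) : 'M[F]_(p * k) :=
  block_col (fun i => block_row (X i)).

Lemma block_squareE k (X : 'I_p -> 'I_p -> 'M[F]_k) i x j y :
  block_square X (pair_ord i x) (pair_ord j y) = X i j x y.
Proof. by rewrite block_colE block_rowE. Qed.

Lemma block_col_row k l (f : 'I_p -> 'M[F]_(k, l)) (g : 'I_p -> 'M[F]_(l, k)) :
  block_col f *m block_row g = block_square (fun i j => f i *m g j).
Proof.
apply/pair2_mxP=> i x j y; rewrite block_squareE !mxE; apply: eq_bigr => z _.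
by rewrite block_colE block_rowE.
Qed.

Lemma sandwich_row k (X : 'I_p -> 'M[F]_k) :
  block_square (fun i j => X i) *m tprod Q (1%:M : 'M[F]_k) = 0.
Proof.
rewrite /block_square block_col_mul; apply/pair_mxP=> i x l; rewrite block_colE.
rewrite block_row_tprod; case: (pair_ordP l) => j y; rewrite block_rowE.
by rewrite -scaler_suml prj_sumE scale0r !mxE.
Qed.

Lemma sandwich_col k (X : 'I_p -> 'M[F]_k) :
  tprod S (1%:M : 'M[F]_k) *m block_square (fun i j => X j) = 0.
Proof.
rewrite /block_square tprod_block_col; apply/pair_mxP=> i x l; rewrite block_colE.
by rewrite -scaler_suml sec_sumE scale0r !mxE.
Qed.

Lemma block_square_delta k :
  block_square (fun i j => (i == j)%:R%:M : 'M[F]_k) = 1%:M.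
Proof.
rewrite -[RHS]tprod1; apply/pair2_mxP=> i x j y.
rewrite block_squareE tprodEpair !mxE.
by case: (i == j); rewrite ?mul1r ?mul0r // mul0rn.
Qed.

(** The hypotheses give [g f = 1], so [Z = f g - 1] satisfies [Z Z = -Z]. Moreover [Z = S B Q],
    where [B] has blocks [T i k / r] minus the identity. As rows and columns of [B] sum to zero, the
    inner [Q S] cancels and [Z Z = (S B) (B Q)], both factors being equivariant maps to and from the
    projective [F^p (x) X]. *)
Lemma standard_tensor (X L1 L2 : rep) (f1 : 'I_p -> lin X L1) (f2 : 'I_p -> lin X L2)
    (g1 : 'I_p -> lin L1 X) (g2 : 'I_p -> lin L2 X) (T : 'I_p -> 'I_p -> lin X X)
    (r : F) (o : 'I_p) :
    r != 0 ->
    \sum_i f1 i = 0 -> \sum_i f2 i = 0 -> \sum_i g1 i = 0 -> \sum_i g2 i = 0 ->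
    mx_hom (M := prod_grepr V X) (N := L1) (tprod S 1%:M *m block_col f1) ->
    mx_hom (M := prod_grepr V X) (N := L2) (tprod S 1%:M *m block_col f2) ->
    mx_hom (M := L1) (N := prod_grepr V X) (block_row g1 *m tprod Q 1%:M) ->
    mx_hom (M := L2) (N := prod_grepr V X) (block_row g2 *m tprod Q 1%:M) ->
    \sum_k g1 k *m f1 k = r%:M -> \sum_k g2 k *m f2 k = r%:M ->
    \sum_k g1 k *m f2 k = 0 -> \sum_k g2 k *m f1 k = 0 ->
    (forall i k, f1 i *m g1 k + f2 i *m g2 k = T i k - T i o - T o k + T o o) ->
    (forall k, \sum_i T i k = r%:M) -> (forall i, \sum_k T i k = r%:M) ->
    (forall (g : 'S_p) i k, X g *m T (g i) (g k) = T i k *m X g) ->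
  stably_iso (prod_grepr V X) (dadd_grepr L1 L2).
Proof.
move=> r0 z1 z2 z3 z4 hf1 hf2 hg1 hg2 s11 s22 s12 s21 fgT Tl Tr TJ.
pose NX : rep := prod_grepr (natural_rep F p) X.
pose f : lin (prod_grepr V X) (dadd_grepr L1 L2) :=
  row_mx (tprod S 1%:M *m block_col f1) (tprod S 1%:M *m block_col f2).
pose g : lin (dadd_grepr L1 L2) (prod_grepr V X) :=
  r^-1 *: col_mx (block_row g1 *m tprod Q 1%:M) (block_row g2 *m tprod Q 1%:M).
have hf : mx_hom f by apply: row_mx_hom.
have hg : mx_hom g.
  have hg' : mx_hom (M := dadd_grepr L1 L2) (N := prod_grepr V X)
     (col_mx (block_row g1 *m tprod Q 1%:M) (block_row g2 *m tprod Q 1%:M)).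
    exact: col_mx_hom.
  by move=> h Gh; rewrite -scalemxAl -scalemxAr hg'.
have gf1 : g *m f = 1%:M.
  rewrite -scalemxAl mul_col_row !(prj_sec_cancel sV) ?z1 ?z2 ?z3 ?z4 //.
  rewrite s11 s22 s12 s21 scale_block_mx !scaler0 !scale_scalar_mx.
  by rewrite mulVf // -scalar_mx_block.
(* Row and column sums of [T / r] are the identity; subtracting the identity makes them zero, as
   [sec_hom], [prj_hom] and [prj_sec_cancel] demand. *)
pose delta i k := r^-1 *: T i k - (i == k)%:R%:M.
have deltal k : \sum_i delta i k = 0.
  rewrite sumrB -scaler_sumr Tl scale_scalar_mx mulVf //.
  rewrite (bigD1 k) //= eqxx big1 ?addr0 ?subrr // => i /negPf->.
  by rewrite raddf0.
have deltar i : \sum_k delta i k = 0.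
  rewrite sumrB -scaler_sumr Tr scale_scalar_mx mulVf //.
  rewrite (bigD1 i) //= eqxx big1 ?addr0 ?subrr // => k.
  by rewrite eq_sym => /negPf->; rewrite raddf0.
have deltaJ (h : 'S_p) i k : X h *m delta (h i) (h k) = delta i k *m X h.
  rewrite mulmxBr mulmxBl (inj_eq perm_inj) scalar_mxC; congr (_ - _).
  by rewrite -scalemxAr -scalemxAl TJ.
pose B := block_square delta.
have Br : B = block_row (fun k => block_col (fun i => delta i k)).
  by apply/pair2_mxP=> i x j y; rewrite block_squareE block_rowE block_colE.
pose u : lin (prod_grepr V X) NX := tprod S 1%:M *m B.
pose w : lin NX (prod_grepr V X) := B *m tprod Q 1%:M.
have hu : mx_hom u.
  apply: (sec_hom sV (X := X) (Y := NX) (f := fun i => block_row (delta i))).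
    apply/matrixP=> x l; case: (pair_ordP l) => j y; rewrite summxE.
    under eq_bigr => i _ do rewrite block_rowE.
    by rewrite -summxE deltal !mxE.
  move=> h; exists 0 => i; rewrite addr0 mul_block_row /= block_row_tprod.
  apply/matrixP=> x l; case: (pair_ordP l) => j y; rewrite !block_rowE.
  rewrite (bigD1 (h^-1%g j)) //= perm_mxE permKV eqxx scale1r -deltaJ permKV.
  rewrite big1 ?addr0 // => k; rewrite perm_mxE (canF_eq (permK h)) => /negPf->.
  by rewrite scale0r.
have hw : mx_hom w.
  rewrite /w Br.
  apply: (prj_hom sV (X := X) (Y := NX) (f := fun k => block_col (fun i => delta i k))).
    apply/pair_mxP=> i x y; rewrite summxE.
    under eq_bigr => k _ do rewrite block_colE.
    by rewrite -summxE deltar !mxE.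
  move=> h; exists 0 => k; rewrite addr0 block_col_mul /= tprod_block_col.
  apply: eq_block_col => i.
  rewrite (bigD1 (h i)) //= perm_mxE eqxx scale1r -deltaJ big1 ?addr0 // => j.
  by rewrite perm_mxE eq_sym => /negPf->; rewrite scale0r.
pose Z : lin (prod_grepr V X) (prod_grepr V X) := f *m g - 1%:M.
have BT : B + 1%:M = r^-1 *: block_square T.
  rewrite -block_square_delta; apply/pair2_mxP=> i x j y.
  by rewrite [LHS]mxE [RHS]mxE !block_squareE !mxE subrK.
have defZ : Z = tprod S 1%:M *m B *m tprod Q 1%:M.
  rewrite /Z.
  have -> : f *m g = tprod S 1%:M *m (B + 1%:M) *m tprod Q 1%:M.
    (* Blocks depending only on the row index are killed by [Q], those depending only on the column
       index by [S]; only [T] survives. *)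
    have -> : f *m g = r^-1 *: (tprod S 1%:M *m
       (block_square T - block_square (fun i _ => T i o)
        - block_square (fun _ k => T o k) + block_square (fun _ _ => T o o))
        *m tprod Q 1%:M).
      rewrite -scalemxAr mul_row_col !mulmxA; congr (_ *: _).
      rewrite -mulmxDl -(mulmxA _ (block_col f1)) -(mulmxA _ (block_col f2)) -mulmxDr.
      rewrite !block_col_row; congr (_ *m _ *m _).
      apply/pair2_mxP=> i x j y; have /matrixP/(_ x y) := fgT i j.
      by rewrite [in X in X -> _]mxE => eqT; rewrite [LHS]mxE !block_squareE eqT !mxE !pair_ordK.
    rewrite BT -scalemxAr -scalemxAl; congr (_ *: _).
    rewrite mulmxDr mulmxDl -!mulmxA sandwich_row mulmx0 addr0 !mulmxA.
    rewrite mulmxBr sandwich_col subr0 mulmxBr mulmxBl.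
    by rewrite -(mulmxA _ (block_square (fun i _ => T i o))) sandwich_row mulmx0 subr0.
  by rewrite mulmxDr mulmxDl mulmx1 -tprodE mulmx1 sec_prj tprod1 addrK.
have BB : B *m tprod Q 1%:M *m (tprod S 1%:M *m B) = B *m B.
  rewrite {1 3}Br (prj_sec_cancel sV) ?block_row_col //.
    apply/pair_mxP=> i x y; rewrite summxE.
    under eq_bigr => k _ do rewrite block_colE.
    by rewrite -summxE deltar !mxE.
  apply/matrixP=> x l; case: (pair_ordP l) => j y; rewrite summxE.
  under eq_bigr => i _ do rewrite block_rowE.
  by rewrite -summxE deltal !mxE.
have ZZ : Z = - (u *m w).
  have -> : u *m w = Z *m Z.
    rewrite [in RHS]defZ; transitivity (tprod S 1%:M *m (B *m B) *m tprod Q 1%:M).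
      by rewrite /u /w !mulmxA.
    by rewrite -BB !mulmxA.
  have : Z *m Z = - Z.
    rewrite /Z mulmxBl mul1mx mulmxBr mulmx1 opprB -mulmxA (mulmxA g) gf1 mul1mx.
    by rewrite subrr add0r.
  by move->; rewrite opprK.
exists f, g; split=> //; last by rewrite gf1 subrr; apply: stably_zero0.
rewrite -/Z ZZ; apply/stably_zeroN/through_trace => //.
exact/projectiveP/natural_projective.
Qed.

End StandardTensorSplit.

(** * Tensoring harmonic modules with the standard module *)

Section HarmonicTensor.

Variables (F : fieldType) (p : nat).
Hypothesis charF : p \in [pchar F].

Local Notation d := #|{set 'I_p}|.
Local Notation op := 'M[F]_d.
Local Notation c i := (cre F i).
Local Notation a i := (ann F i).
Local Notation e := (@cre_sum F p).
Local Notation iota := (@ann_sum F p).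
Local Notation num := (@num_op F p).
Local Notation D r := (harmonic_rep F p r).
Local Notation inc r := (inc F p r).
Local Notation out r := (out F p r).
Local Notation up := (@up F p).
Local Notation down := (@down F p).
Local Notation mix := (@mix F p).
Implicit Types (i k o : 'I_p) (r s t : nat).

Variables (V : representation F [set: 'S_p]%G) (sV : standard_section V).
Local Notation S := (sec sV).
Local Notation Q := (prj sV).

Definition lands r s (A : 'I_p -> op) :=
  forall i, (inc r *m A i <= harmonic F p s)%MS.

(** The error [B] is independent of [i]. For [up] and [down] it comes from replacing the base point
    [o] by [g o]. *)
Definition quasi_equivariant (A : 'I_p -> op) :=
  forall g, exists B, forall i,
    fock_mx F g *m A (g i) = A i *m fock_mx F g + B.

Definition block r s (A : 'I_p -> op) i : 'M[F]_(rdegree (D r), rdegree (D s)) :=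
  inc r *m A i *m out s.

Lemma block_mul r s t A B i k : lands r s A ->
  block r s A i *m block s t B k = inc r *m A i *m B k *m out t.
Proof. by move=> lA; rewrite /block !mulmxA outK. Qed.

Lemma sum_block r s A : inc r *m (\sum_i A i) = 0 -> \sum_i block r s A i = 0.
Proof. by move=> A0; rewrite -mulmx_suml -mulmx_sumr A0 mul0mx. Qed.

Lemma block_sec_hom r s A :
    quasi_equivariant A -> lands r s A -> inc r *m (\sum_i A i) = 0 ->
  mx_hom (M := prod_grepr V (D r)) (N := D s)
    (tprod S 1%:M *m block_col (block r s A)).
Proof.
move=> qA lA A0; apply: (sec_hom sV (X := D r) (Y := D s)); first exact: sum_block.
move=> g; have [B defA] := qA g; exists (inc r *m B *m out s) => i.
rewrite /block outJ // !mulmxA incJ -(mulmxA (inc r) (fock_mx F g)) defA.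
by rewrite mulmxDr mulmxDl !mulmxA.
Qed.

Lemma block_prj_hom r s A :
    quasi_equivariant A -> lands r s A -> inc r *m (\sum_i A i) = 0 ->
  mx_hom (M := D r) (N := prod_grepr V (D s))
    (block_row (block r s A) *m tprod Q 1%:M).
Proof.
move=> qA lA A0; apply: (prj_hom sV (X := D s) (Y := D r)); first exact: sum_block.
move=> g; have [B defA] := qA g; exists (- (inc r *m B *m out s)) => i.
rewrite /block outJ // !mulmxA incJ -(mulmxA (inc r) (fock_mx F g)) defA.
by rewrite mulmxDr mulmxDl !mulmxA addrK.
Qed.

Lemma quasi_up o : quasi_equivariant (up o).
Proof.
move=> g; exists (fock_mx F g *m (c o - c (g o))) => i.
rewrite /up mulmxBl !fock_cre -mulmxBr -mulmxDr; congr (_ *m _).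
by rewrite [RHS]addrC addrA subrK.
Qed.

Lemma quasi_down o : quasi_equivariant (down o).
Proof.
move=> g; exists (fock_mx F g *m (a o - a (g o))) => i.
rewrite /down mulmxBl !fock_ann -mulmxBr -mulmxDr; congr (_ *m _).
by rewrite [RHS]addrC addrA subrK.
Qed.

Lemma quasi_downN o : quasi_equivariant (fun i => - down o i).
Proof.
move=> g; have [B defB] := quasi_down o g; exists (- B) => i.
by rewrite mulmxN defB mulNmx opprD.
Qed.

Lemma mixJ g i k : fock_mx F g *m mix (g i) (g k) = mix i k *m fock_mx F g.
Proof.
have ac x y : fock_mx F g *m (a (g x) *m c (g y)) = a x *m c y *m fock_mx F g.
  by rewrite mulmxA -fock_ann -!mulmxA fock_cre.
have ca x y : fock_mx F g *m (c (g x) *m a (g y)) = c x *m a y *m fock_mx F g.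
  by rewrite mulmxA -fock_cre -!mulmxA fock_ann.
by rewrite /mix mulmxBr !mulmxDr mulmxBl !mulmxDl !ac ca.
Qed.

Lemma sum_up o : \sum_i up o i = - e.
Proof. by rewrite sumrB sumr_const card_ord -scaler_nat pF0 // scale0r sub0r. Qed.

Lemma sum_down o : \sum_i down o i = - iota.
Proof. by rewrite sumrB sumr_const card_ord -scaler_nat pF0 // scale0r sub0r. Qed.

Section Degree.

Variables (o : 'I_p) (s : nat).
Hypothesis lt_s : (s.+1 < p)%N.

Local Notation r := (s.+1).
Local Notation rR := (r%:R : F).

Lemma degree_neq0 : rR != 0.
Proof.
rewrite -(dvdn_pcharf charF); apply/negP=> /dvdn_leq; lia.
Qed.

Local Notation X := (D r).
Local Notation fU := (block r r.+1 (up o)).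
Local Notation fD := (block r s (fun i => - down o i)).
Local Notation gD := (block r.+1 r (down o)).
Local Notation gU := (block s r (up o)).

Lemma inc_eqs t : [/\ inc t *m e = 0, inc t *m iota = 0 & inc t *m num = t%:R *: inc t].
Proof. by apply/harmonicP; apply: inc_harmonic. Qed.

Lemma lands_up : lands r r.+1 (up o).
Proof. by move=> i; apply/harmonic_up/inc_harmonic. Qed.

Lemma lands_downN : lands r s (fun i => - down o i).
Proof.
by move=> i; rewrite mulmxN eqmx_opp; apply: (@harmonic_down _ _ _ _ r) => //; apply: inc_harmonic.
Qed.

Lemma lands_down : lands r.+1 r (down o).
Proof. by move=> i; apply: (@harmonic_down _ _ _ _ r.+1) => //; apply: inc_harmonic. Qed.

Lemma lands_up_prev : lands s r (up o).
Proof. by move=> i; apply/harmonic_up/inc_harmonic. Qed.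

Lemma inc_sum_up : inc r *m (\sum_i up o i) = 0.
Proof. by have [h _ _] := inc_eqs r; rewrite sum_up mulmxN h oppr0. Qed.

Lemma inc_sum_downN : inc r *m (\sum_i - down o i) = 0.
Proof. by have [_ h _] := inc_eqs r; rewrite sumrN sum_down opprK h. Qed.

Lemma inc_sum_down : inc r.+1 *m (\sum_i down o i) = 0.
Proof. by have [_ h _] := inc_eqs r.+1; rewrite sum_down mulmxN h oppr0. Qed.

Lemma inc_sum_up_prev : inc s *m (\sum_i up o i) = 0.
Proof. by have [h _ _] := inc_eqs s; rewrite sum_up mulmxN h oppr0. Qed.

(** The term [W x y] is independent of [k] and is repeated [p = 0] times. *)
Lemma sum_differences (A B : 'I_p -> op) (x y : op) m (W : 'M[F]_(m, d)) :
  \sum_k W *m (x - A k) *m (y - B k)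
  = - (W *m x *m (\sum_k B k)) - W *m (\sum_k A k) *m y
    + W *m (\sum_k A k *m B k).
Proof.
rewrite (eq_bigr (fun k => W *m x *m y - W *m x *m B k - W *m A k *m y
                           + W *m (A k *m B k))) => [|k _].
  rewrite big_split !sumrB /= sumr_const card_ord -scaler_nat pF0 // scale0r sub0r.
  by rewrite -!mulmx_sumr -mulmx_suml -mulmx_sumr.
by rewrite !mulmxBr !mulmxBl opprB !mulmxA addrA [LHS]addrAC (addrAC _ (- (W *m A k *m y))).
Qed.

Lemma sum_down_up : \sum_k gD k *m fU k = rR%:M.
Proof.
have [We Wi Wn] := inc_eqs r.+1.
rewrite (eq_bigr (fun k => inc r.+1 *m (a o - a k) *m (c o - c k) *m out r.+1)) => [|k _].
  rewrite -mulmx_suml sum_differences mul_ann_e We Wi !mul0mx !subr0 -/num Wn.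
  rewrite -{1}[inc r.+1]scale1r -scaleNr -scalerDl -scalemxAl incK scale_scalar_mx mulr1.
  by rewrite -[r.+1%:R]natr1 addrC addrK.
exact/block_mul/lands_down.
Qed.

Lemma sum_up_down : \sum_k gU k *m fD k = rR%:M.
Proof.
have [We Wi Wn] := inc_eqs s.
rewrite (eq_bigr (fun k => - (inc s *m (c o - c k) *m (a o - a k) *m out s))) => [|k _].
  rewrite sumrN -mulmx_suml sum_differences mul_cre_iota We Wi !mul0mx !subr0.
  (* [c_k a_k = 1 - a_k c_k], and the [p] identities add up to zero. *)
  have -> : \sum_k c k *m a k = - num.
    rewrite (eq_bigr (fun k => 1%:M - a k *m c k)) => [|k _].
      by rewrite sumrB sumr_const card_ord -scaler_nat pF0 // scale0r sub0r.
    by rewrite cre_ann eqxx.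
  rewrite mulmxN Wn -{1}[inc s]scale1r -opprD -scalerDl mulNmx opprK -scalemxAl.
  by rewrite incK scale_scalar_mx mulr1 -[s.+1%:R]natr1 addrC.
by rewrite (block_mul _ _ _ _ lands_up_prev) mulmxN mulNmx.
Qed.

Lemma sum_down_down : \sum_k gD k *m fD k = 0.
Proof.
have [We Wi Wn] := inc_eqs r.+1.
rewrite (eq_bigr (fun k => - (inc r.+1 *m (a o - a k) *m (a o - a k) *m out s))) => [|k _].
  rewrite sumrN -mulmx_suml sum_differences mul_ann_iota Wi !mul0mx !(oppr0, addr0, add0r).
  by rewrite big1 => [|k _]; rewrite ?ann_ann // mulmx0 mul0mx oppr0.
by rewrite (block_mul _ _ _ _ lands_down) mulmxN mulNmx.
Qed.

Lemma sum_up_up : \sum_k gU k *m fU k = 0.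
Proof.
have [We Wi Wn] := inc_eqs s.
rewrite (eq_bigr (fun k => inc s *m (c o - c k) *m (c o - c k) *m out r.+1)) => [|k _].
  rewrite -mulmx_suml sum_differences mul_cre_e We !mul0mx !(oppr0, addr0, add0r).
  by rewrite big1 => [|k _]; rewrite ?cre_cre // mulmx0 mul0mx.
exact/block_mul/lands_up_prev.
Qed.

(** The minus sign in [fD] turns [fU gD + fD gU] into the left side of [up_down], and makes both
    diagonal sums equal to the same nonzero scalar [r]. *)
Lemma harmonic_tensor : stably_iso (prod_grepr V X) (dadd_grepr (D r.+1) (D s)).
Proof.
pose T i k := block r r (fun k => mix i k) k.
apply: (@standard_tensor F p charF V sV X (D r.+1) (D s) fU fD gD gU T rR o).
- exact: degree_neq0.
- exact: (sum_block _ inc_sum_up).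
- exact: (sum_block _ inc_sum_downN).
- exact: (sum_block _ inc_sum_down).
- exact: (sum_block _ inc_sum_up_prev).
- exact: (block_sec_hom (quasi_up o) lands_up inc_sum_up).
- exact: (block_sec_hom (quasi_downN o) lands_downN inc_sum_downN).
- exact: (block_prj_hom (quasi_down o) lands_down inc_sum_down).
- exact: (block_prj_hom (quasi_up o) lands_up_prev inc_sum_up_prev).
- exact: sum_down_up.
- exact: sum_up_down.
- exact: sum_down_down.
- exact: sum_up_up.
- move=> i k.
  rewrite (block_mul _ _ _ _ lands_up) (block_mul _ _ _ _ lands_downN) /T /block.
  transitivity (inc r *m (up o i *m down o k - down o i *m up o k) *m out r).
    move: (up o i) (up o k) (down o i) (down o k) => U1 U2 D1 D2.
    by rewrite mulmxN !mulNmx mulmxBr mulmxBl !mulmxA.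
  rewrite up_down; move: (mix i k) (mix i o) (mix o k) (mix o o) => X1 X2 X3 X4.
  by rewrite mulmxDr mulmxDl !mulmxBr !mulmxBl.
- move=> k; rewrite -mulmx_suml (sum_mixl charF _ (inc_harmonic F p r)) -scalemxAl.
  by rewrite incK scale_scalar_mx mulr1.
- move=> i; rewrite -mulmx_suml (sum_mixr charF _ (inc_harmonic F p r)) -scalemxAl.
  by rewrite incK scale_scalar_mx mulr1.
move=> g i k; rewrite /T /block outJ ?harmonic_mix ?inc_harmonic // !mulmxA incJ.
by rewrite -(mulmxA (inc r) (fock_mx F g)) mixJ mulmxA.
Qed.

End Degree.

End HarmonicTensor.

(** * Signs of permutations acting on basis wedges *)

Section SignedAction.

Variables (F : fieldType) (n : nat).
Implicit Types (A B : {set 'I_n}) (s g : 'S_n).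

Lemma imset_fix s A : {in A, s =1 id} -> s @: A = A.
Proof.
by move=> sA; rewrite -[RHS]imset_id; apply: eq_in_imset => x /sA.
Qed.

Lemma act_sign_fix s A : {in A, s =1 id} -> act_sign F s A = 1.
Proof.
move=> sA; rewrite /act_sign /pair_prod big1 // => i iA; rewrite big1 // => k.
by case/andP=> kA _; rewrite /inv_sign !sA // ord_sign2.
Qed.

Lemma act_tperm x y A : x \in A -> y \in A -> x != y ->
  act_sign F (tperm x y) A = -1.
Proof.
move=> xA yA ne_xy.
have yB : y \notin A :\ x :\ y by rewrite setD11.
have xB : x \notin y |: (A :\ x :\ y).
  by rewrite !inE (negPf ne_xy) eqxx.
have fixB : {in A :\ x :\ y, tperm x y =1 id}.
  by move=> z; rewrite !inE => /and3P[zy zx _]; rewrite tpermD // eq_sym.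
have defA : A = x |: (y |: (A :\ x :\ y)).
  by rewrite (setD1K (_ : y \in A :\ x)) ?setD1K // !inE eq_sym ne_xy.
rewrite [in LHS]defA act_signU // act_signU // act_sign_fix //.
rewrite imset_permU tpermL tpermR (imset_fix fixB) !set_signU //; last first.
  by rewrite !inE eqxx andbF.
rewrite (ord_signN F ne_xy).
set u := set_sign _ x _; set v := set_sign _ y _; set w := ord_sign _ y x.
have u2 : u * u = 1 by apply: set_sign2.
have v2 : v * v = 1 by apply: set_sign2.
have w2 : w * w = 1 by apply: ord_sign2.
transitivity (- ((u * u) * (v * v) * (w * w))); first by ring.
by rewrite u2 v2 w2 !mulr1.
Qed.

Lemma perm_on_stab s A : perm_on A s -> s @: A = A.
Proof.
move=> sA; apply/setP=> x; apply/imsetP/idP => [[y yA ->]|xA].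
  by rewrite perm_closed.
by exists (s^-1%g x); rewrite ?permKV // perm_closed ?perm_onV.
Qed.

(** Induction on the number of moved points: composing [s] with the transposition of [x] and [s x]
    makes [x] fixed. *)
Lemma act_perm_on s A : perm_on A s -> act_sign F s A = (-1) ^+ s.
Proof.
have [m] := ubnP #|[set x | s x != x]|; elim: m s => // m IHm s.
rewrite ltnS => le_m sA.
have [s1 | [x]] := set_0Vmem [set x | s x != x].
  have -> : s = 1%g.
    by apply/permP=> x; rewrite perm1; apply/eqP; move/setP/(_ x): s1; rewrite !inE => /negbFE.
  by rewrite act_sign_fix ?odd_perm1 // => x _; rewrite perm1.
rewrite inE => sx.
have xA : x \in A by apply: (subsetP sA).
have sxA : s x \in A by rewrite perm_closed.
pose k := (s * tperm x (s x))%g.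
have ton : perm_on A (tperm x (s x)).
  apply/subsetP=> y; rewrite inE; case: tpermP => [-> | -> |]; rewrite ?eqxx //.
have kA : perm_on A k by apply: perm_onM.
have kx : k x = x by rewrite permM tpermR.
have def_s : s = (k * tperm x (s x))%g by rewrite /k -mulgA tperm2 mulg1.
rewrite def_s act_signM (perm_on_stab kA) act_tperm // 1?eq_sym // IHm //; last first.
  apply: leq_trans le_m; apply: proper_card; apply/properP; split.
    apply/subsetP=> y; rewrite !inE; apply: contra => /eqP sy.
    rewrite permM sy tpermD //; first by apply: contraNneq sx => ->; rewrite sy.
    by apply: contraNneq sx => sxy; apply/eqP/(@perm_inj _ s); rewrite sxy sy.
  by exists x; rewrite !inE ?sx // kx eqxx.
by rewrite odd_permM odd_tperm eq_sym sx addbT; case: (odd_perm k); rewrite !(mulN1r, mulrN1, opprK, expr0, expr1, mul1r).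
Qed.

Lemma fock_perm_on s A : perm_on A s ->
  fock_vec F A *m fock_mx F s = (-1) ^+ s *: fock_vec F A.
Proof. by move=> sA; rewrite fock_vec_mx act_perm_on // perm_on_stab. Qed.

Lemma fock_fix s A : {in A, s =1 id} -> fock_vec F A *m fock_mx F s = fock_vec F A.
Proof.
by move=> sA; rewrite fock_vec_mx act_sign_fix // scale1r (imset_fix sA).
Qed.

Lemma fock_coord_perm_on s A (v : 'rV[F]_#|{set 'I_n}|) : perm_on A s ->
  (v *m fock_mx F s) 0 (enum_rank A) = (-1) ^+ s * v 0 (enum_rank A).
Proof.
move=> sA; rewrite mxE (bigD1 (enum_rank A)) //= big1 ?addr0 => [|b neb].
  by rewrite mxE enum_rankK perm_on_stab // eqxx act_perm_on // mulrC.
rewrite mxE; case: eqP; rewrite ?mulr0 // enum_rankK => eA.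
case/eqP: neb; apply: enum_val_inj; rewrite enum_rankK.
apply: (imset_inj (@perm_inj _ s)).
by rewrite -eA perm_on_stab.
Qed.

(** Replacing the factor [e_y] by [e_x] in place is what the transposition does. Contractions
    thereby become group elements that a signed column sum can absorb. *)
Lemma fock_swap A x y : y \in A -> x \notin A ->
  fock_vec F A *m ann F y *m cre F x = fock_vec F A *m fock_mx F (tperm x y).
Proof.
move=> yA xA; rewrite fock_vec_ann yA -scalemxAl fock_vec_cre fock_vec_mx.
have yB : y \notin A :\ y by rewrite setD11.
have xB : x \notin A :\ y by rewrite !inE (negPf xA) andbF.
have fixB : {in A :\ y, tperm x y =1 id}.
  move=> z; rewrite !inE => /andP[zy zA]; rewrite tpermD // 1?eq_sym //.
  by apply: contraNneq xA => <-.
have defA : A = y |: (A :\ y) by rewrite setD1K.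
rewrite (negPf xB) [in RHS]defA act_signU // act_sign_fix // imset_permU tpermR.
by rewrite (imset_fix fixB) scalerA mul1r.
Qed.

End SignedAction.

(** * Hook Specht modules *)

Section HookTableaux.

Variables (p i : nat).
Hypotheses (p_gt1 : (1 < p)%N) (le_i : (i <= p - 2)%N).

Local Notation q := (p - i)%N.
Local Notation la := (hook p i).
Implicit Types (t u s : 'S_p) (c x y : 'I_p).

Definition corner : 'I_p := Ordinal (ltnW p_gt1).
Local Notation o := corner.

(* The cells outside the first row, and those outside the first column. *)
Definition leg : {set 'I_p} := [set c : 'I_p | (q <= c)%N].
Definition arm : {set 'I_p} := [set c : 'I_p | (0 < c < q)%N].
Definition column : {set 'I_p} := o |: leg.

Lemma reshape_hook (c : nat) : (c < p)%N ->
  reshape_index la c = (if c < q then 0 else (c - q).+1)%N /\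
  reshape_offset la c = (if c < q then c else 0)%N.
Proof.
move=> lt_c; case: ifPn => [lt_cq | ]; last rewrite -leqNgt => le_qc.
  have -> : c = flatten_index la 0 c by [].
  by rewrite flatten_indexKl // flatten_indexKr.
have def_c : c = flatten_index la (c - q).+1 0.
  rewrite /flatten_index /= take_nseq; last lia.
  by rewrite sumn_nseq; lia.
have lt0 : (0 < nth 0 la (c - q).+1)%N by rewrite /= nth_nseq; case: ifP; lia.
by rewrite {1 3}def_c flatten_indexKl // flatten_indexKr.
Qed.

(** All rows of a hook below the first are single cells, so a row stabilizer is the pointwise
    stabilizer of the leg entries. For columns the arm plays this role. *)
Lemma row_stabP t s :
  reflect (forall c, c \in leg -> s (t c) = t c) (s \in row_stab la t).
Proof.
rewrite inE; apply: (iffP forallP) => [Rs c | fix_s x].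
  rewrite inE => leg_c; have := Rs (t c); rewrite /row_of permK.
  rewrite !(proj1 (reshape_hook _)) // [(c < _)%N]ltnNge leg_c /=.
  case: ifP => // le_q /eqP[eq_c].
  have /val_inj def_c : val (t^-1%g (s (t c))) = val c.
    by move: le_q leg_c eq_c => /=; lia.
  by rewrite -[in RHS]def_c permKV.
have leg_s : (t^-1%g (s x) \in leg) = (t^-1%g x \in leg).
  apply/idP/idP => hx; have := fix_s _ hx; rewrite permKV; last by move->.
  by move/perm_inj=> sx; rewrite sx in hx.
rewrite /row_of !(proj1 (reshape_hook _)) //.
have [leg_x|] := boolP (t^-1%g x \in leg).
  by have := fix_s _ leg_x; rewrite permKV => ->.
by rewrite -leg_s => nleg_s; move: (nleg_s); rewrite leg_s;
   move: nleg_s; rewrite !inE -!ltnNge => -> ->.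
Qed.

Lemma col_stabP t s :
  reflect (forall c, c \in arm -> s (t c) = t c) (s \in col_stab la t).
Proof.
rewrite inE; apply: (iffP forallP) => [Cs c | fix_s x].
  rewrite inE => /andP[c0 cq]; have := Cs (t c); rewrite /col_of permK.
  rewrite !(proj2 (reshape_hook _)) // cq.
  case: ifP => [_ /eqP eq_c | _ /eqP c00]; last by rewrite -c00 in c0.
  by rewrite -[in RHS](val_inj eq_c) permKV.
have arm_s : (t^-1%g (s x) \in arm) = (t^-1%g x \in arm).
  apply/idP/idP => hx; have := fix_s _ hx; rewrite permKV; last by move->.
  by move/perm_inj=> sx; rewrite sx in hx.
rewrite /col_of !(proj2 (reshape_hook _)) //.
have [arm_x|] := boolP (t^-1%g x \in arm).
  by have := fix_s _ arm_x; rewrite permKV => ->.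
have offset0 c : c \notin arm -> (if (c < q)%N then val c else 0%N) = 0%N.
  by rewrite inE; case: (ltnP c q) => //= _; rewrite andbT lt0n negbK => /eqP.
by move=> narm; rewrite !offset0 ?arm_s.
Qed.

Lemma column_arm c : (c \in column) = (c \notin arm).
Proof.
rewrite !inE -(inj_eq val_inj) /= negb_and -leqNgt -leqn0 -leqNgt leqn0.
by [].
Qed.

Lemma col_stab_perm_on t s : (s \in col_stab la t) = perm_on (t @: column) s.
Proof.
apply/col_stabP/idP => [fix_s | on_s c arm_c].
  apply/subsetP=> x; rewrite inE => sx; apply/imsetP; exists (t^-1%g x).
    rewrite column_arm; apply: contra sx => /fix_s.
    by rewrite permKV => ->.
  by rewrite permKV.
apply: (out_perm on_s); apply/imsetP=> [[c' col_c' /perm_inj eq_c]].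
by rewrite -eq_c column_arm arm_c in col_c'.
Qed.

Lemma mem_tabloid t u :
  reflect (forall c, c \in leg -> u c = t c) (u \in tabloid la t).
Proof.
apply: (iffP imsetP) => [[s /row_stabP fix_s -> c /fix_s]|eq_tu].
  by rewrite permM.
exists (t^-1 * u)%g; last by rewrite mulKVg.
by apply/row_stabP=> c /eq_tu; rewrite permM permK.
Qed.

Lemma eq_tabloid t u :
  (forall c, c \in leg -> u c = t c) -> tabloid la u = tabloid la t.
Proof.
move=> eq_tu; apply/setP=> w; apply/mem_tabloid/mem_tabloid => eq_w c leg_c.
  by rewrite eq_w ?eq_tu.
by rewrite eq_w -?eq_tu.
Qed.

Lemma card_leg : #|leg| = i.
Proof.
have -> : leg = ~: [set widen_ord (leq_subr i p) c | c : 'I_q].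
  apply/setP=> c; rewrite !inE; apply/idP/negP => [le_qc /imsetP[c' _ def_c]|nc].
    by have := ltn_ord c'; move: le_qc; rewrite def_c /= leqNgt => /negP.
  rewrite leqNgt; apply/negP=> lt_cq; case: nc; apply/imsetP.
  by exists (Ordinal lt_cq) => //; apply: val_inj.
rewrite cardsCs setCK card_imset; last by move=> x y /(congr1 val) /= /val_inj.
by rewrite !card_ord; lia.
Qed.

Lemma corner_leg : o \notin leg.
Proof. by rewrite inE -ltnNge /=; lia. Qed.

Lemma card_column : #|column| = i.+1.
Proof. by rewrite cardsU1 corner_leg card_leg. Qed.

(* The combinatorial heart of James' submodule theorem. *)
Lemma tabloid_dichotomy t u :
  (exists2 s, s \in col_stab la t & tabloid la u = tabloid la (t * s)%g) \/
  (exists x, exists y, [/\ x != y, x \in t @: column, y \in t @: column,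
                         x \notin u @: leg & y \notin u @: leg]).
Proof.
set A := t @: column; set B := u @: leg.
have cA : #|A| = i.+1 by rewrite card_imset ?card_column //; apply: perm_inj.
have cB : #|B| = i by rewrite card_imset ?card_leg //; apply: perm_inj.
(* The question is whether the leg entries of [u] all lie in the first column of [t]. *)
have [sBA | nBA] := boolP (B \subset A); [left | right].
  have [z defAB] : exists z, A :\: B = [set z].
    by apply/cards1P; rewrite cardsD (setIidPr sBA) cA cB subSnn.
  have zAB : z \in A :\: B by rewrite defAB set11.
  have [zB zA] : z \notin B /\ z \in A by move: zAB; rewrite inE => /andP[].
  (* The tableau with the leg of [u], the arm of [t], and in the corner the one entry [z] left over;
     it differs from [t] by a column permutation. *)
  pose w c := if c \in leg then u c else if c \in arm then t c else z.
  have wB c : (w c \in B) = (c \in leg).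
    rewrite /w; case: ifP => [leg_c|_]; first by rewrite imset_f.
    case: ifP => [arm_c|_]; last exact/negbTE.
    apply/negbTE; apply: contraL (arm_c) => /(subsetP sBA)/imsetP[c' col_c'].
    by move=> /perm_inj->; rewrite -column_arm.
  have wA c : (w c \in A) = (c \notin arm).
    have [leg_c | nleg_c] := boolP (c \in leg).
      by rewrite -column_arm inE leg_c orbT (subsetP sBA) // wB.
    rewrite /w (negPf nleg_c); case: ifP => // arm_c; apply/negbTE.
    by rewrite (mem_imset _ _ perm_inj) column_arm arm_c.
  have winj : injective w.
    move=> c c' eq_w.
    have eq_leg : (c \in leg) = (c' \in leg) by rewrite -!wB eq_w.
    have eq_arm : (c \in arm) = (c' \in arm) by apply: negb_inj; rewrite -!wA eq_w.
    move: eq_w; rewrite /w -eq_leg -eq_arm.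
    case: ifP => [_ /perm_inj // | nleg]; case: ifP => [_ /perm_inj // | narm _].
    have col_o x : x \notin leg -> x \notin arm -> x = o.
      by move=> nl; rewrite -column_arm !inE => /orP[/eqP-> //|lx]; rewrite inE lx in nl.
    by rewrite [c]col_o ?nleg ?narm // [c']col_o // -?eq_leg -?eq_arm ?nleg ?narm.
  exists (t^-1 * perm winj)%g; last first.
    by apply: eq_tabloid => c leg_c; rewrite mulKVg permE /w leg_c.
  apply/col_stabP=> c arm_c; rewrite permM permK permE /w arm_c ifF //.
  by apply: contraTF arm_c => leg_c; rewrite -column_arm inE leg_c orbT.
(* Otherwise fewer than [i] of the [i + 1] column entries of [t] lie in the leg of [u], so at least
   two lie in its first row. *)
have gt1 : (1 < #|A :\: B|)%N.
  have ltI : (#|A :&: B| < i)%N.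
    rewrite -cB; apply: proper_card; rewrite properEneq subsetIr andbT.
    by apply: contra nBA => /eqP <-; apply: subsetIl.
  by rewrite cardsD cA; lia.
have [x xAB] : exists x, x \in A :\: B by apply/card_gt0P; apply: ltnW.
have [y] : exists y, y \in (A :\: B) :\ x.
  by apply/card_gt0P; move: gt1; rewrite (cardsD1 x) xAB.
rewrite !inE => /and3P[nyx yB yA]; move: xAB; rewrite inE => /andP[xB xA].
by exists x, y; rewrite eq_sym; split.
Qed.

End HookTableaux.

(** Induction on [#|B :\: A|], which drops when a point of [B :\: A] is exchanged with one of
    [A :\: B]. *)
Lemma perm_of_card n (A B : {set 'I_n}) : #|A| = #|B| -> exists t : 'S_n, t @: A = B.
Proof.
move=> eqAB.
have [m] := ubnP #|B :\: A|; elim: m B eqAB => // m IHm B eqAB; rewrite ltnS => leBA.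
have [BA0 | [y]] := set_0Vmem (B :\: A).
  exists 1%g; rewrite imset_fix => [|x _]; last by rewrite perm1.
  by apply/esym/eqP; rewrite eqEcard eqAB leqnn andbT -setD_eq0 BA0.
rewrite inE => /andP[yA yB].
have [x] : exists x, x \in A :\: B.
  apply/card_gt0P; rewrite cardsD eqAB setIC -cardsD.
  by apply/card_gt0P; exists y; rewrite inE yA.
rewrite inE => /andP[xB xA].
have [||t defB] := IHm (tperm x y @: B).
- by rewrite card_imset ?eqAB //; apply: perm_inj.
- apply: leq_trans leBA; apply: proper_card; apply/properP; split.
    apply/subsetP=> z; rewrite !inE => /andP[zA /imsetP[w wB def_z]].
    move: zA; rewrite {z}def_z; case: tpermP => [_|_|_ _] zA; rewrite ?zA //.
    by rewrite xA in zA.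
  exists y; first by rewrite inE yA.
  rewrite inE yA /=; apply/imsetP=> [[w wB]].
  case: tpermP => [wx|_ yx|_ wy yw]; first by rewrite -wx wB in xB.
    by rewrite yx xA in yA.
  by rewrite yw in wy.
exists (t * tperm x y)%g.
have -> : (t * tperm x y)%g @: A = tperm x y @: (t @: A).
  by rewrite -imset_comp; apply: eq_imset => z; rewrite permM.
rewrite defB -imset_comp -[RHS]imset_id; apply: eq_imset => z /=.
by rewrite tpermK.
Qed.

Lemma fact_neq0 (F : fieldType) p m : p \in [pchar F] -> (m < p)%N -> m`!%:R != 0 :> F.
Proof.
move=> charF; elim: m => [|m IHm] lt_m; first by rewrite oner_eq0.
rewrite factS natrM mulf_neq0 ?IHm ?(ltnW lt_m) // -(dvdn_pcharf charF).
by apply/negP=> /dvdn_leq; lia.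
Qed.

(** * The image of the hook Specht module in the exterior algebra *)

Section HookSpecht.

Variables (F : fieldType) (p i : nat).
Hypotheses (charF : p \in [pchar F]) (p_gt1 : (1 < p)%N) (le_i : (i <= p - 2)%N).

Local Notation d := #|{set 'I_p}|.
Local Notation la := (hook p i).
Local Notation leg := (leg p i).
Local Notation column := (column i p_gt1).
Local Notation o := (corner p_gt1).
Local Notation c x := (cre F x).
Local Notation a x := (ann F x).
Local Notation e := (@cre_sum F p).
Local Notation iota := (@ann_sum F p).
Local Notation num := (@num_op F p).
Local Notation r := (i.+1).
Local Notation fvec := (fock_vec F).
Local Notation act g := (fock_mx F g).
Implicit Types (t u s g : 'S_p) (x y : 'I_p).

Definition leg_vec t : 'rV[F]_d := fvec leg *m act t.
Definition column_vec t : 'rV[F]_d := leg_vec t *m c (t o).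

Lemma act_mx_mul g s : act (g * s)%g = act g *m act s.
Proof. exact: (repr_mxM (fock F p) (in_setT g) (in_setT s)). Qed.

Lemma leg_vecM t s : leg_vec (t * s)%g = leg_vec t *m act s.
Proof. by rewrite /leg_vec act_mx_mul mulmxA. Qed.

Lemma leg_vec_eq t u : (forall x, x \in leg -> u x = t x) -> leg_vec u = leg_vec t.
Proof.
move=> eq_tu; rewrite -[u](mulgKV t) /leg_vec act_mx_mul mulmxA fock_fix //.
by move=> x /eq_tu; rewrite permM => ->; rewrite permK.
Qed.

Lemma leg_vecE t : leg_vec t = act_sign F t leg *: fvec (t @: leg).
Proof. exact: fock_vec_mx. Qed.

Lemma column_vecE t : column_vec t = act_sign F t column *: fvec (t @: column).
Proof.
rewrite -fock_vec_mx /column_vec /leg_vec -mulmxA -fock_cre mulmxA fock_vec_cre.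
rewrite (negPf (corner_leg p_gt1 le_i)) [set_sign _ _ _]big1 ?scale1r //.
Qed.

Lemma act_sign_neq0 t A : act_sign F t A != 0.
Proof.
apply/prodf_neq0 => x _; apply/prodf_neq0 => y _.
by rewrite /inv_sign mulf_neq0 // signr_eq0.
Qed.

(** A tabloid goes to the wedge of its leg entries, from the tabloid module to the [i]-th exterior
    power. Any representative serves, because only the leg entries enter [leg_vec]. *)
Definition tabloid_to_fock : 'M[F]_(#|tabloids p la|, d) :=
  \matrix_j leg_vec (repr (enum_val j : {set 'S_p})).
Local Notation tau := tabloid_to_fock.
Local Notation eta := (tau *m e).

Lemma tabloid_vec_enum j :
  tabloid_vec F la (enum_val j) = delta_mx 0 j :> 'rV_#|tabloids p la|.
Proof. by apply/rowP=> k; rewrite !mxE eqxx (inj_eq enum_val_inj) eq_sym. Qed.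

Lemma enum_tabloid (j : 'I_#|tabloids p la|) : exists t, enum_val j = tabloid la t.
Proof. by have /imsetP[t _ ->] := enum_valP j; exists t. Qed.

Lemma tabloid_vec_tau t : tabloid_vec F la (tabloid la t) *m tau = leg_vec t.
Proof.
have tA : tabloid la t \in tabloids p la by apply: imset_f.
pose j := enum_rank_in tA (tabloid la t).
have ej : enum_val j = tabloid la t by rewrite enum_rankK_in.
rewrite -ej tabloid_vec_enum -rowE rowK ej; apply: leg_vec_eq.
apply/(mem_tabloid p_gt1 le_i)/(mem_repr t).
by apply/(mem_tabloid p_gt1 le_i).
Qed.

Lemma row_tau j : row j tau = tabloid_vec F la (enum_val j) *m tau.
Proof. by rewrite tabloid_vec_enum -rowE. Qed.

Lemma tabloid_mx_tau g : tabloid_mx F la g *m tau = tau *m act g.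
Proof.
apply/row_matrixP=> j; rewrite row_mul row_tabloid_mx [RHS]row_mul row_tau.
have [t ->] := enum_tabloid j.
by rewrite tabloidM !tabloid_vec_tau leg_vecM.
Qed.

Lemma tabloid_mx_eta g : tabloid_mx F la g *m eta = eta *m act g.
Proof. by rewrite mulmxA tabloid_mx_tau -!mulmxA fock_cre_sum. Qed.

Lemma leg_vec_num t : leg_vec t *m num = i%:R *: leg_vec t.
Proof.
by rewrite leg_vecE -scalemxAl fock_vec_num card_imset ?card_leg //;
   [rewrite !scalerA mulrC | apply: perm_inj].
Qed.

Lemma eta_num : eta *m num = r%:R *: eta.
Proof.
have tau_num : tau *m num = i%:R *: tau.
  apply/row_matrixP=> j; rewrite row_mul linearZ /= row_tau.
  by have [t ->] := enum_tabloid j; rewrite tabloid_vec_tau leg_vec_num.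
have e_num : e *m num = num *m e + e.
  rewrite /cre_sum mulmx_suml [X in _ = X + _]mulmx_sumr -big_split.
  by apply: eq_bigr => x _; apply: num_cre.
rewrite -mulmxA e_num mulmxDr mulmxA tau_num -scalemxAl.
by rewrite -natr1 scalerDl scale1r.
Qed.

Definition column_antisym t : 'M[F]_d :=
  \sum_(s in col_stab la t) (-1) ^+ s *: act s.
Local Notation K := column_antisym.

Lemma polytabloid_tau t : polytabloid F la t *m tau = leg_vec t *m K t.
Proof.
rewrite mulmx_suml mulmx_sumr; apply: eq_bigr => s _.
by rewrite -scalemxAl -scalemxAr tabloidM tabloid_vec_tau leg_vecM.
Qed.

Lemma K_iota t : iota *m K t = K t *m iota.
Proof.
rewrite mulmx_sumr mulmx_suml; apply: eq_bigr => s _.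
by rewrite -scalemxAr -scalemxAl fock_ann_sum.
Qed.

Lemma col_stabM t s0 : s0 \in col_stab la t ->
  forall s, ((s0 * s)%g \in col_stab la t) = (s \in col_stab la t).
Proof.
rewrite (col_stab_perm_on p_gt1 le_i) => on0 s; rewrite !(col_stab_perm_on p_gt1 le_i).
apply/idP/idP => on_s; last exact: perm_onM.
by rewrite -(mulKg s0 s) perm_onM // perm_onV.
Qed.

Lemma column_vec_K t : column_vec t *m K t = #|col_stab la t|%:R *: column_vec t.
Proof.
rewrite mulmx_sumr (eq_bigr (fun=> column_vec t)) => [|s].
  by rewrite sumr_const scaler_nat.
rewrite (col_stab_perm_on p_gt1 le_i) => on_s.
rewrite -scalemxAr column_vecE -scalemxAl fock_perm_on // !scalerA.
by rewrite mulrAC -expr2 sqrr_sign mul1r.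
Qed.

Lemma act_K t s : s \in col_stab la t -> act s *m K t = (-1) ^+ s *: K t.
Proof.
move=> Cs; rewrite mulmx_sumr scaler_sumr.
rewrite [RHS](reindex_inj (mulgI s)) /=; apply: eq_big => [s'|s' _].
  by rewrite col_stabM.
rewrite -scalemxAr -act_mx_mul scalerA; congr (_ *: _).
by rewrite odd_permM signr_addb mulrA -expr2 sqrr_sign mul1r.
Qed.

(** Each of the [i] nonzero terms replaces a leg entry by the corner entry. This is a transposition
    in the column group, which [K t] absorbs with sign -1. *)
Lemma leg_vec_swap_K t :
  leg_vec t *m iota *m c (t o) *m K t = - (i%:R *: (leg_vec t *m K t)).
Proof.
have o_leg : t o \notin t @: leg.
  by rewrite (mem_imset _ _ perm_inj) (corner_leg p_gt1 le_i).
have -> : leg_vec t *m iota = \sum_y leg_vec t *m a y by apply: mulmx_sumr.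
rewrite !mulmx_suml (bigID (mem (t @: leg))) /= [X in _ + X]big1 => [|y nleg].
  rewrite addr0 (eq_bigr (fun=> - (leg_vec t *m K t))) => [|y leg_y].
    rewrite sumr_const card_imset ?(card_leg p_gt1 le_i); last exact: perm_inj.
    by rewrite mulNrn scaler_nat.
  rewrite leg_vecE -!scalemxAl fock_swap // -mulmxA act_K; last first.
    rewrite (col_stab_perm_on p_gt1 le_i).
    have ycol : y \in t @: column.
      case/imsetP: leg_y => x leg_x ->; apply: imset_f.
      by rewrite !inE in leg_x *; rewrite leg_x orbT.
    have ocol : t o \in t @: column by apply: imset_f; rewrite !inE eqxx.
    by apply/subsetP=> x; rewrite inE; case: tpermP => [->|->|]; rewrite ?eqxx.
  have ne_oy : t o != y by apply: contraNneq o_leg => ->.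
  by rewrite odd_tperm ne_oy expr1 scaleN1r mulmxN scalerN.
by rewrite leg_vecE -!scalemxAl fock_vec_ann (negPf nleg) !mul0mx scaler0.
Qed.

(** [column_vec t iota K] is evaluated twice: [K] commutes with [iota] and scales the column wedge
    by the order of the column group; expanding [iota] first gives [1 + i] copies of
    [leg_vec t K]. *)
Lemma polytabloid_eta t :
  r%:R *: (polytabloid F la t *m eta)
  = #|col_stab la t|%:R *: (column_vec t *m iota *m e).
Proof.
have VK : column_vec t *m iota *m K t = r%:R *: (leg_vec t *m K t).
  rewrite mul_cre_iota mulmxBl leg_vec_swap_K opprK -natr1 scalerDl scale1r.
  by rewrite addrC.
rewrite mulmxA polytabloid_tau scalemxAl -VK -(mulmxA _ iota (K t)) K_iota mulmxA column_vec_K.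
by rewrite -!scalemxAl.
Qed.

Lemma col_stab_neq0 t : #|col_stab la t|%:R != 0 :> F.
Proof.
have -> : col_stab la t = [set s | perm_on (t @: column) s].
  by apply/setP=> s; rewrite [RHS]inE (col_stab_perm_on p_gt1 le_i).
rewrite cardsE card_perm card_imset; last exact: perm_inj.
rewrite (card_column p_gt1 le_i); apply: fact_neq0 charF _; lia.
Qed.

Lemma r_neq0 : r%:R != 0 :> F.
Proof. by rewrite -(dvdn_pcharf charF); apply/negP=> /dvdn_leq; lia. Qed.

Lemma polytabloid_eta_eqmx t :
  (polytabloid F la t *m eta :=: column_vec t *m iota *m e)%MS.
Proof.
apply: eqmx_trans (eqmx_scale _ (col_stab_neq0 t)).
rewrite -polytabloid_eta; exact/eqmx_sym/eqmx_scale/r_neq0.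
Qed.

Lemma column_vec_num t : column_vec t *m num = r%:R *: column_vec t.
Proof.
rewrite column_vecE -scalemxAl fock_vec_num card_imset; last exact: perm_inj.
by rewrite (card_column p_gt1 le_i) !scalerA mulrC.
Qed.

Lemma iota_e_num : iota *m e *m num = num *m iota *m e.
Proof.
have i_num : iota *m num = num *m iota - iota.
  rewrite /ann_sum mulmx_suml [X in _ = X - _]mulmx_sumr -sumrB.
  by apply: eq_bigr => x _; apply: num_ann.
by rewrite mul_e_num i_num mulmxBl subrK.
Qed.

Lemma iota_e_iota : iota *m e *m iota = 0.
Proof.
rewrite -mulmxA cre_sum_ann_sum pcharf0 // raddf0 sub0r mulmxN mulmxA ann_sum2.
by rewrite mul0mx oppr0.
Qed.

Lemma column_vec_harmonic t : (column_vec t *m iota *m e <= harmonic F p r)%MS.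
Proof.
apply/harmonicP; split.
- by rewrite -(mulmxA _ e) cre_sum2 mulmx0.
- transitivity (column_vec t *m (iota *m e *m iota)); first by rewrite !mulmxA.
  by rewrite iota_e_iota mulmx0.
transitivity (column_vec t *m (iota *m e *m num)); first by rewrite !mulmxA.
by rewrite iota_e_num !mulmxA column_vec_num -!scalemxAl.
Qed.

(** An explicit preimage, of the same degree, of a harmonic vector under [iota e]. *)
Lemma harmonic_iota_e m (v : 'M_(m, d)) : (v <= harmonic F p r)%MS ->
  v = v *m a o *m c o *m iota *m e.
Proof.
case/harmonicP=> ve vi _; rewrite mul_cre_iota mul_ann_iota vi mul0mx oppr0 mul0mx.
by rewrite subr0 mul_ann_e ve mul0mx subr0.
Qed.

Lemma vec_support (v : 'rV[F]_d) b :
  v *m num = r%:R *: v -> v 0 b != 0 -> #|(enum_val b : {set 'I_p})| = r.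
Proof.
move=> vn vb; apply: (card_mod_eq charF); first lia.
have /rowP/(_ b) := vn.
rewrite mxE (bigD1 b) //= big1 ?addr0 => [|b' neb]; last first.
  have -> : num b' b = (fvec (enum_val b') *m num) 0 b.
    by rewrite fock_vecE mxE enum_valK.
  by rewrite fock_vec_num !mxE enum_valK eq_sym (negPf neb) andbF !mulr0.
have -> : num b b = #|(enum_val b : {set 'I_p})|%:R.
  have := fock_vec_num F (enum_val b); rewrite fock_vecE => /rowP/(_ b).
  by rewrite !mxE enum_valK !eqxx mulr1.
by rewrite mxE mulrC => /(mulIf vb).
Qed.

(** Polytabloids go to nonzero multiples of [column_vec t iota e], while the column wedges span
    degree [r] and [iota e] maps that degree onto the harmonic vectors. *)
Lemma specht_eta : (specht_mx F p la *m eta :=: harmonic F p r)%MS.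
Proof.
apply/eqmxP/andP; split.
  rewrite sumsmxMr_gen; apply/sumsmx_subP=> t _.
  by rewrite genmxE (eqmxMr _ (genmxE _)) polytabloid_eta_eqmx column_vec_harmonic.
apply/row_subP=> j; set v := row j _.
have v_harm : (v <= harmonic F p r)%MS by apply: row_sub.
(* [w] is expanded in basis wedges; each one that occurs has [r] factors and so is a scalar multiple
   of some column wedge. *)
rewrite (harmonic_iota_e v_harm); set w := v *m a o *m c o.
have wn : w *m num = r%:R *: w.
  have /harmonicP[_ _ vn] := v_harm.
  by rewrite /w mul_cre_num mul_ann_num mulmxBl vn -!scalemxAl subrK.
rewrite [w]row_sum_delta !mulmx_suml; apply: summx_sub => b _.
have [-> | wb] := eqVneq (w 0 b) 0; first by rewrite scale0r !mul0mx sub0mx.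
have [|t def_t] := @perm_of_card _ column (enum_val b).
  by rewrite (card_column p_gt1 le_i) (vec_support wn wb).
rewrite -!scalemxAl scalemx_sub //.
have -> : delta_mx 0 b = (act_sign F t column)^-1 *: column_vec t :> 'rV_d.
  rewrite column_vecE def_t scalerA mulVf ?act_sign_neq0 // scale1r /fock_vec.
  by rewrite enum_valK.
rewrite -!scalemxAl scalemx_sub // -polytabloid_eta_eqmx submxMr //.
by rewrite (sumsmx_sup t) // genmxE.
Qed.

End HookSpecht.

(** * Modules with a unique maximal submodule *)

Section UniqueMaximal.

Variables (F : fieldType) (gT : finGroupType) (G : {group gT}).
Variables (M D : representation F G) (h : 'M[F]_(rdegree M, rdegree D)).
Hypotheses (hom_h : mx_hom h) (full_h : row_full h) (D_neq0 : rdegree D <> 0%N).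
Hypothesis gen : forall U : 'M_(rdegree M), mxmodule M U -> U *m h != 0 -> row_full U.

Lemma ker_hom_module : mxmodule M (kermx h).
Proof.
apply/mxmoduleP=> g Gg; apply/sub_kermxP.
by rewrite -mulmxA hom_h // mulmxA mulmx_ker mul0mx.
Qed.

Lemma ker_hom_proper : ~~ row_full (kermx h).
Proof.
apply/negP=> /row_fullP[B B1]; have [C C1] := row_fullP full_h.
have h0 : h = 0 by rewrite -[h]mul1mx -B1 -mulmxA mulmx_ker mulmx0.
by apply: D_neq0; rewrite -(mxrank1 F (rdegree D)) -C1 h0 mulmx0 mxrank0.
Qed.

(** By [gen] every proper submodule lies in the kernel of [h], which is therefore the only maximal
    submodule. *)
Lemma radical_ker : (radical M :=: kermx h)%MS.
Proof.
have radP : is_radical (radical M) := projT2 (cid (radical_exists M)).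
have max_ker : max_submod M (kermx h) 1%:M.
  split; first by rewrite ltmx1 ker_hom_proper.
  move=> W [modW /andP[_ nW]]; rewrite ltmx1 => /negP[]; apply: (gen modW).
  by apply: contra nW => /eqP /sub_kermxP.
apply/eqmxP/andP; split; apply/row_subP=> j.
  have /radP/(_ (kermx h) ker_hom_module max_ker) // := row_sub j (radical M).
apply/radP=> U modU [U1 maxU]; have U_ker : (U <= kermx h)%MS.
  apply/sub_kermxP/eqP; apply: contraTT U1 => Uh0.
  by rewrite ltmx1 negbK; apply: gen modU Uh0.
apply: contrapT => njU; case: (maxU (kermx h)); split; first exact: ker_hom_module.
  rewrite ltmxE U_ker; apply: contraT => /negPn kerU.
  by case: njU; apply: submx_trans (row_sub _ _) kerU.
by rewrite ltmx1 ker_hom_proper.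
Qed.

Lemma head_rsim : mx_rsim (Defs.head M) D.
Proof.
pose R := radical M.
have Rh : R *m h = 0 by apply/sub_kermxP; rewrite radical_ker.
pose f : 'M_(rdegree (Defs.head M), rdegree D) := val_factmod (1%:M : 'M_(\rank (cokermx R))) *m h.
have valE m (W : 'M_(m, _)) : val_factmod (U := R) W = W *m val_factmod 1%:M.
  by rewrite /val_factmod /= mul1mx.
have sub0 m (X : 'M_(m, _)) : val_submod (in_submod R X) *m h = 0.
  by apply/sub_kermxP; rewrite -radical_ker; apply: val_submodP.
have hf : mx_hom f.
  move=> g Gg; rewrite /= /f mulmxA -valE /factmod_mx.
  have := add_sub_fact_mod R (val_factmod (1%:M : 'M_(\rank (cokermx R))) *m M g).
  move/(congr1 (mulmx^~ h)); rewrite mulmxDl.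
  by rewrite sub0 add0r -mulmxA hom_h // mulmxA => ->.
have freef : row_free f.
  rewrite -kermx_eq0; apply/eqP/row_matrixP=> j; rewrite row0; set w := row j _.
  have : w *m f = 0 by rewrite -row_mul mulmx_ker row0.
  rewrite /f mulmxA -valE => /sub_kermxP; rewrite -radical_ker -in_factmod_eq0.
  by rewrite val_factmodK => /eqP.
have fullf : row_full f.
  rewrite -sub1mx; have [C C1] := row_fullP full_h.
  rewrite -C1 -[C](add_sub_fact_mod R) mulmxDl.
  by rewrite sub0 add0r valE -mulmxA submxMl.
exists f => //; exact: etrans (esym (eqP freef)) (eqP fullf).
Qed.

(** The kernel of [h f] is a submodule of [M]. If [h] kills it, then [f] is injective; otherwise
    [gen] makes it everything, and [f = 0]. *)
Lemma unique_max_division_end : division_end D.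
Proof.
move=> f hf; have [fh0 | fh] := eqVneq f 0; [by left | right].
rewrite -row_free_unit -kermx_eq0; apply/eqP/row_matrixP=> j; rewrite row0.
have hhf : mx_hom (M := M) (N := D) (h *m f) := mx_hom_mul hom_h hf.
have modU : mxmodule M (kermx (h *m f)).
  apply/mxmoduleP=> g Gg; apply/sub_kermxP.
  by rewrite -mulmxA hhf // mulmxA mulmx_ker mul0mx.
set w := row j _.
have wf : w *m f = 0 by rewrite -row_mul mulmx_ker row0.
have [C C1] := row_fullP full_h.
have wU : (w *m C <= kermx (h *m f))%MS.
  by apply/sub_kermxP; rewrite -!mulmxA (mulmxA C) C1 mul1mx.
have [Uh0 | /(gen modU) /row_fullP[B B1]] := eqVneq (kermx (h *m f) *m h) 0.
  have [X defX] := submxP wU.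
  by rewrite -[w]mulmx1 -C1 mulmxA defX -mulmxA Uh0 mulmx0.
have hf0 : h *m f = 0 by rewrite -[h *m f]mul1mx -B1 -mulmxA mulmx_ker mulmx0.
by case/eqP: fh; rewrite -[f]mul1mx -C1 -mulmxA hf0 mulmx0.
Qed.

End UniqueMaximal.

(** Each even [s] is paired with the odd [tau * s], so no division by 2 takes place. *)
Lemma sum_parity_cancel (V : zmodType) n (A : {set 'S_n}) (f : 'S_n -> V) (tau : 'S_n) :
    odd_perm tau ->
    (forall s, ((tau * s)%g \in A) = (s \in A)) ->
    (forall s, f (tau * s)%g = - f s) ->
  \sum_(s in A) f s = 0.
Proof.
move=> odd_tau Atau ftau; rewrite (bigID (@odd_perm _)) /=.
rewrite [X in X + _](reindex_inj (mulgI tau)) /=.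
rewrite [X in X + _](eq_bigl (fun s => (s \in A) && ~~ odd_perm s)) => [|s]; last first.
  by rewrite Atau odd_permM odd_tau addTb.
by rewrite -big_split big1 // => s _ /=; rewrite ftau addNr.
Qed.

(** * James' submodule argument for hooks *)

Section JamesSubmodule.

Variables (F : fieldType) (p i : nat).
Hypotheses (charF : p \in [pchar F]) (p_gt1 : (1 < p)%N) (le_i : (i <= p - 2)%N).

Local Notation d := #|{set 'I_p}|.
Local Notation la := (hook p i).
Local Notation leg := (leg p i).
Local Notation column := (column i p_gt1).
Local Notation o := (corner p_gt1).
Local Notation e := (@cre_sum F p).
Local Notation r := (i.+1).
Local Notation fvec := (fock_vec F).
Local Notation act g := (fock_mx F g).
Local Notation tau := (tabloid_to_fock F p i).
Local Notation eta := (tau *m e).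
Local Notation leg_vec := (leg_vec F i).
Implicit Types (t u s g : 'S_p) (x y : 'I_p).

Definition tabloid_antisym t : 'M[F]_#|tabloids p la| :=
  \sum_(s in col_stab la t) (-1) ^+ s *: tabloid_mx F la s.
Local Notation kappa := tabloid_antisym.
Local Notation colpos t := (enum_rank (t @: column)).

Lemma tabloid_vec_kappa u t : tabloid_vec F la (tabloid la u) *m kappa t
  = \sum_(s in col_stab la t) (-1) ^+ s *: tabloid_vec F la (tabloid la (u * s)%g).
Proof.
rewrite mulmx_sumr; apply: eq_bigr => s _.
by rewrite -scalemxAr tabloid_vec_mx ?imset_f // tabloidM.
Qed.

Lemma polytabloid_kappa t :
  polytabloid F la t = tabloid_vec F la (tabloid la t) *m kappa t.
Proof.
by rewrite tabloid_vec_kappa; apply: eq_bigr => s _; rewrite tabloidM.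
Qed.

Lemma leg_vec_coord0 u (C : {set 'I_p}) :
    (forall x, x \notin u @: leg -> C <> x |: u @: leg) ->
  (leg_vec u *m e) 0 (enum_rank C) = 0.
Proof.
move=> neC; rewrite mulmx_sumr summxE big1 // => x _.
rewrite leg_vecE -scalemxAl mxE fock_vec_cre; case: ifPn => [_|xu].
  by rewrite mxE mulr0.
rewrite !mxE eqxx /= (inj_eq enum_rank_inj).
by case: eqP => [/(neC x xu) | _]; rewrite ?mulr0.
Qed.

Lemma leg_vec_coord_neq0 t : (leg_vec t *m e) 0 (colpos t) != 0.
Proof.
rewrite mulmx_sumr summxE (bigD1 (t o)) //= big1 ?addr0 => [|x ne_x].
  rewrite -/(column_vec F i p_gt1 t) column_vecE // mxE mxE !eqxx mulr1.
  exact: act_sign_neq0.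
rewrite leg_vecE -scalemxAl mxE fock_vec_cre; case: ifPn => [_|xu].
  by rewrite mxE mulr0.
rewrite !mxE eqxx /= (inj_eq enum_rank_inj) imset_permU.
case: eqP => [eq_x|]; rewrite ?mulr0 //; case/negP: xu.
have : x \in t o |: t @: leg by rewrite eq_x setU11.
by rewrite in_setU1 (negPf ne_x).
Qed.

(** Classically the left side is [0] or, up to sign, the polytabloid of [t]. Here the scalar is read
    off from [eta], as the coordinate at the column of [t] relative to its value for [t] itself. *)
Lemma james_tabloid u t :
  tabloid_vec F la (tabloid la u) *m kappa t
  = ((tabloid_vec F la (tabloid la u) *m eta) 0 (colpos t)
     / (leg_vec t *m e) 0 (colpos t)) *: polytabloid F la t.
Proof.
rewrite mulmxA tabloid_vec_tau //.
have [[s Cs eq_us] | [x [y [ne_xy xt yt xu yu]]]] := tabloid_dichotomy p_gt1 le_i t u.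
  have on_s : perm_on (t @: column) s by rewrite -col_stab_perm_on.
  have -> : leg_vec u = leg_vec t *m act s.
    by rewrite -(tabloid_vec_tau F p_gt1 le_i) eq_us tabloid_vec_tau // leg_vecM.
  rewrite -mulmxA -fock_cre_sum mulmxA fock_coord_perm_on // mulfK ?leg_vec_coord_neq0 //.
  rewrite eq_us polytabloid_kappa !tabloid_vec_kappa scaler_sumr.
  rewrite [RHS](reindex_inj (mulgI s)) /=; apply: eq_big => [s'|s' _].
    by rewrite (col_stabM p_gt1 le_i Cs).
  by rewrite odd_permM signr_addb scalerA mulrA -expr2 sqrr_sign mul1r mulgA.
rewrite leg_vec_coord0 ?mul0r ?scale0r => [|z zu eq_z]; last first.
  have : x \in z |: u @: leg by rewrite -eq_z.
  rewrite in_setU1 (negPf xu) orbF => /eqP xz.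
  have : y \in z |: u @: leg by rewrite -eq_z.
  rewrite in_setU1 (negPf yu) orbF => /eqP yz.
  by rewrite xz yz eqxx in ne_xy.
have Cxy : tperm x y \in col_stab la t.
  rewrite (col_stab_perm_on p_gt1 le_i).
  by apply/subsetP=> z; rewrite inE; case: tpermP => [->|->|]; rewrite ?eqxx.
rewrite tabloid_vec_kappa; apply: (@sum_parity_cancel _ _ _ _ (tperm x y)).
- by rewrite odd_tperm.
- exact: (col_stabM p_gt1 le_i Cxy).
move=> s; rewrite odd_permM odd_tperm ne_xy signr_addb mulN1r scaleNr mulgA.
congr (- (_ *: tabloid_vec _ _ _)); apply: (eq_tabloid p_gt1 le_i) => z leg_z.
rewrite !permM tpermD //; first by apply: contraNneq xu => ->; rewrite imset_f.
by apply: contraNneq yu => ->; rewrite imset_f.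
Qed.

Lemma james (v : 'rV[F]_#|tabloids p la|) t :
  v *m kappa t
  = ((v *m eta) 0 (colpos t) / (leg_vec t *m e) 0 (colpos t)) *: polytabloid F la t.
Proof.
rewrite {1}[v]row_sum_delta mulmx_suml.
rewrite [X in (X *m eta)]row_sum_delta mulmx_suml summxE mulr_suml scaler_suml.
apply: eq_bigr => j _; rewrite -tabloid_vec_enum; have [t' ->] := enum_tabloid j.
by rewrite -!scalemxAl james_tabloid [X in _ = (X / _) *: _]mxE -mulrA scalerA.
Qed.

(** The map [eta] replaces the bilinear form of James' theorem: a nonzero coordinate of [v eta]
    makes [v *m kappa t] a nonzero multiple of a polytabloid, and one polytabloid generates the
    Specht module. *)
Lemma specht_generated m (U : 'M[F]_(m, _)) (v : 'rV_#|tabloids p la|) :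
    mxmodule (tabloid_repr F p la) U -> (v <= U)%MS -> v *m eta != 0 ->
  (specht_mx F p la <= U)%MS.
Proof.
move=> modU vU v_neq0.
have /existsP[b vb] : [exists b, (v *m eta) 0 b != 0].
  apply: contraNT v_neq0; rewrite negb_exists => /forallP v0; apply/eqP/rowP=> b.
  by rewrite [RHS]mxE; apply/eqP/negbNE.
have vn : v *m eta *m (@num_op F p) = r%:R *: (v *m eta).
  by rewrite -mulmxA eta_num // -scalemxAr.
(* The coordinate [b] sits at a set of [r] points, which is the first column of some tableau. *)
have [|t def_t] := @perm_of_card _ column (enum_val b).
  by rewrite (card_column p_gt1 le_i) (vec_support charF p_gt1 le_i vn vb).
have tU : (polytabloid F la t <= U)%MS.
  have := james v t; rewrite def_t enum_valK.
  set x := _ / _ => vK.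
  have x0 : x != 0.
    rewrite /x mulf_neq0 // invr_neq0 //; have := leg_vec_coord_neq0 t.
    by rewrite def_t enum_valK.
  have -> : polytabloid F la t = x^-1 *: (v *m kappa t).
    by rewrite vK scalerA mulVf // scale1r.
  rewrite scalemx_sub // mulmx_sumr; apply: summx_sub => s _.
  rewrite -scalemxAr scalemx_sub //.
  exact: (mxmodule_trans modU (in_setT s) vU).
apply/sumsmx_subP=> u _; rewrite genmxE -(mulKVg t u) -polytabloidM.
exact: (mxmodule_trans modU (in_setT _) tU).
Qed.

End JamesSubmodule.

(** * Identification of the hook simple modules, and the degenerate degrees *)

Section HookSimple.

Variables (F : fieldType) (p : nat).
Hypothesis charF : p \in [pchar F].

Local Notation d := #|{set 'I_p}|.
Local Notation e := (@cre_sum F p).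
Local Notation iota := (@ann_sum F p).
Local Notation num := (@num_op F p).
Local Notation vac := (fock_vec F (set0 : {set 'I_p})).
Local Notation D r := (harmonic_rep F p r).

Let p_gt1 : (1 < p)%N := prime_gt1 (pcharf_prime charF).

Lemma fock_vec_iota_e_coord (C : {set 'I_p}) :
  (fock_vec F C *m iota *m e) 0 (enum_rank C) = #|C|%:R.
Proof.
rewrite -sum1_card natr_sum; have -> : fock_vec F C *m iota = \sum_x fock_vec F C *m ann F x.
  exact: mulmx_sumr.
rewrite mulmx_suml summxE [RHS]big_mkcond; apply: eq_bigr => x _ /=.
rewrite fock_vec_ann; case: ifP => [xC|_]; last by rewrite mul0mx mxE.
rewrite mulmx_sumr summxE (bigD1 x) //= big1 => [|y ne_y].
  rewrite addr0 -scalemxAl fock_vec_cre setD11 scalerA set_sign2 setD1K // scale1r.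
  by rewrite mxE !eqxx.
rewrite -scalemxAl mxE fock_vec_cre; case: ifP => _; first by rewrite mxE mulr0.
rewrite !mxE eqxx /= (inj_eq enum_rank_inj); case: eqP => [eqC|_]; rewrite ?mulr0 //.
by move: xC; rewrite eqC in_setU1 setD11 orbF eq_sym (negPf ne_y).
Qed.

(** The harmonic vector [column_vec iota e] has, up to sign, coordinate [i + 1] at its own column,
    and this is nonzero in [F]. *)
Lemma harmonic_neq0 i : (i <= p - 2)%N -> rdegree (D i.+1) <> 0%N.
Proof.
move=> le_i /eqP; rewrite /= mxrank_eq0 => /eqP harm0.
have := column_vec_harmonic charF p_gt1 le_i 1%g.
rewrite harm0 submx0 column_vecE // -!scalemxAl scaler_eq0.
rewrite (negPf (act_sign_neq0 _ _ _)) /= => /eqP/rowP/(_ (enum_rank ((1%g : 'S_p) @: column i p_gt1))).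
rewrite fock_vec_iota_e_coord card_imset; last exact: perm_inj.
rewrite (card_column p_gt1 le_i) mxE => /eqP.
by apply/negP; apply: r_neq0 charF p_gt1 le_i.
Qed.

Lemma hook_simple_harmonic i : (i <= p - 2)%N ->
  mx_rsim (hook_simple F p i) (D i.+1) /\ division_end (D i.+1).
Proof.
move=> le_i; set r := i.+1.
pose eta : 'M_(_, d) := tabloid_to_fock F p i *m e.
pose S := specht F p (hook p i).
pose v : 'M_(rdegree S, _) := val_submod (1%:M : 'M_(\rank (specht_mx F p (hook p i)))).
have v_specht : (v :=: specht_mx F p (hook p i))%MS by apply: val_submod1.
pose h : 'M_(rdegree S, rdegree (D r)) := v *m eta *m out F p r.
have veta : (v *m eta :=: harmonic F p r)%MS.
  exact: eqmx_trans (eqmxMr eta v_specht) (specht_eta charF p_gt1 le_i).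
have hom_v g : S g *m v = v *m tabloid_mx F (hook p i) g.
  by rewrite /v -val_submodE -[S g]mul1mx val_submodJ ?inE.
have hom_h : mx_hom h.
  move=> g _; have vW : (v *m eta <= harmonic F p r)%MS by rewrite veta.
  rewrite [RHS](outJ _ vW) -(mulmxA v eta) -(tabloid_mx_eta F p_gt1 le_i).
  by rewrite (mulmxA v) -(hom_v g) -(mulmxA (S g)) -(mulmxA (S g)).
have full_h : row_full h.
  rewrite -sub1mx -(incK F p r); apply: submxMr.
  by rewrite veta; apply: inc_harmonic.
(* [U] is viewed inside the tabloid module, where [specht_generated] applies to one of its rows. *)
have gen (U : 'M_(rdegree S)) : mxmodule S U -> U *m h != 0 -> row_full U.
  move=> modU Uh.
  have modV : mxmodule (tabloid_repr F p (hook p i)) (val_submod U : 'M_(_, #|tabloids p (hook p i)|)).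
    by rewrite (val_submod_module (specht_module F p (hook p i))); exact: modU.
  have [j Uj] : exists j, row j U *m v *m eta != 0.
    apply: contrapT => all0; case/eqP: Uh.
    suff U0 : U *m v *m eta = 0 by rewrite /h (mulmxA U) (mulmxA U) U0 mul0mx.
    apply/row_matrixP=> j; rewrite row0 !row_mul; apply: contrapT => nz; apply: all0.
    by exists j; apply/eqP.
  have jU : (row j U *m v <= val_submod U)%MS.
    by rewrite [val_submod U]val_submodE submxMr ?row_sub.
  have := specht_generated charF p_gt1 le_i modV jU Uj.
  by rewrite -v_specht /v val_submodS sub1mx.
split; first exact: (head_rsim hom_h full_h (harmonic_neq0 le_i) gen).
exact: (unique_max_division_end hom_h full_h gen).
Qed.

(** Only degrees 0 and [p] are possible. Degree 0 is excluded since [v = v a_o e] lies in the image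
    of [e]; hence [v c_o = 0], and [v c_o iota = v] gives [v = 0]. *)
Lemma harmonic_degree0 r : r%:R = 0 :> F -> rdegree (D r) = 0%N.
Proof.
move=> r0; apply/eqP; rewrite /= mxrank_eq0; apply/eqP/row_matrixP=> j.
rewrite row0; have /harmonicP[] := row_sub j (harmonic F p r).
move: (row j _) => v ve vi; rewrite r0 scale0r => vn.
pose o : 'I_p := Ordinal (ltnW p_gt1).
suff vo : v *m cre F o = 0.
  by have := mul_cre_iota v o; rewrite vo vi !mul0mx subr0.
have ev : v = v *m ann F o *m e by rewrite mul_ann_e ve mul0mx subr0.
rewrite [v]row_sum_delta mulmx_suml big1 // => b _.
have [->|vb] := eqVneq (v 0 b) 0; first by rewrite scale0r mul0mx.
suff bT : enum_val b = [set: 'I_p].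
  by rewrite -scalemxAl -[b]enum_valK -/(fock_vec F _) bT fock_vec_cre inE scaler0.
have : #|(enum_val b : {set 'I_p})|%:R = 0 :> F.
  have /rowP/(_ b) := vn.
  rewrite mxE (bigD1 b) //= big1 ?addr0 => [|b' neb]; last first.
    have -> : num b' b = (fock_vec F (enum_val b') *m num) 0 b.
      by rewrite fock_vecE mxE enum_valK.
    by rewrite fock_vec_num !mxE enum_valK eq_sym (negPf neb) andbF !mulr0.
  have -> : num b b = #|(enum_val b : {set 'I_p})|%:R.
    have := fock_vec_num F (enum_val b); rewrite fock_vecE => /rowP/(_ b).
    by rewrite !mxE enum_valK !eqxx mulr1.
  by rewrite mxE => /eqP; rewrite mulf_eq0 (negPf vb) => /eqP.
move/eqP; rewrite -(dvdn_pcharf charF) => p_dvd.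
have leb : (#|(enum_val b : {set 'I_p})| <= p)%N.
  by rewrite -[X in (_ <= X)%N]card_ord max_card.
have [b0 | b_gt0] := posnP #|(enum_val b : {set 'I_p})|; last first.
  apply/eqP; rewrite eqEcard subsetT cardsT card_ord; exact: dvdn_leq.
case/eqP: vb; rewrite ev mulmx_sumr summxE big1 // => x _.
rewrite mxE big1 // => b' _; rewrite [cre _ _ _ _]mxE; case: ifP; rewrite ?mulr0 //.
by move/eqP: b0; rewrite cards_eq0 => /eqP-> /andP[_ /eqP/setP/(_ x)]; rewrite !inE eqxx.
Qed.

Lemma trivial_tensor_of (V X : representation F [set: 'S_p]%G)
    (al : 'cV_(rdegree V)) (be : 'rV_(rdegree V)) :
  (forall g, V g *m al = al) -> al *m be = 1%:M -> be *m al = 1%:M ->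
  mx_rsim (prod_grepr V X) X.
Proof.
move=> alG alb bal; apply/mx_rsim_homP.
pose f : 'M_(rdegree (prod_grepr V X), rdegree X) :=
  block_col (fun a => al a 0 *: 1%:M).
pose h : 'M_(rdegree X, rdegree (prod_grepr V X)) :=
  block_row (fun a => be 0 a *: 1%:M).
have hf : h *m f = 1%:M.
  rewrite [LHS]block_row_col (eq_bigr (fun k => (be 0 k * al k 0) *: 1%:M)).
    rewrite -scaler_suml; have := congr1 (fun A : 'M_1 => A 0 0) bal.
    by rewrite !mxE => ->; rewrite scale1r.
  by move=> k _; rewrite -scalemxAl mul1mx scalerA.
have fh : f *m h = 1%:M.
  rewrite -tprod1; apply: pair2_mxP => a x b y.
  rewrite [LHS](congr1 (fun A : 'M_(_ * _, _) => A _ _) (block_col_mul _ _)).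
  rewrite block_colE tprodEpair -scalemxAl mul1mx mxE block_rowE mxE mulrA.
  by rewrite -alb [in RHS]mxE big_ord1.
have hom_f : mx_hom f.
  move=> g Gg; rewrite [LHS]tprod_block_col [RHS]block_col_mul.
  apply: eq_block_col => a; rewrite (eq_bigr (fun k => (V g a k * al k 0) *: X g)).
    by rewrite -scaler_suml -scalemxAl mul1mx -[in RHS](alG g) [in RHS]mxE.
  by move=> k _; rewrite -scalemxAr mulmx1 scalerA.
exists f, h; split=> // g Gg.
rewrite -[LHS]mul1mx -hf -(mulmxA h) (mulmxA f) -(hom_f g Gg) -(mulmxA _ f) fh.
by rewrite mulmx1.
Qed.

(** [D 1] is the line of [vac e], the sum of all [e_x]. The functional [al] reads the coefficient at
    [o], and it is invariant because every other point gives the same coefficient. *)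
Lemma trivial_tensor (X : representation F [set: 'S_p]%G) :
  stably_iso (prod_grepr (D 1) X) X.
Proof.
have o : 'I_p := Ordinal (ltnW p_gt1).
have /harmonicP[Ie _ In] := inc_harmonic F p 1.
have def_inc x : inc F p 1 *m ann F x *m vac^T *m vac *m e = inc F p 1.
  rewrite -(degree1_ann charF); last by rewrite In scale1r.
  by rewrite mul_ann_e Ie mul0mx subr0.
pose al := inc F p 1 *m ann F o *m vac^T.
have alE x : inc F p 1 *m ann F x *m vac^T = al.
  rewrite /al -{1}(def_inc o); set W := inc F p 1 *m ann F o *m vac^T.
  by rewrite -(mulmxA W) -(mulmxA W) -(mulmxA W) vac_e_ann mulmx1.
apply: rsim_stably_iso.
apply: (@trivial_tensor_of (D 1) X al (vac *m e *m out F p 1)) => [g||].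
- rewrite /al -(mulmxA (inc F p 1)) (mulmxA (D 1 g)) incJ.
  rewrite -(mulmxA (inc F p 1)) (mulmxA (fock_mx F g)).
  rewrite -[in LHS](permKV g o) -fock_ann -(mulmxA (ann F _)) act_vacT.
  rewrite !(mulmxA (inc F p 1)); exact: alE.
- rewrite /al (mulmxA _ (vac *m e)) (mulmxA _ vac) def_inc.
  exact: incK.
rewrite /al; have := outK (vac_e_harmonic charF).
move: (vac *m e *m out F p 1) (inc F p 1) => W W' eqW.
by rewrite !(mulmxA W) eqW vac_e_ann.
Qed.

End HookSimple.

(** * The fusion rule *)

Section Fusion.

Variables (F : fieldType) (p : nat).
Hypothesis charF : p \in [pchar F].

(** The shift matches the hook label [t] with exterior degree [t + 1]. *)
Local Notation H t := (harmonic_rep F p t.+1).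
Local Notation "\bigH_ ( t <- r )" := (\big[@dadd_grepr F _ _/grepr0]_(t <- r) H t) (t name, at level 0).

Lemma Rset0 j : (1 < p)%N -> (j <= p - 2)%N -> Rset p 0 j = [:: j].
Proof.
move=> p_gt1 le_j; rewrite /Rset /ell /rr leq0n subn0 leq0n add0n subnn /=.
by rewrite addn0.
Qed.

Lemma degree0_stably_iso (X Y : representation F [set: 'S_p]%G) :
  rdegree Y = 0%N -> stably_iso (dadd_grepr X Y) X.
Proof.
move/rsim_degree0/rsim_stably_iso=> Y0.
apply: stably_iso_trans (stably_iso_dadd (stably_iso_refl X) Y0) _.
exact: dadd_projective_stably_iso (@grepr0_projective _ _ _).
Qed.

(** At the ends one of the two summands lies in a degenerate degree and vanishes: degree 0 for
    [j = 0], degree [p] for [j = p - 2]. *)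
Lemma harmonic_tensor2 j : (2 < p)%N -> (j <= p - 2)%N ->
  stably_iso (prod_grepr (H 1) (H j)) (\bigH_(t <- Rset p 1 j)).
Proof.
move=> p_gt2 le_j; have o : 'I_p := Ordinal (ltnW (ltnW p_gt2)).
have lt_j : (j.+1 < p)%N by lia.
have p0 : p%:R = 0 :> F by have /andP[_ /eqP] := charF.
apply: stably_iso_trans
  (harmonic_tensor charF (standard_section_harmonic charF o) o lt_j) _.
have memR t : (t \in Rset p 1 j) = [&& 1 <= j + t, j <= 1 + t, t <= 1 + j,
    t + 1 + j <= 2 * p - 4 & ~~ odd (t + 1 + j)]%N by apply: mem_Rset; lia.
have bigR r : uniq r -> r =i Rset p 1 j ->
    stably_iso (\bigH_(t <- r)) (\bigH_(t <- Rset p 1 j)).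
  by move=> ur eqr; apply/bigdadd_perm/uniq_perm; rewrite ?uniq_Rset.
have sing s : stably_iso (H s) (\bigH_(t <- [:: s])).
  apply: stably_iso_sym; rewrite big_cons big_nil.
  exact: dadd_projective_stably_iso (@grepr0_projective _ _ _).
have [j0 | j_gt0] := posnP j; last have [eq_j | ne_j] := eqVneq j (p - 2)%N.
- rewrite j0; apply: stably_iso_trans (degree0_stably_iso _ (harmonic_degree0 charF _)) _.
    by [].
  apply: stably_iso_trans (sing 1%N) _; rewrite -[X in Rset _ _ X]j0.
  by apply: bigR => // t; rewrite memR inE; lia.
- have def_p : p = j.+2 by lia.
  apply: stably_iso_trans (rsim_stably_iso (dadd_comm _ _)) _.
  apply: stably_iso_trans (degree0_stably_iso _ (harmonic_degree0 charF _)) _.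
    by rewrite -def_p.
  rewrite -(prednK j_gt0).
  apply: stably_iso_trans (sing j.-1) _; rewrite prednK //; apply: bigR => // t.
  by rewrite memR inE; lia.
rewrite -{2}(prednK j_gt0).
apply: stably_iso_trans (stably_iso_dadd (stably_iso_refl _) (sing j.-1)) _.
have -> : dadd_grepr (harmonic_rep F p j.+2) (\bigH_(t <- [:: j.-1]))
   = \bigH_(t <- [:: j.+1; j.-1]) by rewrite [in RHS]big_cons.
apply: bigR => [|t]; first by rewrite /= inE andbT; lia.
by rewrite memR !inE; lia.
Qed.

Lemma fusion_step i j : (0 < i)%N -> (i.+1 <= p - 2)%N -> (j <= p - 2)%N ->
  stably_iso (prod_grepr (H i) (H j)) (\bigH_(t <- Rset p i j)) ->
  stably_iso (prod_grepr (H i.-1) (H j)) (\bigH_(t <- Rset p i.-1 j)) ->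
  stably_iso (prod_grepr (H i.+1) (H j)) (\bigH_(t <- Rset p i.+1 j)).
Proof.
move=> i_gt0 lt_i le_j IHi IHi1; have o : 'I_p by apply: Ordinal (_ : (0 < p)%N); lia.
have le_R t : t \in Rset p i j -> (t <= p - 2)%N.
  by rewrite mem_Rset; lia.
(* The sum over [Rset p i.-1 j], stably [H i.-1 (x) H j], is added to both sides. *)
apply: (@bigdadd_cancel _ _ _ _ (fun t => H t) _ _ (Rset p i.-1 j)) => [t|].
  by rewrite mem_Rset => [t_R|||]; try apply: (hook_simple_harmonic charF _).2; lia.
apply: stably_iso_trans
  (stably_iso_dadd (stably_iso_refl _) (stably_iso_sym IHi1)) _.
apply: stably_iso_trans (stably_iso_sym (rsim_stably_iso (prod_daddl _ _ _))) _.
(* Since [i > 0], [H i.-1] is the harmonic module of degree [i], so the two left factors recombine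
   into [H 1 (x) H i]. *)
rewrite (prednK i_gt0); have lt_ip : (i.+1 < p)%N by lia.
apply: stably_iso_trans (stably_iso_prod (stably_iso_sym
  (harmonic_tensor charF (standard_section_harmonic charF o) o lt_ip))
  (stably_iso_refl _)) _.
apply: stably_iso_trans (rsim_stably_iso (prod_assoc _ _ _)) _.
apply: stably_iso_trans (stably_iso_prod (stably_iso_refl _) IHi) _.
apply: stably_iso_trans (prod_bigdaddr _ _ _) _.
apply: stably_iso_trans (bigdadd_stably_iso
  (fun t (tR : t \in Rset p i j) => harmonic_tensor2 _ (le_R t tR))) _; first by lia.
apply: stably_iso_trans (stably_iso_sym (bigdadd_flatten _ _ _)) _.
by apply: stably_iso_trans (bigdadd_perm _ (Rset_step i_gt0 lt_i le_j)) (bigdadd_cat _ _ _).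
Qed.

Lemma harmonic_fusion i j : (i <= p - 2)%N -> (j <= p - 2)%N ->
  stably_iso (prod_grepr (H i) (H j)) (\bigH_(t <- Rset p i j)).
Proof.
move=> + le_j; have p_gt1 := prime_gt1 (pcharf_prime charF).
have base : stably_iso (prod_grepr (H 0) (H j)) (\bigH_(t <- Rset p 0 j)).
  apply: stably_iso_trans (trivial_tensor charF _) _.
  rewrite Rset0 // big_cons big_nil; apply: stably_iso_sym.
  exact: dadd_projective_stably_iso (@grepr0_projective _ _ _).
elim/ltn_ind: i => -[_ _ | [_ le_1 | i IH le_i]]; first exact: base.
  by apply: harmonic_tensor2; lia.
by apply: fusion_step => //; apply: IH; lia.
Qed.

End Fusion.

Theorem theorem4p2 (F : closedFieldType) (p : nat) (charF : p \in [pchar F])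
    (i j k l : nat)
    (hi : (i <= p - 2)%N) (hj : (j <= p - 2)%N)
    (hk : (k <= p - 2)%N) (hl : (l <= p - 2)%N) :
  mx_rsim
    (core (prod_grepr (omega k (hook_simple F p i))
                      (omega l (hook_simple F p j))))
    (\big[dadd_grepr/grepr0]_(t <- Rset p i j) omega (k + l)%N (hook_simple F p t)).
Proof.
(* Neither side has a nonzero projective summand, so a stable isomorphism suffices. *)
apply: projective_free_rsim.
- exact: core_projective_free.
- by apply: bigdadd_projective_free => t; apply: omega_projective_free.
have stab s (le_s : (s <= p - 2)%N) := rsim_stably_iso (hook_simple_harmonic charF le_s).1.
have p_gt1 := prime_gt1 (pcharf_prime charF).
apply: stably_iso_trans (core_stably_iso _) _.
apply: stably_iso_trans
  (stably_iso_prod (omega_stably_iso _ _) (omega_stably_iso _ _)) _.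
(* The Heller operators are pulled out of the left factor, then of the right one, and add up to
   [k + l] iterations. *)
apply: stably_iso_trans (iter_heller_prodl _ _ _) _.
apply: stably_iso_trans (iter_heller_stably_iso _ (iter_heller_prodr _ _ _)) _.
rewrite -iterD.
apply: stably_iso_trans (iter_heller_stably_iso _ _) _.
  apply: stably_iso_trans (stably_iso_prod (stab i hi) (stab j hj)) _.
  exact: harmonic_fusion.
apply: stably_iso_trans (iter_heller_bigdadd _ _ _) _.
apply: bigdadd_stably_iso => t; rewrite mem_Rset // => t_R.
apply: stably_iso_sym; apply: stably_iso_trans (omega_stably_iso _ _) _.
by apply/iter_heller_stably_iso/stab; lia.
Qed.
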